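(* Let $n\in\mathbb{N}$, $j\in\{1,\dots,D\}$, and let $\hat A$ be one of the operators $\mathrm{Id}$, $\hat q_j^n$, $\hat p_j^n$ or $\hat H$. Let $\tau>0$ be a fixed time and let $\rho>0$ be a probability density on $\mathbb{R}^{4D}$. If $\psi_0\in\mathcal{S}(\mathbb{R}^D)$ with $\|\psi_0\|_{L^2}=1$, then for all times $t\in[0,\tau]$ the crude Monte Carlo estimator $$A_N(t)=\frac1N\sum_{j=1}^N\frac{f_0(w_j)}{\rho(w_j)}\Phi_t(w_j)O_t[\hat A](w_j),$$ where $w_1,w_2,\dots\in\mathbb{R}^{4D}$ are independent and identically distributed with respect to $\rho$, converges almost surely to $\langle\hat A\rangle_t$ as $N\to\infty$.
   Context: Fix a dimension $D\ge 1$, a semiclassical parameter $\epsilon>0$ (thought of as $0<\epsilon\ll 1$), a real symmetric positive-definite matrix $\Gamma\in\mathbb{R}^{D\times D}$, and a smooth potential $V:\mathbb{R}^D\to\mathbb{R}$ that is sub-quadratic, meaning that all partial derivatives of $V$ of order at least $2$ are bounded. $\langle\cdot,\cdot\rangle$ is the $L^2(\mathbb{R}^D)$ inner product $\langle\phi,\psi\rangle=\int\overline{\phi}\,\psi\,dx$. A density written $\rho>0$ is allowed to vanish on Lebesgue null sets. Operators: $\hat q_j$ is multiplication by $x_j$, $\hat p_j=-i\epsilon\partial_{x_j}$, $T=-\frac{\epsilon^2}{2}\Delta$, $V$ also denotes multiplication by $V(x)$, and $\hat H=T+V$. Gaussians: for $z=(q,p)\in\mathbb{R}^{2D}$, $$g_z(x)=\left(\frac{\det\Gamma}{\pi^D\epsilon^D}\right)^{1/4}\exp\left(-\frac{1}{2\epsilon}(x-q)^T\Gamma(x-q)+\frac{i}{\epsilon}p^T(x-q)\right).$$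 Classical quantities: let $h(q,p)=\frac12|p|^2+V(q)$ and $J=\begin{pmatrix}0&\mathrm{Id}_D\\-\mathrm{Id}_D&0\end{pmatrix}$. For $z\in\mathbb{R}^{2D}$, $z(t)=(q(t),p(t))$ solves $\dot z(t)=J\nabla h(z(t))$, $z(0)=z$; the action solves $\dot S_t(z)=\frac12|p(t)|^2-V(q(t))$, $S_0(z)=0$; the stability matrix $M(t)=\partial z(t)/\partial z$ solves $\dot M(t)=J\,\mathrm{Hess}\,h(z(t))\,M(t)$, $M(0)=\mathrm{Id}_{2D}$, with $D\times D$ blocks $M_{qq},M_{qp},M_{pq},M_{pp}$ ($M_{\alpha\beta}=\partial\alpha(t)/\partial\beta$). The Herman--Kluk prefactor is $$R_t(z)=2^{-D/2}\det\left(M_{qq}+\Gamma^{-1}M_{pp}\Gamma-iM_{qp}\Gamma+i\Gamma^{-1}M_{pq}\right)^{1/2},$$ with the branch of the square root chosen continuously in $t$ and $R_0=1$. For $w=(y,z)\in\mathbb{R}^{4D}$ with $y,z\in\mathbb{R}^{2D}$, define $$f_0(y,z)=(2\pi\epsilon)^{-2D}\langle\psi_0,g_y\rangle\langle g_z,\psi_0\rangle,$$ $$\Phi_t(y,z)=\overline{R_t(y)}R_t(z)\exp[i(S_t(z)-S_t(y))/\epsilon],\qquad O_t[\hat A](y,z)=\langle g_{y(t)},\hat A g_{z(t)}\rangle,$$ and the Herman--Kluk expectation value $\langle\hat A\rangle_t=\int_{\mathbb{R}^{4D}}f_0(w)\Phi_t(w)O_t[\hat A](w)\,dw$. *)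

(* Defs.v *)
From HB Require Import structures.
From mathcomp Require Import all_boot all_order all_algebra.
From mathcomp Require Import complex.
From mathcomp Require Import all_classical all_reals all_analysis.
Set Implicit Arguments.
Unset Strict Implicit.
Unset Printing Implicit Defensive.
Import Order.TTheory GRing.Theory Num.Theory.
Import numFieldNormedType.Exports.
Local Open Scope classical_set_scope.
Local Open Scope ring_scope.
Local Open Scope complex_scope.

(* Points of R^n are column vectors 'cV[R]_n; a phase space point (q, p) is
   col_mx q p : 'cV[R]_(D + D), and a pair of phase space points (y, z) is
   col_mx y z : 'cV[R]_((D + D) + (D + D)). *)

(* The product sigma-algebra on 'cV[T]_n, generated by the coordinate maps; for
   T = R it is the Borel sigma-algebra of R^n. *)
Definition measure_cV_display : measure_display -> measure_display.
Proof. exact. Qed.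

Section measurable_cV.
Context d (T : measurableType d) (n : nat).

Definition cV_coord (i : 'I_n) (v : 'cV[T]_n) : T := v i ord0.

Let cV_set0 : g_sigma_preimage cV_coord set0.
Proof. exact: sigma_algebra0. Qed.

Let cV_setC A : g_sigma_preimage cV_coord A -> g_sigma_preimage cV_coord (~` A).
Proof. exact: sigma_algebraC. Qed.

Let cV_bigcup (F : (set 'cV[T]_n)^nat) :
  (forall i, g_sigma_preimage cV_coord (F i)) ->
  g_sigma_preimage cV_coord (\bigcup_i (F i)).
Proof. exact: sigma_algebra_bigcup. Qed.

HB.instance Definition _ := @isMeasurable.Build (measure_cV_display d)
  'cV[T]_n (g_sigma_preimage cV_coord) cV_set0 cV_setC cV_bigcup.

Lemma measurable_cV_coord (i : 'I_n) : measurable_fun [set: 'cV[T]_n] (cV_coord i).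
Proof.
move=> _ Y mY; rewrite setTI; apply: sub_sigma_algebra => /=.
rewrite -bigcup_seq/=; exists i => /=; first by rewrite mem_index_enum.
by exists Y => //; rewrite setTI.
Qed.

Lemma measurable_fun_cV d' (U : measurableType d') (f : U -> 'cV[T]_n) :
  (forall i, measurable_fun [set: U] (cV_coord i \o f)) ->
  measurable_fun [set: U] f.
Proof.
move=> mf.
suff H : g_sigma_preimage (fun i => cV_coord i \o f) `<=` measurable.
  rewrite g_sigma_preimage_comp in H.
  by move=> _ A mA; apply: H; exists A.
apply: smallest_sub; first exact: sigma_algebra_measurable.
rewrite -bigcup_seq /=; apply: bigcup_sub => i _ A [B mB <-].
exact: mf.
Qed.

End measurable_cV.

Section cV_cons.
Context (R : realType) (n : nat).

Definition cV_cons (p : R * 'cV[R]_n) : 'cV[R]_n.+1 :=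
  col_mx (p.1%:M : 'cV_1) p.2.

Definition cV_uncons (v : 'cV[R]_n.+1) : R * 'cV[R]_n :=
  ((usubmx (v : 'cV_(1 + n))) ord0 ord0, dsubmx (v : 'cV_(1 + n))).

Lemma cV_consK : cancel cV_cons cV_uncons.
Proof.
by case=> a v; rewrite /cV_uncons /cV_cons col_mxKu col_mxKd/= mxE eqxx mulr1n.
Qed.

Lemma cV_cons0 p : cV_cons p ord0 ord0 = p.1.
Proof.
rewrite (_ : ord0 = @lshift 1 n ord0 :> 'I_(1 + n)); last exact: val_inj.
by rewrite /cV_cons; apply: etrans (col_mxEu _ _ _ _) _; rewrite mxE eqxx mulr1n.
Qed.

Lemma cV_consS p (i : 'I_n) : cV_cons p (lift ord0 i) ord0 = p.2 i ord0.
Proof.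
rewrite (_ : lift ord0 i = @rshift 1 n i :> 'I_(1 + n)); last exact: val_inj.
by rewrite /cV_cons; exact: col_mxEd.
Qed.

Lemma measurable_cV_cons : measurable_fun [set: R * 'cV[R]_n] cV_cons.
Proof.
apply: measurable_fun_cV => i.
case: (unliftP ord0 i) => [j ->|->].
  rewrite (_ : _ \o _ = cV_coord j \o snd).
    by apply: measurableT_comp => //; exact: measurable_cV_coord.
  by apply/funext => p; exact: cV_consS.
by rewrite (_ : _ \o _ = fst)//; apply/funext => p; exact: cV_cons0.
Qed.

Lemma measurable_cV_uncons : measurable_fun [set: 'cV[R]_n.+1] cV_uncons.
Proof.
apply/measurable_fun_pairP; split.
  rewrite (_ : _ \o _ = @cV_coord _ _ n.+1 (@lshift 1 n ord0)).
    exact: measurable_cV_coord.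
  by apply/funext => v /=; rewrite mxE.
apply: measurable_fun_cV => i.
rewrite (_ : _ \o _ = @cV_coord _ _ n.+1 (@rshift 1 n i)).
  exact: measurable_cV_coord.
by apply/funext => v /=; rewrite /cV_coord mxE.
Qed.

End cV_cons.

(* The library's instance for this fact is masked by a later instance on
   product_measure1, so it is not found by unification. *)
Lemma sigma_finite_prod d1 d2 (T1 : measurableType d1) (T2 : measurableType d2)
    (R : realType) (m1 : {sigma_finite_measure set T1 -> \bar R})
    (m2 : {sigma_finite_measure set T2 -> \bar R}) :
  sigma_finite setT (m1 \x m2)%E.
Proof.
have /sigma_finiteP[F [TF ndF Foo]] := sigma_finiteT m1.
have /sigma_finiteP[G [TG ndG Goo]] := sigma_finiteT m2.
exists (fun n => F n `*` G n).
  rewrite -setXTT TF TG predeqE => -[x y]; split.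
    move=> [/= [n _ Fnx] [k _ Gky]]; exists (maxn n k) => //; split.
    - by move: x Fnx; exact/subsetPset/ndF/leq_maxl.
    - by move: y Gky; exact/subsetPset/ndG/leq_maxr.
  by move=> [n _ []/= ? ?]; split; exists n.
move=> k; have [? ?] := Foo k; have [? ?] := Goo k.
split; first exact: measurableX.
by rewrite product_measure1E// lte_mul_pinfty// ge0_fin_numE.
Qed.

Section lebesgue_cons.
Context (R : realType) (n : nat).
Variable mu : {sigma_finite_measure set 'cV[R]_n -> \bar R}.
Local Open Scope ereal_scope.

Definition lebesgue_cons : set 'cV[R]_n.+1 -> \bar R :=
  pushforward (@lebesgue_measure R \x mu) (@cV_cons R n).

Let lebesgue_cons0 : lebesgue_cons set0 = 0.
Proof. by rewrite /lebesgue_cons /pushforward preimage_set0 measure0. Qed.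

Let lebesgue_cons_ge0 A : 0 <= lebesgue_cons A.
Proof. by rewrite /lebesgue_cons /pushforward; exact: measure_ge0. Qed.

Let lebesgue_cons_sigma_additive : semi_sigma_additive lebesgue_cons.
Proof.
move=> F mF tF mUF; rewrite /lebesgue_cons /pushforward preimage_bigcup.
apply: measure_semi_sigma_additive.
- by move=> k; rewrite -[X in measurable X]setTI; exact: measurable_cV_cons.
- apply/trivIsetP => /= i j _ _ ij; rewrite -preimage_setI.
  by move/trivIsetP : tF => /(_ _ _ _ _ ij) ->//; rewrite preimage_set0.
- by rewrite -preimage_bigcup -[X in measurable X]setTI; exact: measurable_cV_cons.
Qed.

HB.instance Definition _ := isMeasure.Build _ _ _ lebesgue_cons
  lebesgue_cons0 lebesgue_cons_ge0 lebesgue_cons_sigma_additive.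

Let lebesgue_cons_sigma_finite : sigma_finite setT lebesgue_cons.
Proof.
have /= [F FT Foo] := sigma_finite_prod (@lebesgue_measure R) mu.
exists (fun k => @cV_uncons R n @^-1` F k).
  by rewrite -preimage_bigcup -FT preimage_setT.
move=> k; have [mF Fk] := Foo k; split.
  by rewrite -[X in measurable X]setTI; exact: measurable_cV_uncons.
rewrite /lebesgue_cons /pushforward -comp_preimage.
by rewrite (_ : _ \o _ = id)//; apply/funext => p; exact: cV_consK.
Qed.

HB.instance Definition _ := Measure_isSigmaFinite.Build _ _ _ lebesgue_cons
  lebesgue_cons_sigma_finite.

End lebesgue_cons.

(* Lebesgue measure on R^n, as the n-fold product of lebesgue_measure. *)
Fixpoint lebesgue_cV (R : realType) (n : nat) :
    {sigma_finite_measure set 'cV[R]_n -> \bar R} :=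
  if n is n'.+1 then lebesgue_cons (lebesgue_cV R n') else \d_(0 : 'cV[R]_0).

Lemma lebesgue_cV_box (R : realType) n (B : 'I_n -> set R) :
  (forall i, measurable (B i)) ->
  lebesgue_cV R n [set v : 'cV[R]_n | forall i, B i (v i ord0)] =
  (\prod_(i < n) lebesgue_measure (B i))%E.
Proof.
elim: n B => [|n IH] B mB.
  rewrite big_ord0/= diracE mem_set//= => -[]//.
rewrite big_ord_recl -(IH (fun i => B (lift ord0 i))); last first.
  by move=> i; exact: mB.
rewrite -[RHS](@product_measure1E _ _ _ _ _ lebesgue_measure
  (lebesgue_cV R n))//; last first.
  rewrite (_ : mkset _ =
      \bigcap_(i in [set: 'I_n]) (@cV_coord _ R n i @^-1` B (lift ord0 i))); last first.
    by apply/seteqP; split => v /= Bv i; [move=> _; exact: Bv|exact: (Bv i)].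
  apply: fin_bigcap_measurable => // i _.
  rewrite -[X in measurable X]setTI.
  by apply: (@measurable_cV_coord _ _ n i) => //; exact: mB.
  exact: mB.
rewrite /= /lebesgue_cons /pushforward; congr (product_measure1 _ _ _).
apply/seteqP; split => [[a v] /= Bav|[a v] /= [Ba Bv] i].
  split=> [|i]; first by have := Bav ord0; rewrite cV_cons0.
  by have := Bav (lift ord0 i); rewrite cV_consS.
case: (unliftP ord0 i) => [j ->|->]; last by rewrite cV_cons0.
by rewrite cV_consS; exact: Bv.
Qed.

Section complex_valued.
Context (R : realType).

Definition expC (z : R[i]) : R[i] :=
  (expR (complex.Re z))%:C * (cos (complex.Im z) +i* sin (complex.Im z)).

Definition Cintegral d (T : measurableType d) (mu : {measure set T -> \bar R})
    (f : T -> R[i]) : R[i] :=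
  (\int[mu]_x complex.Re (f x)) +i* (\int[mu]_x complex.Im (f x)).

Definition inner n (phi psi : 'cV[R]_n -> R[i]) : R[i] :=
  Cintegral (lebesgue_cV R n) (fun x => (phi x)^*%C * psi x).

Definition L2norm n (phi : 'cV[R]_n -> R[i]) : R :=
  Num.sqrt (complex.Re (inner phi phi)).

End complex_valued.

Section smooth_functions.
Context (R : realType) (n : nat).
Implicit Types (f : 'cV[R]_n -> R) (phi : 'cV[R]_n -> R[i]).

Definition partial (i : 'I_n) f : 'cV[R]_n -> R := 'D_(delta_mx i ord0) f.

(* A multi-index of order k is given as a sequence of k directions. *)
Definition partials (s : seq 'I_n) f : 'cV[R]_n -> R := foldr partial f s.

Definition grad f (x : 'cV[R]_n) : 'cV[R]_n := \col_i partial i f x.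

Definition Hess f (x : 'cV[R]_n) : 'M[R]_n :=
  \matrix_(i, j) partial i (partial j f) x.

(* C^oo: existence of all iterated partial derivatives is not enough, they must
   also be continuous. *)
Definition smooth f := forall s : seq 'I_n,
  continuous (partials s f) /\
  forall i x, derivable (partials s f) x (delta_mx i ord0).

Definition subquadratic f := smooth f /\
  forall s : seq 'I_n, (2 <= size s)%N ->
    exists C : R, forall x, `|partials s f x| <= C.

(* R[i] carries no normed R-module structure in the library, so derivatives of
   complex-valued functions are taken on real and imaginary parts. *)
Definition Cpartial (i : 'I_n) phi : 'cV[R]_n -> R[i] :=
  fun x => partial i (fun y => complex.Re (phi y)) x +i*
           partial i (fun y => complex.Im (phi y)) x.

Definition Cpartials (s : seq 'I_n) phi : 'cV[R]_n -> R[i] :=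
  foldr Cpartial phi s.

Definition schwartz phi :=
  [/\ smooth (fun x => complex.Re (phi x)),
      smooth (fun x => complex.Im (phi x)) &
    forall (a : 'I_n -> nat) (s : seq 'I_n), exists C : R, forall x : 'cV[R]_n,
      `|(\prod_i x i ord0 ^+ a i)%:C * Cpartials s phi x| <= C%:C].

End smooth_functions.

Section herman_kluk.
Context (R : realType) (D : nat) (eps : R) (Gamma : 'M[R]_D)
  (V : 'cV[R]_D -> R).

Local Notation wavefun := ('cV[R]_D -> R[i]).
Local Notation phase := 'cV[R]_(D + D).

Definition qhat (j : 'I_D) (phi : wavefun) : wavefun :=
  fun x => (x j ord0)%:C * phi x.

Definition phat (j : 'I_D) (phi : wavefun) : wavefun :=
  fun x => - 'i%C * eps%:C * Cpartial j phi x.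

Definition That (phi : wavefun) : wavefun :=
  fun x => - (eps ^+ 2 / 2)%:C * \sum_(j < D) Cpartial j (Cpartial j phi) x.

Definition Hhat (phi : wavefun) : wavefun :=
  fun x => That phi x + (V x)%:C * phi x.

Definition gaussian (z : phase) : wavefun := fun x =>
  let q := usubmx z in let p := dsubmx z in
  ((\det Gamma / (pi ^+ D * eps ^+ D)) `^ (4^-1))%:C *
  expC ((- (2 * eps)^-1 * ((x - q)^T *m Gamma *m (x - q)) ord0 ord0)%:C +
        'i%C / eps%:C * ((p^T *m (x - q)) ord0 ord0)%:C).

Definition sqnorm (p : 'cV[R]_D) : R := (p^T *m p) ord0 ord0.

Definition hamiltonian (z : phase) : R :=
  2^-1 * sqnorm (dsubmx z) + V (usubmx z).

Definition symplJ : 'M[R]_(D + D) := block_mx 0 1%:M (- 1%:M) 0.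

(* In the predicates below flow t z, S t z and M t z are the position at time
   t of the trajectory starting at z, its action and its stability matrix
   (rows: components of flow t z, columns: components of z). *)
Definition is_flow (flow : R -> phase -> phase) := forall z : phase,
  flow 0 z = z /\
  forall t : R, is_derive t 1 (fun s => flow s z)
    (symplJ *m grad hamiltonian (flow t z)).

Definition is_action (flow : R -> phase -> phase) (S : R -> phase -> R) :=
  forall z : phase, S 0 z = 0 /\
  forall t : R, is_derive t 1 (fun s => S s z)
    (2^-1 * sqnorm (dsubmx (flow t z)) - V (usubmx (flow t z))).

Definition is_stability (flow : R -> phase -> phase)
    (M : R -> phase -> 'M[R]_(D + D)) := forall z : phase,
  [/\ forall t i j, is_derive z (delta_mx j ord0)
        (fun y : phase => flow t y i ord0) (M t z i j),
      M 0 z = 1%:M &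
      forall t : R, is_derive t 1 (fun s => M s z)
        (symplJ *m Hess hamiltonian (flow t z) *m M t z)].

Definition HK_matrix (M : 'M[R]_(D + D)) : 'M[R[i]]_D :=
  let toC (A : 'M[R]_D) := map_mx (real_complex R) A in
  let Mqq := ulsubmx M in let Mqp := ursubmx M in
  let Mpq := dlsubmx M in let Mpp := drsubmx M in
  toC Mqq + toC (invmx Gamma *m Mpp *m Gamma)
  - 'i%C *: toC (Mqp *m Gamma) + 'i%C *: toC (invmx Gamma *m Mpq).

Definition HK_prefactor (r : R[i]) : R[i] := (2 `^ (- (D%:R / 2)))%:C * r.

(* r t z is the square root of the determinant, on the branch continuous in t
   and normalized so that the prefactor is 1 at t = 0. *)
Definition is_HK_root (M : R -> phase -> 'M[R]_(D + D))
    (r : R -> phase -> R[i]) := forall z : phase,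
  [/\ forall t, r t z ^+ 2 = \det (HK_matrix (M t z)),
      continuous (fun t => r t z : R[i]^o) &
      HK_prefactor (r 0 z) = 1].

Local Notation pphase := 'cV[R]_((D + D) + (D + D)).

Definition HK_f0 (psi0 : wavefun) (w : pphase) : R[i] :=
  ((2 * pi * eps) ^- (2 * D))%:C *
  inner psi0 (gaussian (usubmx w)) * inner (gaussian (dsubmx w)) psi0.

Definition HK_Phi (S : R -> phase -> R) (r : R -> phase -> R[i]) (t : R)
    (w : pphase) : R[i] :=
  let y := usubmx w in let z := dsubmx w in
  (HK_prefactor (r t y))^*%C * HK_prefactor (r t z) *
  expC ('i%C * (S t z - S t y)%:C / eps%:C).

Definition HK_O (flow : R -> phase -> phase) (A : wavefun -> wavefun) (t : R)
    (w : pphase) : R[i] :=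
  inner (gaussian (flow t (usubmx w))) (A (gaussian (flow t (dsubmx w)))).

Definition HK_expectation psi0 flow S r A (t : R) : R[i] :=
  Cintegral (lebesgue_cV R ((D + D) + (D + D)))
    (fun w => HK_f0 psi0 w * HK_Phi S r t w * HK_O flow A t w).

Definition HK_estimator psi0 flow S r A (rho : pphase -> R)
    (w : nat -> pphase) (t : R) (N : nat) : R[i] :=
  N%:R^-1 * \sum_(k < N)
    HK_f0 psi0 (w k) / (rho (w k))%:C * HK_Phi S r t (w k) *
    HK_O flow A t (w k).

End herman_kluk.

Section probability_notions.
Context (R : realType) (n : nat).

(* A density is positive up to a Lebesgue null set, on which it may vanish. *)
Definition prob_density (rho : 'cV[R]_n -> R) :=
  [/\ measurable_fun setT rho, forall w, 0 <= rho w,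
      {ae lebesgue_cV R n, forall w, 0 < rho w} &
      (\int[lebesgue_cV R n]_w (rho w)%:E = 1)%E].

Definition has_density d (Omega : measurableType d) (P : probability Omega R)
    (X : {RV P >-> 'cV[R]_n}) (rho : 'cV[R]_n -> R) :=
  forall B : set 'cV[R]_n, measurable B ->
    distribution P X B = (\int[lebesgue_cV R n]_(w in B) (rho w)%:E)%E.

Definition mutually_independent d (Omega : measurableType d)
    (P : probability Omega R) (X : nat -> {RV P >-> 'cV[R]_n}) :=
  forall (I : seq nat) (B : nat -> set 'cV[R]_n), uniq I ->
    (forall k, measurable (B k)) ->
    P (\bigcap_(k in [set` I]) (X k @^-1` B k)) =
    (\prod_(k <- I) P (X k @^-1` B k))%E.

End probability_notions.

(* Main.v *)
Require Import Defs.
From HB Require Import structures.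
From mathcomp Require Import all_boot all_order all_algebra.
From mathcomp Require Import complex.
From mathcomp Require Import all_classical all_reals all_analysis.
From mathcomp Require Import perm measurable_realfun.
From mathcomp Require Import ring lra.
Set Implicit Arguments.
Unset Strict Implicit.
Unset Printing Implicit Defensive.
Import Order.TTheory GRing.Theory Num.Theory.
Import numFieldNormedType.Exports.
Local Open Scope classical_set_scope.
Local Open Scope ring_scope.
Local Open Scope complex_scope.

(** The terms of the estimator are the values, at independent samples of density
    [rho], of [F / rho], where [F] is the product of the initial amplitude, the
    Herman-Kluk phase factor and the matrix element of the observable. Since
    [rho] is positive almost everywhere, the expectation of [F / rho] is the
    integral of [F], provided that [F] is integrable. The theorem is therefore the
    strong law of large numbers, together with the measurability and
    integrability of [F].

    The strong law ([strong_law]) is proved by Etemadi's method: truncated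
    averages converge along geometrically growing times because the sum of their
    variances is finite, and monotonicity of the partial sums of nonnegative
    variables fills the gaps. [Cimportance_sampling] applies it
    to the real and imaginary parts of [F / rho].

    Integrability of [F] ([HK_integrand_bound]) balances decay against growth.
    - The inner products of a Schwartz function with wave packets decay faster than
      any power of the centre of the packet ([inner_gaussian_decay]): in the
      position because the function decays, in the momentum by integration by parts.
    - An observable multiplies the wave packet by a polynomial, to which the Hamiltonian
      adds [V]; hence its
      matrix elements grow at most polynomially in the centre
      ([matrix_element_bound]). The Hamiltonian vector field is globally Lipschitz
      because the second derivatives of [V] are bounded, so by Gronwall's inequality
      the flow at a fixed time grows at most linearly ([flow_growth]).
    - The flow is Lipschitz, so the stability matrix is bounded and so is the
      prefactor, whose square is a determinant in its entries ([HK_root_bound]).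

    Measurability of [F] is immediate except for the prefactor, the branch of a
    square root that is continuous in time. The stability matrix is symplectic
    because the Hessian of the Hamiltonian is symmetric ([stability_symplectic]),
    and for symplectic matrices the determinant under the root does not vanish
    ([HK_det_neq0]). The branch can thus be followed along a fine partition of the
    time interval, which writes it as a limit of explicit measurable functions of
    the determinants ([Cmeasurable_continuous_root]). *)

(** * Measurability on R^n *)

Section measurable_cV_continuous.
Context {R : realType} {n : nat}.

Definition grid (k : nat) (x : 'cV[R]_n) : 'cV[R]_n :=
  \col_i ((Num.floor (k.+1%:R * x i ord0))%:~R / k.+1%:R).

Lemma mx_norm_le (m p : nat) (A : 'M[R]_(m, p)) (e : R) : 0 <= e ->
  (forall i j, `|A i j| <= e) -> `|A| <= e.
Proof.
move=> e0 Ae; rewrite [leLHS]/Num.Def.normr/= mx_normrE.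
by apply: bigmax_le => // -[i j] _; exact: Ae.
Qed.

Lemma le_mx_norm (m p : nat) (A : 'M[R]_(m, p)) i j : `|A i j| <= `|A|.
Proof.
rewrite [leRHS]/Num.Def.normr/= mx_normrE.
exact: (le_bigmax _ (fun ij : 'I_m * 'I_p => `|A ij.1 ij.2|) (i, j)).
Qed.

Lemma grid_cvg (x : 'cV[R]_n) : grid ^~ x @ \oo --> x.
Proof.
apply/cvgrPdist_le => e e0; near=> k.
have k0 : 0 < k.+1%:R :> R by rewrite ltr0n.
apply: (@le_trans _ _ (k.+1%:R^-1)).
  apply: mx_norm_le; first by rewrite invr_ge0 ltW.
  move=> i j; rewrite !mxE (ord1 j).
  set y := x i ord0; set m := Num.floor _.
  rewrite -[y](mulfK (lt0r_neq0 k0)) -mulrBl normrM [`|_^-1|]ger0_norm; last first.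
    by rewrite invr_ge0 ltW.
  rewrite ler_piMl ?invr_ge0 ?ltW// mulrC.
  have /andP[m1 m2] := floor_itv (k.+1%:R * y).
  by rewrite ger0_norm ?subr_ge0//; move: m2; rewrite intrD -/m; lra.
rewrite -[leRHS]invrK lef_pV2 ?posrE ?invr_gt0//.
have : (Num.trunc e^-1 <= k)%N by near: k; exact: nbhs_infty_ge.
rewrite -(ltnS (Num.trunc _)) -(ler_nat R); apply: le_trans.
by rewrite ltW// truncnS_gt.
Unshelve. all: by end_near. Qed.

(** The sigma-algebra of R^n is generated by the coordinates, so it is not
    given as the Borel sets of a topology. A continuous function is the
    pointwise limit of its values at the nearest points of finer and finer
    grids, and these step functions take countably many values. *)
Lemma continuous_cV_measurable (f : 'cV[R]_n -> R) :
  continuous f -> measurable_fun [set: 'cV[R]_n] f.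
Proof.
move=> cf.
apply: (@measurable_fun_cvg _ _ _ setT (fun k => f \o grid k)); last first.
  suff cg (x : 'cV[R]_n) : f (grid k x) @[k --> \oo] --> f x by move=> x _; exact: cg.
  by apply: continuous_cvg; [exact: cf|exact: grid_cvg].
move=> k _ B mB; rewrite setTI.
pose pt (v : 'cV[int]_n) : 'cV[R]_n := \col_i ((v i ord0)%:~R / k.+1%:R).
pose cell (v : 'cV[int]_n) :=
  [set x : 'cV[R]_n | forall i, Num.floor (k.+1%:R * x i ord0) = v i ord0].
rewrite (_ : _ @^-1` B = \bigcup_v ([set _ | B (f (pt v))] `&` cell v)).
  apply: countable_bigcupT_measurable => [|v]; first exact: countableP.
  apply: measurableI.
    have [Bv|nB] := pselect (B (f (pt v))).
      by rewrite (_ : mkset _ = setT)//; apply/seteqP; split.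
    by rewrite (_ : mkset _ = set0)//; apply/seteqP; split.
  rewrite (_ : cell v = \bigcap_(i in [set: 'I_n]) (@cV_coord _ R n i @^-1`
      [set a | (v i ord0)%:~R / k.+1%:R <= a < ((v i ord0 + 1)%:~R) / k.+1%:R])).
    apply: fin_bigcap_measurable => // i _; rewrite -[X in measurable X]setTI.
    apply: (@measurable_cV_coord _ _ n i) => //.
    rewrite (_ : [set _ | _] =
      [set` `[(v i ord0)%:~R / k.+1%:R : R, ((v i ord0 + 1)%:~R) / k.+1%:R[ ]).
      exact: measurable_itv.
    by apply/seteqP; split => a /=; rewrite in_itv.
  apply/seteqP; split => x /= vx i.
    move=> _ /=; rewrite /cV_coord ler_pdivrMr// ltr_pdivlMr// mulrC -(vx i).
    exact: floor_itv.
  apply/eqP; rewrite floor_eq; have := vx i I.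
  by rewrite /cV_coord /= ler_pdivrMr// ltr_pdivlMr// mulrC.
apply/seteqP; split => [x /= Bx|x [v _]].
  exists (\col_i Num.floor (k.+1%:R * x i ord0)) => //.
  split=> [|i]/=; last by rewrite mxE.
  move: Bx => /=; rewrite (_ : grid k x = pt (\col_i Num.floor (k.+1%:R * x i ord0)))//.
  by apply/colP => i; rewrite !mxE.
move=> [/= Bv vx] /=; rewrite (_ : grid k x = pt v)//.
by apply/colP => i; rewrite !mxE vx.
Qed.

Lemma measurable_coord (i : 'I_n) (j : 'I_1) :
  measurable_fun setT (fun x : 'cV[R]_n => x i j).
Proof. by rewrite (ord1 j); exact: (@measurable_cV_coord _ R n i). Qed.

End measurable_cV_continuous.

Section measurable_cV_blocks.
Context {R : realType} {m n : nat}.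

Lemma measurable_usubmx :
  measurable_fun setT (fun x : 'cV[R]_(m + n) => usubmx x).
Proof.
apply: measurable_fun_cV => i.
rewrite (_ : _ \o _ = fun x : 'cV[R]_(m + n) => x (lshift n i) ord0); first exact: measurable_coord.
by apply/funext => x /=; rewrite /cV_coord mxE.
Qed.

Lemma measurable_dsubmx :
  measurable_fun setT (fun x : 'cV[R]_(m + n) => dsubmx x).
Proof.
apply: measurable_fun_cV => i.
rewrite (_ : _ \o _ = fun x : 'cV[R]_(m + n) => x (rshift m i) ord0); first exact: measurable_coord.
by apply/funext => x /=; rewrite /cV_coord mxE.
Qed.

End measurable_cV_blocks.

Section complex_measurable.
Context {R : realType} {d : measure_display} {T : measurableType d}.
Implicit Types f g : T -> R[i].

Definition Cmeasurable f :=
  measurable_fun setT (fun x => complex.Re (f x)) /\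
  measurable_fun setT (fun x => complex.Im (f x)).

Lemma complex_ReM (a b : R[i]) : complex.Re (a * b) =
  complex.Re a * complex.Re b - complex.Im a * complex.Im b.
Proof. by case: a b => [? ?] [? ?]. Qed.

Lemma complex_ImM (a b : R[i]) : complex.Im (a * b) =
  complex.Re a * complex.Im b + complex.Im a * complex.Re b.
Proof. by case: a b => [? ?] [? ?]. Qed.

Lemma complex_ReD (a b : R[i]) : complex.Re (a + b) = complex.Re a + complex.Re b.
Proof. by case: a b => [? ?] [? ?]. Qed.

Lemma complex_ImD (a b : R[i]) : complex.Im (a + b) = complex.Im a + complex.Im b.
Proof. by case: a b => [? ?] [? ?]. Qed.

Lemma Cmeasurable_cst (c : R[i]) : Cmeasurable (fun=> c).
Proof. by split; exact: measurable_cst. Qed.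

Lemma Cmeasurable_real (f : T -> R) : measurable_fun setT f ->
  Cmeasurable (fun x => (f x)%:C).
Proof. by move=> mf; split => //=; exact: measurable_cst. Qed.

Lemma CmeasurableD f g : Cmeasurable f -> Cmeasurable g ->
  Cmeasurable (fun x => f x + g x).
Proof.
move=> [f1 f2] [g1 g2]; split.
  by under eq_fun do rewrite complex_ReD; exact: measurable_funD.
by under eq_fun do rewrite complex_ImD; exact: measurable_funD.
Qed.

Lemma CmeasurableM f g : Cmeasurable f -> Cmeasurable g ->
  Cmeasurable (fun x => f x * g x).
Proof.
move=> [f1 f2] [g1 g2]; split.
  by under eq_fun do rewrite complex_ReM; apply: measurable_funB; exact: measurable_funM.
by under eq_fun do rewrite complex_ImM; apply: measurable_funD; exact: measurable_funM.
Qed.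

Lemma Cmeasurable_conj f : Cmeasurable f -> Cmeasurable (fun x => (f x)^*%C).
Proof.
move=> [f1 f2]; split.
  by rewrite (_ : (fun _ => _) = fun x => complex.Re (f x))//; apply/funext => x; case: (f x).
rewrite (_ : (fun _ => _) = fun x => - complex.Im (f x)); first exact: measurable_funN.
by apply/funext => x; case: (f x).
Qed.

Lemma Cmeasurable_sum (I : Type) (s : seq I) (f : I -> T -> R[i]) :
  (forall i, Cmeasurable (f i)) -> Cmeasurable (fun x => \sum_(i <- s) f i x).
Proof.
move=> mf; elim: s => [|i s IH].
  by under eq_fun do rewrite big_nil; exact: Cmeasurable_cst.
by under eq_fun do rewrite big_cons; exact: CmeasurableD.
Qed.

Lemma Cmeasurable_prod (I : Type) (s : seq I) (f : I -> T -> R[i]) :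
  (forall i, Cmeasurable (f i)) -> Cmeasurable (fun x => \prod_(i <- s) f i x).
Proof.
move=> mf; elim: s => [|i s IH].
  by under eq_fun do rewrite big_nil; exact: Cmeasurable_cst.
by under eq_fun do rewrite big_cons; exact: CmeasurableM.
Qed.

Lemma Cmeasurable_expC f : Cmeasurable f -> Cmeasurable (fun x => expC (f x)).
Proof.
move=> [f1 f2]; apply: CmeasurableM.
  by apply: Cmeasurable_real; exact: measurableT_comp.
split => /=.
- apply: measurableT_comp => //; apply: continuous_measurable_fun.
  exact: continuous_cos.
- apply: measurableT_comp => //; apply: continuous_measurable_fun.
  exact: continuous_sin.
Qed.

Lemma Cmeasurable_det (n : nat) (A : T -> 'M[R[i]]_n) :
  (forall i j, Cmeasurable (fun x => A x i j)) -> Cmeasurable (fun x => \det (A x)).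
Proof.
move=> mA; rewrite /determinant; apply: Cmeasurable_sum => s.
apply: CmeasurableM; first exact: Cmeasurable_cst.
by apply: Cmeasurable_prod => i; exact: mA.
Qed.

End complex_measurable.

Lemma Cmeasurable_comp (R : realType) d d' (T : measurableType d)
    (U : measurableType d') (f : U -> R[i]) (h : T -> U) :
  Cmeasurable f -> measurable_fun setT h -> Cmeasurable (fun x => f (h x)).
Proof.
move=> [f1 f2] mh; split.
  exact: (measurableT_comp f1 mh).
exact: (measurableT_comp f2 mh).
Qed.

Section parametric_integral.
Context {R : realType} d d' (T : measurableType d) (U : measurableType d').
Variable mu : {sigma_finite_measure set U -> \bar R}.

Lemma measurable_parametric_integral (F : T * U -> R) :
  measurable_fun setT F ->
  measurable_fun setT (fun x => \int[mu]_y F (x, y)).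
Proof.
move=> mF; rewrite /Rintegral; apply: measurableT_comp => //.
have mF' : measurable_fun setT (EFin \o F) by exact/measurable_EFinP.
rewrite (_ : (fun _ => _) = (fun x => \int[mu]_y (EFin \o F)^\+%E (x, y) -
   \int[mu]_y (EFin \o F)^\-%E (x, y))%E); last first.
  apply/funext => x; rewrite integralE; congr (_ - _)%E.
    by apply: eq_integral => y _; rewrite !funeposE.
  by apply: eq_integral => y _; rewrite !funenegE.
apply: emeasurable_funB.
  by apply: measurable_fun_fubini_tonelli_F => //; exact: measurable_funepos.
by apply: measurable_fun_fubini_tonelli_F => //; exact: measurable_funeneg.
Qed.

Lemma Cmeasurable_parametric_integral (F : T * U -> R[i]) :
  Cmeasurable F -> Cmeasurable (fun x => Cintegral mu (fun y => F (x, y))).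
Proof.
move=> [F1 F2]; split.
  exact: (measurable_parametric_integral F1).
exact: (measurable_parametric_integral F2).
Qed.

End parametric_integral.


(** * Integration on R^n *)

Section directional_derivative.
Context {R : realType}.
Implicit Types U V W : normedModType R.

(** A directional derivative only depends on the restriction of the function
    to the line, hence is inherited by any parametrization [c] of that line. *)
Lemma is_derive_along U V W (f : V -> W) (c : U -> V) (x u : U) (v : V) (df : W) :
  (forall h : R, c (h *: u + x) = h *: v + c x) ->
  is_derive (c x) v f df -> is_derive x u (f \o c) df.
Proof.
move=> cE [fc dfE].
have E : (fun h : R => h^-1 *: (((f \o c) \o shift x) (h *: u) - (f \o c) x)) =
    (fun h : R => h^-1 *: ((f \o shift (c x)) (h *: v) - f (c x))).
  by apply/funext => h /=; rewrite cE.
by split; [rewrite /derivable E|rewrite /derive E].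
Qed.

Lemma is_derive_line V W (f : V -> W) (x v : V) (s : R) (df : W) :
  is_derive (x + s *: v) v f df -> is_derive s 1 (fun h => f (x + h *: v)) df.
Proof.
apply: (@is_derive_along R^o) => h; rewrite scalerDl addrCA; congr (_ *: _ + _).
by rewrite /GRing.scale/= mulr1.
Qed.

End directional_derivative.

Section weight.
Context {R : realType}.

(** A product over the coordinates rather than a power of the norm, so that its
    integral factors by Fubini's theorem. *)
Definition weight (n : nat) (x : 'cV[R]_n) : R := \prod_i (oneDsqr (x i ord0))^-1.

Lemma weight_gt0 n (x : 'cV[R]_n) : 0 < weight x.
Proof. by apply: prodr_gt0 => i _; rewrite invr_gt0 (lt_le_trans ltr01). Qed.

Lemma measurable_oneDsqrV : measurable_fun [set: R] (fun a : R => (oneDsqr a)^-1).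
Proof. by apply: continuous_measurable_fun; exact: continuous_oneDsqrV. Qed.

Lemma measurable_weight n : measurable_fun setT (@weight n).
Proof.
apply: measurable_prod => i _.
exact: (measurableT_comp measurable_oneDsqrV (measurable_coord i ord0)).
Qed.

Lemma weight_cons n (p : R * 'cV[R]_n) :
  weight (cV_cons p) = (oneDsqr p.1)^-1 * weight p.2.
Proof.
rewrite /weight big_ord_recl cV_cons0; congr (_ * _).
by apply: eq_bigr => i _; rewrite cV_consS.
Qed.

(** Each of the [n] factors is at least [(1 + |x|) ^- 2], since coordinates are
    bounded by the norm. Through this lemma polynomial decay of order [2 * n]
    implies integrability. *)
Lemma weight_ge n (x : 'cV[R]_n) : (1 + `|x|) ^- (2 * n) <= weight x.
Proof.
have x1 : 0 < 1 + `|x| by rewrite ltr_pwDl.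
rewrite exprM /weight -[leLHS]exprVn -[X in _ ^+ X](card_ord n) -prodr_const.
apply: ler_prod => i _; rewrite invr_ge0 exprn_ge0 ?(ltW x1)//=.
rewrite lef_pV2 ?posrE ?exprn_gt0 ?(lt_le_trans ltr01)//.
  have := le_mx_norm x i ord0; rewrite /oneDsqr -(real_normK (num_real (x i ord0))).
  by have := normr_ge0 (x i ord0); nra.
by rewrite lerDl.
Qed.

Lemma integral_oneDsqrV : (\int[@lebesgue_measure R]_x ((oneDsqr x)^-1)%:E < +oo)%E.
Proof.
rewrite ge0_symfun_integralT.
- by rewrite -set_itvcy integral0y_oneDsqr -EFinM ltry.
- by move=> x; rewrite invr_ge0 (le_trans ler01).
- exact: continuous_oneDsqrV.
- by move=> x /=; rewrite /oneDsqr sqrrN.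
Qed.

Lemma ge0_integral_lebesgue_cVS n (F : 'cV[R]_n.+1 -> \bar R) :
  measurable_fun setT F -> (forall x, 0 <= F x)%E ->
  (\int[lebesgue_cV R n.+1]_x F x =
   \int[@lebesgue_measure R]_a \int[lebesgue_cV R n]_v F (cV_cons (a, v)))%E.
Proof.
move=> mF F0.
transitivity (\int[(@lebesgue_measure R \x lebesgue_cV R n)%E]_p F (cV_cons p))%E.
  have F0' : {in [set: 'cV[R]_n.+1], forall y, 0 <= F y}%E by move=> y _; exact: F0.
  pose m := [the measure _ _ of (@lebesgue_measure R \x lebesgue_cV R n)%E].
  have mc : measurable_fun [set: measurableTypeR R * 'cV[R]_n] (@cV_cons R n).
    by move=> mD Y mY; exact: measurable_cV_cons.
  have := ge0_integral_pushforward mc m measurableT mF F0'.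
  by rewrite preimage_setT => <-; exact: eq_measure_integral.
by rewrite fubini_tonelli1//; exact: measurableT_comp mF (@measurable_cV_cons R n).
Qed.

Lemma integrable_weight n : (lebesgue_cV R n).-integrable setT (EFin \o @weight n).
Proof.
apply/integrableP; split; first by apply/measurable_EFinP; exact: measurable_weight.
under eq_integral do rewrite /= ger0_norm ?ltW ?weight_gt0//.
elim: n => [|n IH].
  have m0 : measurable_fun setT (fun x : 'cV[R]_0 => (weight x)%:E).
    by apply/measurable_EFinP; exact: measurable_weight.
  rewrite [ltLHS](_ : _ = (\d_(0 : 'cV[R]_0)%R setT * (weight (0 : 'cV[R]_0)%R)%:E)%E).
    by rewrite diracT mul1e ltry.
  by rewrite -(integral_dirac (0 : 'cV[R]_0)%R measurableT m0); exact: eq_measure_integral.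
rewrite ge0_integral_lebesgue_cVS; last 2 first.
- by apply/measurable_EFinP; exact: measurable_weight.
- by move=> x; rewrite lee_fin ltW// weight_gt0.
have -> : (fun a : R => \int[lebesgue_cV R n]_v (weight (cV_cons (a, v)))%:E)%E =
    (fun a : R => ((oneDsqr a)^-1)%:E * \int[lebesgue_cV R n]_v (weight v)%:E)%E.
  apply/funext => a; under eq_integral do rewrite weight_cons/= EFinM.
  rewrite ge0_integralZl//.
  - by apply/measurable_EFinP; exact: measurable_weight.
  - by move=> x _; rewrite lee_fin ltW// weight_gt0.
have W0 : (0 <= \int[lebesgue_cV R n]_x (weight x)%:E)%E.
  by apply: integral_ge0 => x _; rewrite lee_fin ltW// weight_gt0.
rewrite ge0_integralZr//; last first.
  by apply/measurable_EFinP; exact: measurable_oneDsqrV.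
rewrite lte_mul_pinfty//.
- by apply: integral_ge0 => x _; rewrite lee_fin invr_ge0 (le_trans ler01).
- rewrite ge0_fin_numE; first exact: integral_oneDsqrV.
  by apply: integral_ge0 => x _; rewrite lee_fin invr_ge0 (le_trans ler01).
Qed.

Lemma integrable_dominated n (F : 'cV[R]_n -> R) (C : R) :
  measurable_fun setT F -> (forall x, `|F x| <= C * weight x) ->
  (lebesgue_cV R n).-integrable setT (EFin \o F).
Proof.
move=> mF FC; apply: (le_integrable _ _ _ (integrableZl _ C (integrable_weight n))) => //.
- exact/measurable_EFinP.
- move=> x _ /=; rewrite lee_fin (le_trans (FC x))// ler_norm//.
Qed.

End weight.

Section integral_partial.
Context {R : realType}.
Local Notation mu := (@lebesgue_measure R).

Lemma integrable_oneDsqrV : mu.-integrable setT (fun x : R => ((oneDsqr x)^-1)%:E).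
Proof.
apply/integrableP; split; first by apply/measurable_EFinP; exact: measurable_oneDsqrV.
under eq_integral do rewrite /= ger0_norm ?invr_ge0 ?(le_trans ler01)//.
exact: integral_oneDsqrV.
Qed.

Lemma cvg_oneDsqrV : (oneDsqr (k.+1%:R : R))^-1 @[k --> \oo] --> (0 : R).
Proof.
apply: (@squeeze_cvgr _ _ _ _ (cst 0) harmonic); last 2 first.
- exact: cvg_cst.
- exact: cvg_harmonic.
apply: nearW => k; rewrite invr_ge0 (le_trans ler01)//=.
rewrite lef_pV2 ?posrE ?ltr0n ?(lt_le_trans ltr01)// /oneDsqr.
have : 0 <= k%:R :> R by [].
by rewrite -natr1; nra.
Qed.

(** The integral over [-k, k] is [f k - f (- k)], which tends to 0. *)
Lemma integral_derive_eq0 (f f' : R -> R) (C : R) :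
  (forall x : R, is_derive x 1 f (f' x)) -> continuous f' ->
  (forall x, `|f x| <= C * (oneDsqr x)^-1) ->
  (forall x, `|f' x| <= C * (oneDsqr x)^-1) ->
  (\int[mu]_x (f' x)%:E = 0)%E.
Proof.
move=> ff' cf' fC f'C.
pose I (k : nat) : set R := `[- k.+1%:R, k.+1%:R]%classic.
pose f_ k := ((EFin \o f') \_ (I k))%E.
have mf' : measurable_fun setT f' by exact: continuous_measurable_fun.
have cf : continuous f.
  by move=> x; apply/differentiable_continuous/derivable1_diffP; case: (ff' x).
have lim1 : (\int[mu]_x f_ k x)%E @[k --> \oo] --> (\int[mu]_x (f' x)%:E)%E.
  apply: (@dominated_cvg _ _ R mu setT measurableT f_ (EFin \o f')
     (fun x => C%:E * ((oneDsqr x)^-1)%:E)%E) => //.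
  - move=> k; apply/(measurable_restrictT _ _).1 => //; first exact: measurable_itv.
    by apply: measurable_funTS; exact/measurable_EFinP.
  - move=> x _; apply: cvg_near_cst; near=> k; rewrite /f_ patchE mem_set//=.
    rewrite /I/= in_itv/= -ler_norml.
    have : (Num.trunc `|x| <= k)%N by near: k; exact: nbhs_infty_ge.
    rewrite -(ltnS (Num.trunc _)) -(ler_nat R); apply: le_trans.
    by rewrite ltW// truncnS_gt.
  - by apply: integrableZl => //; exact: integrable_oneDsqrV.
  - move=> k x _; rewrite /f_ patchE; case: ifPn => _ /=; first by rewrite lee_fin.
    by rewrite normr0 lee_fin (le_trans _ (f'C x)).
have lim2 : (\int[mu]_x f_ k x)%E @[k --> \oo] --> 0%E.
  rewrite (_ : (fun k => _) = EFin \o (fun k : nat => f k.+1%:R - f (- k.+1%:R))).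
    apply: cvg_EFin; first by apply: nearW.
    rewrite -[X in _ --> X](subr0 0); apply: cvgB.
      apply/norm_cvg0P; apply: (@squeeze_cvgr _ _ _ _ (cst 0) (fun k : nat => C * (oneDsqr (k.+1%:R : R))^-1)).
      - by apply: nearW => k /=; rewrite normr_ge0 fC.
      - exact: cvg_cst.
      - by rewrite -(mulr0 C); apply: cvgMr; exact: cvg_oneDsqrV.
    apply/norm_cvg0P; apply: (@squeeze_cvgr _ _ _ _ (cst 0) (fun k : nat => C * (oneDsqr (k.+1%:R : R))^-1)).
    - apply: nearW => k /=; rewrite normr_ge0 (le_trans (fC _))//.
      by rewrite /oneDsqr sqrrN.
    - exact: cvg_cst.
    - by rewrite -(mulr0 C); apply: cvgMr; exact: cvg_oneDsqrV.
  apply/funext => k; rewrite -integral_mkcond.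
  rewrite (@continuous_FTC2 _ f' f)//.
  - by rewrite (lt_trans (_ : _ < 0))// ?oppr_lt0 ltr0n.
  - exact: continuous_subspaceT.
  - split.
    + by move=> x _; case: (ff' x).
    + by apply: cvg_at_right_filter; exact: cf.
    + by apply: cvg_at_left_filter; exact: cf.
  - by move=> x _; rewrite derive1E; case: (ff' x).
by apply: (cvg_unique _ lim1 lim2).
Unshelve. all: by end_near. Qed.

Lemma integral_lebesgue_cVS n (F : 'cV[R]_n.+1 -> R) :
  (lebesgue_cV R n.+1).-integrable setT (EFin \o F) ->
  let f := fun p : R * 'cV[R]_n => (F (cV_cons p))%:E in
  (\int[lebesgue_cV R n.+1]_x (F x)%:E =
   \int[mu]_a \int[lebesgue_cV R n]_v f (a, v))%E /\
  (\int[lebesgue_cV R n.+1]_x (F x)%:E =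
   \int[lebesgue_cV R n]_v \int[mu]_a f (a, v))%E.
Proof.
move=> iF f.
have mF : measurable_fun setT (EFin \o F) by case/integrableP : iF.
pose m := [the measure _ _ of (@lebesgue_measure R \x lebesgue_cV R n)%E].
have mc : measurable_fun [set: measurableTypeR R * 'cV[R]_n] (@cV_cons R n).
  by move=> mD Y mY; exact: measurable_cV_cons.
have mf : measurable_fun [set: measurableTypeR R * 'cV[R]_n] f.
  exact: measurableT_comp mF mc.
have if_ : (@lebesgue_measure R \x lebesgue_cV R n)%E.-integrable setT f.
  apply/(@integrable12ltyP _ _ _ _ R mu (lebesgue_cV R n) f mf).
  case/integrableP : iF => _; rewrite ge0_integral_lebesgue_cVS//.
  exact: measurableT_comp.
have -> : (\int[lebesgue_cV R n.+1]_x (F x)%:E =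
    \int[(@lebesgue_measure R \x lebesgue_cV R n)%E]_p f p)%E.
  have := @integral_pushforward _ _ _ _ R _ mc m setT (EFin \o F) mF if_ measurableT.
  by rewrite preimage_setT => <-; exact: eq_measure_integral.
split; first by rewrite -integral12_prod_meas1.
by rewrite -integral21_prod_meas1.
Qed.

Lemma continuous_1lip (V W : normedModType R) (f : V -> W) :
  (forall x y, `|f x - f y| <= `|x - y|) -> continuous f.
Proof.
move=> lf x; apply/cvgrPdist_le => e e0; near=> y.
by apply: le_trans (lf x y) _; near: y; exact: cvgr_dist_le cvg_id e e0.
Unshelve. all: by end_near. Qed.

Lemma mxBE m p (A B : 'M[R]_(m, p)) i j : (A - B) i j = A i j - B i j.
Proof. by rewrite !mxE. Qed.

Lemma mxZDE m p (h : R) (A B : 'M[R]_(m, p)) i j :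
  (h *: A + B) i j = h * A i j + B i j.
Proof. by rewrite !mxE. Qed.

Lemma continuous_cV_consl n (v : 'cV[R]_n) : continuous (fun a : R^o => cV_cons (a, v)).
Proof.
apply: continuous_1lip => a b; apply: mx_norm_le => // i j; rewrite (ord1 j) mxBE.
case: (unliftP ord0 i) => [k ->|->]; last by rewrite !cV_cons0.
by rewrite !cV_consS subrr normr0.
Qed.

Lemma continuous_cV_consr n (a : R) : continuous (fun v : 'cV[R]_n => cV_cons (a, v)).
Proof.
apply: continuous_1lip => v w; apply: mx_norm_le => // i j; rewrite (ord1 j) mxBE.
case: (unliftP ord0 i) => [k ->|->]; last by rewrite !cV_cons0 subrr normr0.
by rewrite !cV_consS /= -mxBE le_mx_norm.
Qed.

(** Integrating first along the direction of differentiation, which the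
    recursive definition of the measure makes its head coordinate at some
    stage, gives 0. *)
Lemma integral_partial_eq0 n (j : 'I_n) (F F' : 'cV[R]_n -> R) (C : R) :
  (forall x, is_derive x (delta_mx j ord0) F (F' x)) ->
  continuous F -> continuous F' ->
  (forall x, `|F x| <= C * weight x) -> (forall x, `|F' x| <= C * weight x) ->
  (\int[lebesgue_cV R n]_x (F' x)%:E = 0)%E.
Proof.
elim: n j F F' C => [[]//|n IH] j F F' C FF' cF cF' FC F'C.
have iF' : (lebesgue_cV R n.+1).-integrable setT (EFin \o F').
  by apply: integrable_dominated F'C; exact: continuous_cV_measurable.
have [E1 E2] := integral_lebesgue_cVS iF'.
case: (unliftP ord0 j) FF' => [j' ->|->] FF'.
  rewrite E1; under eq_integral => a _.
    rewrite (_ : integral _ _ _ = 0%E); first over.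
    apply: (IH j' (fun v => F (cV_cons (a, v))) (fun v => F' (cV_cons (a, v)))
      (C * (oneDsqr a)^-1)).
    - move=> v; apply: (is_derive_along (c := fun v => cV_cons (a, v)) _ (FF' _)).
      move=> h; apply/colP => i.
      case: (unliftP ord0 i) => [k ->|->]; rewrite mxZDE ?cV_consS ?cV_cons0 /=.
        by rewrite mxZDE !mxE (inj_eq lift_inj).
      by rewrite mxE (negbTE (neq_lift _ _)) mulr0 add0r.
    - by move=> v; apply: continuous_comp; [exact: continuous_cV_consr|exact: cF].
    - by move=> v; apply: continuous_comp; [exact: continuous_cV_consr|exact: cF'].
    - by move=> v; rewrite -mulrA -(weight_cons (a, v)).
    - by move=> v; rewrite -mulrA -(weight_cons (a, v)).
  by rewrite integral0.
rewrite E2; under eq_integral => v _.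
  rewrite (_ : integral _ _ _ = 0%E); first over.
  apply: (@integral_derive_eq0 (fun a => F (cV_cons (a, v))) _ (C * weight v)).
  - move=> a; apply: (@is_derive_along _ R^o _ _ _ (fun a => cV_cons (a, v)) _ _ _ _ _ (FF' _)).
    move=> h; apply/colP => i.
    case: (unliftP ord0 i) => [k ->|->]; rewrite mxZDE ?cV_consS ?cV_cons0 mxE /=.
      by rewrite mulr0 add0r.
    by [].
  - by move=> a; apply: continuous_comp; [exact: continuous_cV_consl|exact: cF'].
  - by move=> a; rewrite mulrAC -mulrA -(weight_cons (a, v)).
  - by move=> a; rewrite mulrAC -mulrA -(weight_cons (a, v)).
by rewrite integral0.
Qed.

End integral_partial.


(** * Polynomial growth and polynomial families of functions *)

Section calculus.
Context {R : realType} {V : normedModType R}.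

Lemma is_derive_unline (W : normedModType R) (f : V -> W) (x v : V) (df : W) :
  is_derive (0 : R) 1 (fun h => f (x + h *: v)) df -> is_derive x v f df.
Proof.
move=> [cf dfE].
have E : (fun h : R => h^-1 *: ((f \o shift x) (h *: v) - f x)) =
    (fun h : R => h^-1 *: (((fun h => f (x + h *: v)) \o shift 0) (h *: 1) -
                           (fun h => f (x + h *: v)) 0)).
  apply/funext => h /=; rewrite addr0 scale0r addr0 [x + _]addrC.
  by rewrite (_ : h *: (1 : R) = h)// /GRing.scale/= mulr1.
by split; [rewrite /derivable E|rewrite /derive E].
Qed.

Lemma is_derive_comp1 (g : R -> R) (f : V -> R) (x v : V) (a b : R) :
  is_derive (f x) 1 g a -> is_derive x v f b -> is_derive x v (g \o f) (a * b).
Proof.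
move=> ga fb; apply: is_derive_unline.
apply: (@is_derive1_comp _ g (fun h : R => f (x + h *: v)) 0 a b).
  by rewrite scale0r addr0.
by apply: is_derive_line; rewrite scale0r addr0.
Qed.

Lemma is_derive_mul (f g : V -> R) (x v : V) (df dg : R) :
  is_derive x v f df -> is_derive x v g dg ->
  is_derive x v (fun y => f y * g y) (df * g x + f x * dg).
Proof.
by move=> hf hg; apply: is_derive_eq (is_deriveM hf hg) _; rewrite addrC mulrC.
Qed.

Lemma is_derive_add (f g : V -> R) (x v : V) (df dg : R) :
  is_derive x v f df -> is_derive x v g dg ->
  is_derive x v (fun y => f y + g y) (df + dg).
Proof. exact: is_deriveD. Qed.

End calculus.

Section bracket.
Context {R : realType}.

(** The Japanese bracket; adding 1 makes its powers increasing in the exponent,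
    so that orders of growth can be compared. *)
Definition bracket n (x : 'cV[R]_n) : R := 1 + `|x|.

Lemma bracket_ge1 n (x : 'cV[R]_n) : 1 <= bracket x.
Proof. by rewrite lerDl. Qed.

Lemma bracket_gt0 n (x : 'cV[R]_n) : 0 < bracket x.
Proof. exact: lt_le_trans ltr01 (bracket_ge1 x). Qed.

Lemma bracket_ge0 n (x : 'cV[R]_n) : 0 <= bracket x.
Proof. exact: ltW (bracket_gt0 x). Qed.

Lemma bracketX_gt0 n (x : 'cV[R]_n) k : 0 < bracket x ^+ k.
Proof. by rewrite exprn_gt0// bracket_gt0. Qed.

Lemma bracketX_ge1 n (x : 'cV[R]_n) k : 1 <= bracket x ^+ k.
Proof. by rewrite exprn_ege1// bracket_ge1. Qed.

Lemma le_bracket n (x : 'cV[R]_n) i : `|x i ord0| <= bracket x.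
Proof. by rewrite (le_trans (le_mx_norm _ _ _))// lerDr. Qed.

(** Peetre's inequality. *)
Lemma bracket_add n (x y : 'cV[R]_n) : bracket (x + y) <= bracket x * bracket y.
Proof.
rewrite /bracket; have := ler_normD x y; have := normr_ge0 x; have := normr_ge0 y.
nra.
Qed.

Lemma bracketN n (x : 'cV[R]_n) : bracket (- x) = bracket x.
Proof. by rewrite /bracket normrN. Qed.

Lemma bracket_subl n (x q : 'cV[R]_n) : bracket x <= bracket (x - q) * bracket q.
Proof. by rewrite -{1}(subrK q x) bracket_add. Qed.

Lemma bracket_subr n (x q : 'cV[R]_n) : bracket q <= bracket (x - q) * bracket x.
Proof.
rewrite -[X in bracket X <= _](subKr x q); apply: le_trans (bracket_add _ _) _.
by rewrite bracketN mulrC.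
Qed.

Lemma bracket_usubmx m n (x : 'cV[R]_(m + n)) : bracket (usubmx x) <= bracket x.
Proof. by rewrite lerD2l; apply: mx_norm_le => // i j; rewrite mxE le_mx_norm. Qed.

Lemma bracket_vsubmx m n (x : 'cV[R]_(m + n)) :
  bracket x <= bracket (usubmx x) * bracket (dsubmx x).
Proof.
apply: (@le_trans _ _ (1 + (`|usubmx x| + `|dsubmx x|))).
  rewrite lerD2l -{1}(vsubmxK x); apply: mx_norm_le => [|i j]; first exact: addr_ge0.
  rewrite mxE; case: splitP => k _.
    by apply: (le_trans (le_mx_norm (usubmx x) k j)); rewrite lerDl.
  by apply: (le_trans (le_mx_norm (dsubmx x) k j)); rewrite lerDr.
rewrite /bracket; have := normr_ge0 (usubmx x); have := normr_ge0 (dsubmx x); nra.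
Qed.

Lemma weight_bracket n (x : 'cV[R]_n) : bracket x ^- (2 * n) <= weight x.
Proof. exact: weight_ge. Qed.

(** Some coordinate realizes the maximum norm. Decay in each coordinate
    separately thereby gives decay in the norm. *)
Lemma bracketX_le_sum n (x : 'cV[R]_n) k :
  bracket x ^+ k <= 2 ^+ k * (1 + \sum_i `|x i ord0| ^+ k).
Proof.
have S0 : 0 <= \sum_i `|x i ord0| ^+ k by apply: sumr_ge0 => i _; rewrite exprn_ge0.
have [x1|x1] := leP `|x| 1.
  apply: (@le_trans _ _ (2 ^+ k)).
    by rewrite lerXn2r ?nnegrE ?bracket_ge0//; rewrite /bracket; lra.
  by rewrite ler_peMr ?exprn_ge0// lerDl.
have [[i j] /= xij] : exists ij : 'I_n * 'I_1, `|x| = `|x ij.1 ij.2|.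
  by apply: mx_norm_neq0; rewrite gt_eqF// (lt_trans ltr01).
apply: (@le_trans _ _ ((2 * `|x|) ^+ k)).
  by rewrite lerXn2r ?nnegrE ?bracket_ge0 ?mulr_ge0//; rewrite /bracket; lra.
rewrite exprMn ler_wpM2l ?exprn_ge0// xij (ord1 j) (bigD1 i)//= addrCA lerDl.
by rewrite addr_ge0// sumr_ge0// => l _; rewrite exprn_ge0.
Qed.

End bracket.

Section tame.
Context {R : realType} {m n : nat}.
Implicit Types f g : 'cV[R]_m -> 'cV[R]_n -> R.

(** Growth and measurability are required jointly in [c] and [x], because the
    integrals over [x] are themselves integrated over the parameter. *)
Definition tame f :=
  measurable_fun setT (fun p : 'cV[R]_m * 'cV[R]_n => f p.1 p.2) /\
  exists C k, 0 <= C /\ forall c x, `|f c x| <= C * (bracket c * bracket x) ^+ k.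

Let ge1 (c : 'cV[R]_m) (x : 'cV[R]_n) : 1 <= bracket c * bracket x.
Proof. by rewrite mulr_ege1// bracket_ge1. Qed.

Let geX (c : 'cV[R]_m) (x : 'cV[R]_n) k : 0 <= (bracket c * bracket x) ^+ k.
Proof. by rewrite exprn_ge0// (le_trans ler01). Qed.

Lemma tame_cst a : tame (fun _ _ => a).
Proof.
split; first exact: measurable_cst.
by exists `|a|, 0%N; split=> // c x; rewrite mulr1.
Qed.

Lemma tame_par i : tame (fun c _ => c i ord0).
Proof.
split; first exact: (measurableT_comp (measurable_coord i ord0) measurable_fst).
exists 1, 1%N; split=> // c x; rewrite mul1r expr1 (le_trans (le_bracket _ _))//.
by rewrite ler_peMr ?bracket_ge0 ?bracket_ge1.
Qed.

Lemma tame_var j : tame (fun _ x => x j ord0).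
Proof.
split; first exact: (measurableT_comp (measurable_coord j ord0) measurable_snd).
exists 1, 1%N; split=> // c x; rewrite mul1r expr1 (le_trans (le_bracket _ _))//.
by rewrite ler_peMl ?bracket_ge0 ?bracket_ge1.
Qed.

Lemma tameD f g : tame f -> tame g -> tame (fun c x => f c x + g c x).
Proof.
move=> [mf [C [k [C0 fC]]]] [mg [E [l [E0 gE]]]]; split; first exact: measurable_funD.
exists (C + E), (maxn k l); split=> [|c x]; first exact: addr_ge0.
rewrite (le_trans (ler_normD _ _))// mulrDl lerD//.
  by apply: le_trans (fC c x) _; rewrite ler_wpM2l// ler_weXn2l// leq_maxl.
by apply: le_trans (gE c x) _; rewrite ler_wpM2l// ler_weXn2l// leq_maxr.
Qed.

Lemma tameM f g : tame f -> tame g -> tame (fun c x => f c x * g c x).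
Proof.
move=> [mf [C [k [C0 fC]]]] [mg [E [l [E0 gE]]]]; split; first exact: measurable_funM.
exists (C * E), (k + l)%N; split=> [|c x]; first exact: mulr_ge0.
by rewrite normrM exprD mulrACA ler_pM.
Qed.

(** An inductive class, so that closure under differentiation and
    reparametrization follows by induction without handling coefficients. *)
Inductive polyfun : ('cV[R]_m -> 'cV[R]_n -> R) -> Prop :=
| polyfun_cst a : polyfun (fun _ _ => a)
| polyfun_par i : polyfun (fun c _ => c i ord0)
| polyfun_var j : polyfun (fun _ x => x j ord0)
| polyfunD f g : polyfun f -> polyfun g -> polyfun (fun c x => f c x + g c x)
| polyfunM f g : polyfun f -> polyfun g -> polyfun (fun c x => f c x * g c x).

Lemma polyfun_tame f : polyfun f -> tame f.
Proof.
elim=> [a|i|j|{}f g _ IHf _ IHg|{}f g _ IHf _ IHg].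
- exact: tame_cst.
- exact: tame_par.
- exact: tame_var.
- exact: tameD.
- exact: tameM.
Qed.

Lemma polyfunN f : polyfun f -> polyfun (fun c x => - f c x).
Proof.
move=> hf; rewrite (_ : (fun _ _ => _) = fun c x => (-1) * f c x).
  by apply: polyfunM => //; exact: polyfun_cst.
by apply/funext => c; apply/funext => x; rewrite mulN1r.
Qed.

Lemma polyfunB f g : polyfun f -> polyfun g -> polyfun (fun c x => f c x - g c x).
Proof. by move=> hf hg; apply: polyfunD => //; exact: polyfunN. Qed.

Lemma polyfun_sum (I : Type) (s : seq I) (F : I -> 'cV[R]_m -> 'cV[R]_n -> R) :
  (forall i, polyfun (F i)) -> polyfun (fun c x => \sum_(i <- s) F i c x).
Proof.
move=> hF; elim: s => [|i s IH].
  rewrite (_ : (fun _ _ => _) = fun _ _ => 0); first exact: polyfun_cst.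
  by apply/funext => c; apply/funext => x; rewrite big_nil.
rewrite (_ : (fun _ _ => _) = fun c x => F i c x + \sum_(i <- s) F i c x).
  exact: polyfunD.
by apply/funext => c; apply/funext => x; rewrite big_cons.
Qed.

Lemma continuous_polyfun f c : polyfun f -> continuous (f c).
Proof.
elim=> [a|i|j|{}f g _ IHf _ IHg|{}f g _ IHf _ IHg] x.
- exact: cst_continuous.
- exact: cst_continuous.
- exact: coord_continuous.
- exact: (cvgD (IHf x) (IHg x)).
- exact: (cvgM (IHf x) (IHg x)).
Qed.

Lemma is_derive_coord (k j : 'I_n) (x : 'cV[R]_n) :
  is_derive x (delta_mx j ord0) (fun y : 'cV[R]_n => y k ord0) (k == j)%:R.
Proof.
apply: is_derive_unline.
rewrite (_ : (fun h => _) = (fun h => x k ord0 + h * (k == j)%:R)); last first.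
  by apply/funext => h; rewrite addrC mxZDE mxE eqxx andbT addrC.
have := is_derive_add (is_derive_cst (x k ord0) (0 : R) 1)
  (is_derive_mul (is_derive_id (0 : R) 1) (is_derive_cst ((k == j)%:R : R) (0 : R) 1)).
by move=> h; apply: (is_derive_eq h); rewrite add0r mulr0 addr0 mul1r.
Qed.

Lemma is_derive_polyfun f (j : 'I_n) : polyfun f ->
  exists2 f', polyfun f' & forall c x, is_derive x (delta_mx j ord0) (f c) (f' c x).
Proof.
elim=> [a|i|k|{}f g hf [f' hf' df] hg [g' hg' dg]|{}f g hf [f' hf' df] hg [g' hg' dg]].
- by exists (fun _ _ => 0) => [|c x]; [exact: polyfun_cst|exact: is_derive_cst].
- by exists (fun _ _ => 0) => [|c x]; [exact: polyfun_cst|exact: is_derive_cst].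
- exists (fun _ _ => (k == j)%:R) => [|c x]; first exact: polyfun_cst.
  exact: is_derive_coord.
- exists (fun c x => f' c x + g' c x) => [|c x]; first exact: polyfunD.
  exact: is_derive_add.
- exists (fun c x => f' c x * g c x + f c x * g' c x) => [|c x].
    by apply: polyfunD; exact: polyfunM.
  exact: is_derive_mul.
Qed.

End tame.

Lemma polyfun_reparam (R : realType) (m m' n : nat) (s : 'cV[R]_m' -> 'cV[R]_m)
    (f : 'cV[R]_m -> 'cV[R]_n -> R) :
  (forall i, exists i', forall c, s c i ord0 = c i' ord0) ->
  polyfun f -> polyfun (fun c x => f (s c) x).
Proof.
move=> hs; elim=> [a|i|k|{}f g _ hf _ hg|{}f g _ hf _ hg].
- exact: polyfun_cst.
- have [i' E] := hs i; rewrite (_ : (fun _ _ => _) = fun (c : 'cV[R]_m') _ => c i' ord0).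
    exact: polyfun_par.
  by apply/funext => c; apply/funext => x.
- exact: polyfun_var.
- exact: (@polyfunD _ _ _ (fun c x => f (s c) x) (fun c x => g (s c) x)).
- exact: (@polyfunM _ _ _ (fun c x => f (s c) x) (fun c x => g (s c) x)).
Qed.


(** * Gaussian wave packets *)

(** The minimum over the compact unit sphere, extended by homogeneity. *)
Lemma posdef_ge (R : realType) (n : nat) (G : 'M[R]_n) :
  (forall v : 'cV[R]_n, v != 0 -> 0 < (v^T *m G *m v) ord0 ord0) ->
  exists2 c : R, 0 < c & forall v : 'cV[R]_n, c * `|v| ^+ 2 <= (v^T *m G *m v) ord0 ord0.
Proof.
move=> Gpos.
pose f (u : 'rV[R]_n) : R := (u *m G *m u^T) ord0 ord0.
have fZ (a : R) u : f (a *: u) = a ^+ 2 * f u.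
  by rewrite /f linearZ/= -!scalemxAl -scalemxAr !mxE expr2 mulrA.
have cf : continuous f.
  have pf : polyfun (fun (_ : 'cV[R]_0) (v : 'cV[R]_n) => (v^T *m G *m v) ord0 ord0).
    rewrite (_ : (fun _ _ => _) =
        fun (_ : 'cV[R]_0) (v : 'cV[R]_n) => \sum_k (\sum_l v l ord0 * G l k) * v k ord0).
      apply: polyfun_sum => k; apply: polyfunM; last exact: polyfun_var.
      apply: polyfun_sum => l; apply: polyfunM; last exact: polyfun_cst.
      exact: polyfun_var.
    apply/funext => _; apply/funext => v; rewrite mxE; apply: eq_bigr => k _.
    by rewrite mxE; congr (_ * _); apply: eq_bigr => l _; rewrite mxE.
  have ct : continuous (fun u : 'rV[R]_n => u^T).
    apply: continuous_1lip => u v; apply: mx_norm_le => // i j.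
    by rewrite mxBE !mxE -mxBE le_mx_norm.
  move=> u; rewrite (_ : f = (fun v => (v^T *m G *m v) ord0 ord0) \o trmx).
    apply: continuous_comp; first exact: ct.
    exact: (@continuous_polyfun _ _ _ _ (0 : 'cV[R]_0) pf u^T).
  by apply/funext => v; rewrite /f /= trmxK.
have normT (v : 'cV[R]_n) : `|v| = `|v^T|.
  apply/eqP; rewrite eq_le; apply/andP; split; apply: mx_norm_le => // i j.
    by have -> : v i j = v^T j i by [rewrite mxE]; exact: le_mx_norm.
  by rewrite mxE le_mx_norm.
pose A := [set u : 'rV[R]_n | `|u| = 1].
have [A0|A0] := pselect (A !=set0); last first.
  exists 1 => // v; have [->|v0] := eqVneq v 0.
    by rewrite normr0 expr0n mulr0 mulmx0 mxE.
  exfalso; apply: A0; exists (`|v|^-1 *: v^T).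
  by rewrite /A/= normrZ normrV ?unitfE ?normr_eq0// normr_id -normT mulVf ?normr_eq0.
have cA : compact A.
  apply: bounded_closed_compact.
    exists 1; split; first exact: num_real.
    by move=> M M1 u /= ->; exact: ltW.
  have -> : A = (fun u : 'rV[R]_n => `|u|) @^-1` [set 1] by [].
  apply: closed_comp => [u _|]; first exact: norm_continuous.
  exact: closed_eq.
have [u0 u0A umin] := EVT_min_rV A0 cA (continuous_subspaceT cf).
have u01 : `|u0| = 1 by move: u0A; rewrite inE.
exists (f u0).
  have := Gpos u0^T; rewrite trmxK; apply.
  apply/eqP => u00; have : `|u0| = 0 by rewrite -[u0]trmxK u00 trmx0 normr0.
  by rewrite u01 => /eqP; rewrite oner_eq0.
move=> v; have [->|v0] := eqVneq v 0.
  by rewrite normr0 expr0n mulr0 mulmx0 mxE.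
have nv : 0 < `|v| by rewrite normr_gt0.
have -> : (v^T *m G *m v) ord0 ord0 = `|v| ^+ 2 * f (`|v|^-1 *: v^T).
  by rewrite fZ mulrA -exprMn divff ?gt_eqF// expr1n mul1r /f trmxK.
rewrite mulrC ler_wpM2l ?exprn_ge0//; apply: umin.
by rewrite inE /A/= normrZ ger0_norm ?invr_ge0 ?ltW// -normT mulVf ?gt_eqF.
Qed.

(** Gaussian decay beats every power: [exp u >= 1 + u] applied to
    [u = c s^2 / k] and raised to the power [k]. *)
Lemma expR_sqr_decay (R : realType) (c : R) (k : nat) : 0 < c ->
  exists2 C : R, 0 <= C & forall s : R, 0 <= s -> expR (- (c * s ^+ 2)) <= C * (1 + s) ^- k.
Proof.
move=> c0; case: k => [|k].
  exists 1 => // s s0; rewrite expr0 invr1 mulr1 -[leRHS]expR0 ler_expR oppr_le0.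
  by rewrite mulr_ge0 ?sqr_ge0// ltW.
pose a := c / k.+1%:R; have a0 : 0 < a by rewrite divr_gt0// ltr0n.
pose B := 2 + a^-1; have B0 : 0 < B by rewrite addr_gt0// invr_gt0.
exists (B ^+ k.+1) => [|s s0]; first by rewrite exprn_ge0// ltW.
have s1 : 0 < 1 + s by rewrite ltr_pwDl.
rewrite expRN ler_pdivlMr ?exprn_gt0// mulrC ler_pdivrMr ?expR_gt0//.
have -> : c * s ^+ 2 = k.+1%:R * (a * s ^+ 2).
  by rewrite mulrA; congr (_ * _); rewrite /a mulrCA mulfV ?pnatr_eq0// mulr1.
have BE : 0 <= B * expR (a * s ^+ 2) by rewrite mulr_ge0 ?expR_ge0// ltW.
rewrite expRM_natl -exprMn lerXn2r ?nnegrE ?BE ?(ltW s1)//.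
apply: (@le_trans _ _ (B * (1 + a * s ^+ 2))); last first.
  by rewrite ler_pM2l// expR_ge1Dx.
have : 0 <= a^-1 by rewrite invr_ge0 ltW.
have E : a^-1 * (a * s ^+ 2) = s ^+ 2 by rewrite mulKf// gt_eqF.
have : 0 <= a * s ^+ 2 by rewrite mulr_ge0 ?sqr_ge0// ltW.
by rewrite /B mulrDl [a^-1 * _]mulrDr E mulr1; nra.
Qed.

Section gaussian_wave.
Context {R : realType} {D : nat} (eps : R) (Gamma : 'M[R]_D).
Hypothesis eps_gt0 : 0 < eps.
Hypothesis Gamma_pos : forall v : 'cV[R]_D, v != 0 ->
  0 < (v^T *m Gamma *m v) ord0 ord0.

Local Notation phase := 'cV[R]_(D + D).

Definition log_amp (q x : 'cV[R]_D) : R :=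
  - (2 * eps)^-1 * ((x - q)^T *m Gamma *m (x - q)) ord0 ord0.

Definition amp (q x : 'cV[R]_D) : R :=
  (\det Gamma / (pi ^+ D * eps ^+ D)) `^ (4^-1) * expR (log_amp q x).

Definition angle (z : phase) (x : 'cV[R]_D) : R :=
  eps^-1 * \sum_k dsubmx z k ord0 * (x k ord0 - usubmx z k ord0).

(** Real ([b = true]) and imaginary ([b = false]) parts of the wave packet,
    treated together because differentiation exchanges them. *)
Definition wave (b : bool) (z : phase) (x : 'cV[R]_D) : R :=
  amp (usubmx z) x * (if b then cos else @sin R) (angle z x).

Lemma gaussianE z x : gaussian eps Gamma z x = wave true z x +i* wave false z x.
Proof.
rewrite /gaussian /expC /wave.
set A := ((_ *m Gamma *m _) _ _); set th := ((_ *m _) ord0 ord0).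
have -> : complex.Re ((- (2 * eps)^-1 * A)%:C + 'i%C / eps%:C * th%:C) = log_amp (usubmx z) x.
  by rewrite -fmorphV /= /log_amp -/A; ring.
have -> : complex.Im ((- (2 * eps)^-1 * A)%:C + 'i%C / eps%:C * th%:C) = angle z x.
  rewrite -fmorphV /= (_ : _ + _ = eps^-1 * th); last by ring.
  rewrite /angle /th mxE; congr (_ * _).
  by apply: eq_bigr => k _; rewrite !mxE.
rewrite /amp; set N := _ `^ _; set e := expR _.
by apply/eqP; rewrite eq_complex /=; apply/andP; split; apply/eqP; ring.
Qed.

Lemma amp_ge0 q x : 0 <= amp q x.
Proof. by rewrite mulr_ge0 ?powR_ge0 ?expR_ge0. Qed.

Lemma wave_le_amp b z x : `|wave b z x| <= amp (usubmx z) x.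
Proof.
rewrite /wave normrM ger0_norm ?amp_ge0// ler_piMr ?amp_ge0//.
by case: b; rewrite ler_norml ?cos_geN1 ?cos_le1 ?sin_geN1 ?sin_le1.
Qed.

Lemma amp_decay k :
  exists2 C : R, 0 <= C & forall q x, amp q x <= C * bracket (x - q) ^- k.
Proof.
have [c c0 cG] := posdef_ge Gamma_pos.
have c1 : 0 < c / (2 * eps) by rewrite divr_gt0// mulr_gt0.
have [C C0 HC] := expR_sqr_decay k c1.
exists ((\det Gamma / (pi ^+ D * eps ^+ D)) `^ (4^-1) * C).
  by rewrite mulr_ge0 ?powR_ge0.
move=> q x; rewrite -mulrA ler_wpM2l ?powR_ge0//.
apply: le_trans (HC `|x - q| (normr_ge0 _)).
rewrite ler_expR /log_amp mulNr lerN2 [c / _]mulrC -mulrA ler_wpM2l//.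
by rewrite invr_ge0 mulr_ge0// ltW.
Qed.

Lemma polyfun_log_amp : polyfun log_amp.
Proof.
rewrite (_ : log_amp = fun q x => - (2 * eps)^-1 *
    \sum_k (\sum_l (x l ord0 - q l ord0) * Gamma l k) * (x k ord0 - q k ord0)).
  have hxq k : polyfun (fun q x : 'cV[R]_D => x k ord0 - q k ord0).
    by apply: polyfunB; [exact: polyfun_var|exact: polyfun_par].
  apply: (@polyfunM _ _ _ (fun _ _ => - (2 * eps)^-1)); first exact: polyfun_cst.
  apply: polyfun_sum => k; apply: polyfunM; last exact: hxq.
  by apply: polyfun_sum => l; apply: polyfunM; [exact: hxq|exact: polyfun_cst].
apply/funext => q; apply/funext => x; rewrite /log_amp; congr (_ * _).
rewrite mxE; apply: eq_bigr => k _; rewrite mxE mxBE; congr (_ * _).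
by apply: eq_bigr => l _; rewrite mxE mxBE.
Qed.

Lemma polyfun_angle : polyfun angle.
Proof.
rewrite (_ : angle = fun z x => eps^-1 *
    \sum_k z (rshift D k) ord0 * (x k ord0 - z (lshift D k) ord0)).
  apply: (@polyfunM _ _ _ (fun _ _ => eps^-1)); first exact: polyfun_cst.
  apply: polyfun_sum => k; apply: polyfunM; first exact: polyfun_par.
  by apply: polyfunB; [exact: polyfun_var|exact: polyfun_par].
apply/funext => z; apply/funext => x; congr (_ * _).
by apply: eq_bigr => k _; rewrite !mxE.
Qed.

Lemma polyfun_usubmx (f : 'cV[R]_D -> 'cV[R]_D -> R) :
  polyfun f -> polyfun (fun (z : phase) x => f (usubmx z) x).
Proof. by apply: polyfun_reparam => i; exists (lshift D i) => z; rewrite mxE. Qed.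

Lemma measurable_wave b :
  measurable_fun setT (fun p : phase * 'cV[R]_D => wave b p.1 p.2).
Proof.
apply: measurable_funM.
  apply: measurable_funM; first exact: measurable_cst.
  apply: measurableT_comp => //.
  exact: (polyfun_tame (polyfun_usubmx polyfun_log_amp)).1.
have ma := (polyfun_tame polyfun_angle).1.
by case: b; (apply: measurableT_comp ma; apply: continuous_measurable_fun);
  [exact: continuous_cos|exact: continuous_sin].
Qed.

Lemma continuous_wave b z : continuous (wave b z).
Proof.
have cl : continuous (log_amp (usubmx z)) by exact: continuous_polyfun polyfun_log_amp.
have ca : continuous (angle z) by exact: continuous_polyfun polyfun_angle.
have ce : continuous (fun x => expR (log_amp (usubmx z) x)).
  by move=> x; apply: continuous_comp; [exact: cl|exact: continuous_expR].
have ct : continuous (fun x => (if b then cos else @sin R) (angle z x)).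
  by case: b => x; apply: continuous_comp;
    [exact: ca|exact: continuous_cos|exact: ca|exact: continuous_sin].
pose N : R := (\det Gamma / (pi ^+ D * eps ^+ D)) `^ (4^-1).
have cN : continuous (fun _ : 'cV[R]_D => N) by move=> x; exact: cst_continuous.
have ca' : continuous (amp (usubmx z)) by move=> x; exact: (cvgM (cN x) (ce x)).
by move=> x; exact: (cvgM (ca' x) (ct x)).
Qed.

Lemma is_derive_angle j z x :
  is_derive x (delta_mx j ord0) (angle z) (eps^-1 * dsubmx z j ord0).
Proof.
have h k : is_derive x (delta_mx j ord0)
    (fun y : 'cV[R]_D => dsubmx z k ord0 * (y k ord0 - usubmx z k ord0))
    (dsubmx z k ord0 * (k == j)%:R).
  have := is_derive_mul (is_derive_cst (dsubmx z k ord0) x (delta_mx j ord0))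
    (is_derive_add (is_derive_coord k j x)
      (is_derive_cst (- usubmx z k ord0) x (delta_mx j ord0))).
  by move=> h; apply: (is_derive_eq h); rewrite mul0r add0r addr0.
have := is_derive_mul (is_derive_cst (eps^-1 : R) x (delta_mx j ord0)) (is_derive_sum h).
move=> {}h; have -> : angle z = (fun y => cst (eps^-1) y * (\sum_(i < D)
    (fun y : 'cV[R]_D => dsubmx z i ord0 * (y i ord0 - usubmx z i ord0))) y).
  by apply/funext => y; rewrite /angle fct_sumE.
apply: (is_derive_eq h); rewrite mul0r add0r; congr (_ * _).
rewrite (bigD1 j)//= eqxx mulr1 big1 ?addr0//.
by move=> k kj; rewrite (negbTE kj) mulr0.
Qed.

(** The momentum enters the derivative only through the last term, with the
    factor [p_j / eps]; this is what makes the integrations by parts gain a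
    power of [p_j]. *)
Lemma is_derive_wave j : exists2 l : 'cV[R]_D -> 'cV[R]_D -> R, polyfun l &
  forall b z x, is_derive x (delta_mx j ord0) (wave b z)
    (l (usubmx z) x * wave b z x +
     (-1) ^+ b * (eps^-1 * dsubmx z j ord0) * wave (~~ b) z x).
Proof.
have [l hl dl] := is_derive_polyfun j polyfun_log_amp.
exists l => // b z x; rewrite /wave.
have dE := is_derive_comp1 (is_derive_expR (log_amp (usubmx z) x)) (dl (usubmx z) x).
have dA := is_derive_mul (is_derive_cst ((\det Gamma / (pi ^+ D * eps ^+ D)) `^ (4^-1))
  x (delta_mx j ord0)) dE.
have da := is_derive_angle j z x.
case: b.
  have := is_derive_mul dA (is_derive_comp1 (is_derive_cos (angle z x)) da).
  by move=> h; apply: (is_derive_eq h); rewrite /amp /=; ring.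
have := is_derive_mul dA (is_derive_comp1 (is_derive_sin (angle z x)) da).
by move=> h; apply: (is_derive_eq h); rewrite /amp /=; ring.
Qed.

End gaussian_wave.


(** * Decay of the wave packet transform of a Schwartz function *)

Section rapidly_decreasing.
Context {R : realType} {n : nat}.
Implicit Types (u : 'cV[R]_n -> R) (phi : 'cV[R]_n -> R[i]).

(** The decay of all derivatives in terms of [bracket], which absorbs the
    multi-indices of the definition of Schwartz functions. *)
Definition rapid u := smooth u /\ forall (s : seq 'I_n) (k : nat),
  exists2 C : R, 0 <= C & forall x, `|partials s u x| <= C * bracket x ^- k.

Lemma Cpartials_Re phi s x :
  complex.Re (Cpartials s phi x) = partials s (fun y => complex.Re (phi y)) x.
Proof.
elim: s x => //= i s IH x; congr (partial _ _ _).
by apply/funext => y; exact: IH.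
Qed.

Lemma Cpartials_Im phi s x :
  complex.Im (Cpartials s phi x) = partials s (fun y => complex.Im (phi y)) x.
Proof.
elim: s x => //= i s IH x; congr (partial _ _ _).
by apply/funext => y; exact: IH.
Qed.

Lemma monomial_rapid (f : 'cV[R]_n -> R) :
  (forall a : 'I_n -> nat, exists C : R, forall x : 'cV[R]_n,
    `|(\prod_i x i ord0 ^+ a i) * f x| <= C) ->
  forall k, exists2 C : R, 0 <= C & forall x, `|f x| <= C * bracket x ^- k.
Proof.
move=> H k; have [C0 HC0] := H (fun=> 0%N).
have /choice[C HC] := fun i : 'I_n => H (fun i' => if i' == i then k else 0%N).
have C0_ge0 : 0 <= C0 by exact: le_trans (HC0 0).
have C_ge0 i : 0 <= C i by exact: le_trans (HC i 0).
exists (2 ^+ k * (C0 + \sum_i C i)) => [|x].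
  by rewrite mulr_ge0 ?exprn_ge0// addr_ge0// sumr_ge0.
rewrite ler_pdivlMr ?bracketX_gt0// mulrC.
apply: le_trans (ler_wpM2r (normr_ge0 _) (bracketX_le_sum x k)) _.
rewrite -mulrA ler_wpM2l ?exprn_ge0// mulrDl mul1r lerD//.
  by apply: le_trans (HC0 x); rewrite big1 ?mul1r// => i _; rewrite expr0.
rewrite mulr_suml ler_sum// => i _.
apply: le_trans (HC i x); rewrite (bigD1 i)//= eqxx big1 ?mulr1 ?normrM ?normrX//.
by move=> j ji; rewrite (negbTE ji) expr0.
Qed.

Lemma le_normC (a C : R) (z : R[i]) : `|a%:C * z| <= C%:C ->
  `|a * complex.Re z| <= C /\ `|a * complex.Im z| <= C.
Proof.
case: z => p q; rewrite normc_def lecR /= !mul0r subr0 addr0 => h.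
by split; apply: le_trans h; rewrite -sqrtr_sqr ler_wsqrtr// ?lerDl ?lerDr sqr_ge0.
Qed.

Lemma schwartz_rapid phi : schwartz phi ->
  rapid (fun x => complex.Re (phi x)) /\ rapid (fun x => complex.Im (phi x)).
Proof.
move=> [sR sI bd]; split; split=> // s; apply: monomial_rapid => a.
  have [C HC] := bd a s; exists C => x; rewrite -Cpartials_Re.
  by have [] := le_normC (HC x).
have [C HC] := bd a s; exists C => x; rewrite -Cpartials_Im.
by have [] := le_normC (HC x).
Qed.

End rapidly_decreasing.

(** Peetre's inequality [q <= y * x], raised to the power [k + l], in the shape in
    which it is used: [x] is the bracket of the integration variable, [q] that of
    the centre of a wave packet and [y] that of their difference; [k] is the order
    of decay wanted in [q], [l] the growth to absorb, [d] the order needed for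
    integrability. *)
Lemma peetre_exponents (R : realType) (q x y : R) (k l d : nat) :
  0 < q -> 0 < x -> 0 < y -> q <= y * x ->
  x ^- (k + l + l + d) * (q * x) ^+ l * y ^- (k + l) <= q ^- k * x ^- d.
Proof.
move=> q0 x0 y0 qyx.
have P : q ^+ (k + l) <= (y * x) ^+ (k + l).
  by rewrite lerXn2r// nnegrE ltW// mulr_gt0.
move: P; rewrite !exprMn !exprD.
have [a1 a2 a3] : [/\ 0 < x ^+ k, 0 < x ^+ l & 0 < x ^+ d] by rewrite !exprn_gt0.
have [b1 b2] : 0 < q ^+ k /\ 0 < q ^+ l by rewrite !exprn_gt0.
have [c1 c2] : 0 < y ^+ k /\ 0 < y ^+ l by rewrite !exprn_gt0.
move: (x ^+ k) (x ^+ l) (x ^+ d) (q ^+ k) (q ^+ l) (y ^+ k) (y ^+ l)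
  a1 a2 a3 b1 b2 c1 c2 => X1 X2 X3 Q1 Q2 Y1 Y2 a1 a2 a3 b1 b2 c1 c2 P.
pose m := (X1 * X2 * Y1 * Y2)^-1 * (Q1 * X3)^-1.
have m0 : 0 <= m by rewrite ltW// mulr_gt0// invr_gt0 !mulr_gt0.
rewrite [leLHS](_ : _ = Q1 * Q2 * m); last by rewrite /m; field; rewrite !gt_eqF.
rewrite [leRHS](_ : _ = Y1 * Y2 * (X1 * X2) * m); last by rewrite /m; field; rewrite !gt_eqF.
by rewrite ler_wpM2r.
Qed.

Section wave_packet_transform.
Context {R : realType} {D : nat} (eps : R) (Gamma : 'M[R]_D).
Hypothesis eps_gt0 : 0 < eps.
Hypothesis Gamma_pos : forall v : 'cV[R]_D, v != 0 ->
  0 < (v^T *m Gamma *m v) ord0 ord0.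
Variable u : 'cV[R]_D -> R.
Hypothesis u_rapid : rapid u.

Local Notation phase := 'cV[R]_(D + D).
Local Notation wave := (wave eps Gamma).
Local Notation mu := (lebesgue_cV R D).

(** The integrands met when integrating [u g_z] by parts. *)
Let term (s : seq 'I_D) (Q : 'cV[R]_D -> 'cV[R]_D -> R) b (z : phase) x :=
  partials s u x * Q (usubmx z) x * wave b z x.

Lemma continuous_term s Q b z : polyfun Q -> continuous (term s Q b z).
Proof.
move=> hQ; have c1 : continuous (partials s u) by have [] := u_rapid.1 s.
have c2 : continuous (Q (usubmx z)) by exact: continuous_polyfun hQ.
have c3 : continuous (fun x => partials s u x * Q (usubmx z) x).
  by move=> x; exact: (cvgM (c1 x) (c2 x)).
have c4 : continuous (wave b z) by exact: continuous_wave.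
by move=> x; exact: (cvgM (c3 x) (c4 x)).
Qed.

Lemma term_bound s Q b k : polyfun Q -> exists2 C : R, 0 <= C &
  forall z x, `|term s Q b z x| <= C * bracket (usubmx z) ^- k * weight x.
Proof.
move=> hQ; have [_ [A [l [A0 HA]]]] := polyfun_tame hQ.
have [B B0 HB] := u_rapid.2 s (k + l + l + 2 * D)%N.
have [C C0 HC] := amp_decay eps_gt0 Gamma_pos (k + l).
exists (B * A * C) => [|z x]; first by rewrite !mulr_ge0.
set q := usubmx z.
apply: (@le_trans _ _ (B * bracket x ^- (k + l + l + 2 * D) *
    (A * (bracket q * bracket x) ^+ l) * (C * bracket (x - q) ^- (k + l)))).
  rewrite /term 2!normrM; apply: ler_pM => //.
    by apply: ler_pM.
  by apply: le_trans (wave_le_amp _ _ _ _ _) _; exact: HC.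
rewrite [leLHS](_ : _ = B * A * C * (bracket x ^- (k + l + l + 2 * D) *
  (bracket q * bracket x) ^+ l * bracket (x - q) ^- (k + l))); last by ring.
rewrite -[leRHS]mulrA ler_wpM2l ?mulr_ge0//.
apply: (@le_trans _ _ (bracket q ^- k * bracket x ^- (2 * D))).
  by apply: peetre_exponents; rewrite ?bracket_gt0// bracket_subr.
by rewrite ler_wpM2l ?invr_ge0 ?exprn_ge0 ?bracket_ge0// weight_bracket.
Qed.

Lemma is_derive_term s Q j : polyfun Q -> exists2 Q', polyfun Q' &
  forall b z x, is_derive x (delta_mx j ord0) (term s Q b z)
    (term (j :: s) Q b z x + term s Q' b z x +
     (-1) ^+ b * (eps^-1 * dsubmx z j ord0) * term s Q (~~ b) z x).
Proof.
move=> hQ; have [Qj hQj dQ] := is_derive_polyfun j hQ.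
have [l hl dl] := is_derive_wave eps Gamma j.
exists (fun q x => Qj q x + Q q x * l q x).
  by apply: polyfunD => //; exact: polyfunM.
move=> b z x.
have du : is_derive x (delta_mx j ord0) (partials s u) (partials (j :: s) u x).
  by split=> //; exact: (u_rapid.1 s).2.
have := is_derive_mul (is_derive_mul du (dQ (usubmx z) x)) (dl b z x).
by move=> h; apply: (is_derive_eq h); rewrite /term /=; ring.
Qed.

Let W := \int[mu]_x weight x.

Let W0 : 0 <= W.
Proof. by apply: Rintegral_ge0 => x _; exact: ltW (weight_gt0 x). Qed.

Lemma integrable_term s Q b z : polyfun Q -> mu.-integrable setT (EFin \o term s Q b z).
Proof.
move=> hQ; have [C C0 HC] := term_bound s b 0 hQ.
apply: (@integrable_dominated _ _ _ C).
  by apply: continuous_cV_measurable; exact: continuous_term.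
by move=> x; rewrite (le_trans (HC z x))// invr1 mulr1.
Qed.

Lemma integral_term_bound s Q b k : polyfun Q -> exists2 C : R, 0 <= C &
  forall z, `|\int[mu]_x term s Q b z x| <= C * bracket (usubmx z) ^- k.
Proof.
move=> hQ; have [C C0 HC] := term_bound s b k hQ.
exists (C * W) => [|z]; first exact: mulr_ge0.
apply: le_trans (le_normr_Rintegral _ (integrable_term s b z hQ)) _ => //.
rewrite mulrAC -RintegralZl//; last exact: integrable_weight.
apply: (le_Rintegral measurableT (integrable_abse (integrable_term s b z hQ))
  (integrableZl measurableT (C * bracket (usubmx z) ^- k) (integrable_weight _))).
by move=> x _; exact: HC.
Qed.

(** Integrating the derivative of a term gives 0, and isolates the momentum. *)
Lemma integral_term_ibp s Q j : polyfun Q -> exists2 Q', polyfun Q' &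
  forall b z, dsubmx z j ord0 * \int[mu]_x term s Q b z x =
    (-1) ^+ b * eps * (\int[mu]_x term (j :: s) Q (~~ b) z x +
                       \int[mu]_x term s Q' (~~ b) z x).
Proof.
move=> hQ; have [Q' hQ' dT] := is_derive_term s j hQ.
exists Q' => // b z; set p := dsubmx z j ord0.
pose F' x := term (j :: s) Q (~~ b) z x + term s Q' (~~ b) z x +
     (-1) ^+ (~~ b) * (eps^-1 * p) * term s Q b z x.
have i1 := integrable_term (j :: s) (~~ b) z hQ.
have i2 := integrable_term s (~~ b) z hQ'.
have i3 := integrable_term s b z hQ.
have i12 : mu.-integrable setT
    (EFin \o (fun x => term (j :: s) Q (~~ b) z x + term s Q' (~~ b) z x)).
  exact: (integrableD measurableT i1 i2).
have i3' : mu.-integrable setT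
    (EFin \o (fun x => (-1) ^+ (~~ b) * (eps^-1 * p) * term s Q b z x)).
  exact: (integrableZl measurableT _ i3).
have F'0 : \int[mu]_x F' x = 0.
  have [C0 C0p HC0] := term_bound s (~~ b) 0 hQ.
  have [C1 C1p HC1] := term_bound (j :: s) (~~ b) 0 hQ.
  have [C2 C2p HC2] := term_bound s (~~ b) 0 hQ'.
  have [C3 C3p HC3] := term_bound s b 0 hQ.
  have simp (C : R) (x : 'cV[R]_D) : C * bracket (usubmx z) ^- 0 * weight x = C * weight x.
    by rewrite expr0 invr1 mulr1.
  pose a := (-1) ^+ (~~ b) * (eps^-1 * p).
  rewrite /Rintegral -[RHS]/(fine 0%E); congr fine.
  apply: (@integral_partial_eq0 _ _ j (term s Q (~~ b) z) F'
    (C0 + C1 + C2 + `|a| * C3)).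
  - by move=> x; have := dT (~~ b) z x; rewrite negbK.
  - exact: continuous_term.
  - have c1 : continuous (term (j :: s) Q (~~ b) z) by exact: continuous_term.
    have c2 : continuous (term s Q' (~~ b) z) by exact: continuous_term.
    have c3 : continuous (term s Q b z) by exact: continuous_term.
    have ca : continuous (fun _ : 'cV[R]_D => a) by move=> x; exact: cst_continuous.
    by move=> x; exact: (cvgD (cvgD (c1 x) (c2 x)) (cvgM (ca x) (c3 x))).
  - move=> x; apply: le_trans (HC0 z x) _; rewrite simp ler_wpM2r ?(ltW (weight_gt0 _))//.
    by rewrite -!addrA lerDl !addr_ge0// mulr_ge0.
  - move=> x; rewrite /F' -/a; have := HC1 z x; have := HC2 z x; have := HC3 z x.
    rewrite !simp => h3 h2 h1; rewrite !mulrDl.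
    apply: le_trans (ler_normD _ _) _; apply: lerD; last first.
      by rewrite normrM -mulrA ler_wpM2l.
    apply: le_trans (ler_normD _ _) _; apply: lerD => //.
    by rewrite (le_trans h1)// lerDr mulr_ge0// ltW// weight_gt0.
move: F'0; rewrite /F' RintegralD// RintegralD// RintegralZl//.
set I1 := Rintegral _ _ _; set I2 := Rintegral _ _ _; set I3 := Rintegral _ _ _ => E.
have -> : I1 + I2 = - ((-1) ^+ (~~ b) * (eps^-1 * p) * I3) by lra.
have e0 : eps != 0 by rewrite gt_eqF.
have s2 : ((-1) ^+ b : R) * (-1) ^+ b = 1 by rewrite -expr2 sqrr_sign.
rewrite signrN; transitivity ((-1) ^+ b * (-1) ^+ b * (eps * eps^-1) * (p * I3)); last by ring.
by rewrite s2 mulfV// !mul1r.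
Qed.

(** Each integration by parts gains one power of [p_j] and leaves integrals of
    the same kind, which is why the induction ranges over all derivatives of [u]
    and all polynomial factors. *)
Lemma integral_term_decay N : forall s Q j b k, polyfun Q -> exists2 C : R, 0 <= C &
  forall z, `|dsubmx z j ord0| ^+ N * `|\int[mu]_x term s Q b z x| <=
            C * bracket (usubmx z) ^- k.
Proof.
elim: N => [|N IH] s Q j b k hQ.
  have [C C0 HC] := integral_term_bound s b k hQ.
  by exists C => // z; rewrite expr0 mul1r.
have [Q' hQ' E] := integral_term_ibp s j hQ.
have [C1 C10 H1] := IH (j :: s) Q j (~~ b) k hQ.
have [C2 C20 H2] := IH s Q' j (~~ b) k hQ'.
exists (eps * (C1 + C2)) => [|z]; first by rewrite mulr_ge0 ?addr_ge0// ltW.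
rewrite exprSr -mulrA -normrM E !normrM normrX normrN1 expr1n mul1r (gtr0_norm eps_gt0).
rewrite mulrCA -mulrA ler_pM2l// mulrDl.
apply: le_trans (ler_wpM2l (exprn_ge0 _ (normr_ge0 _)) (ler_normD _ _)) _.
by rewrite mulrDr lerD.
Qed.

(** Decay in the position comes from the decay of [u], decay in the momentum from
    integrations by parts, that is, from the smoothness of [u]. *)
Lemma wave_transform_decay b N : exists2 C : R, 0 <= C &
  forall z : phase, `|\int[mu]_x (u x * wave b z x)| <= C * bracket z ^- N.
Proof.
have E z : \int[mu]_x (u x * wave b z x) = \int[mu]_x term [::] (fun _ _ => 1) b z x.
  by apply: eq_Rintegral => x _; rewrite /term /= mulr1.
have h1 : polyfun (fun _ _ : 'cV[R]_D => 1 : R) by exact: polyfun_cst.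
have [C0 C0p HC0] := integral_term_bound [::] b N h1.
have /choice[C HC] : forall j, exists C : R, 0 <= C /\ forall z : phase,
    `|dsubmx z j ord0| ^+ N * `|\int[mu]_x term [::] (fun _ _ => 1) b z x| <=
    C * bracket (usubmx z) ^- N.
  by move=> j; have [C Cp H] := integral_term_decay N [::] j b N h1; exists C.
exists (2 ^+ N * (C0 + \sum_j C j)) => [|z].
  by rewrite mulr_ge0 ?exprn_ge0// addr_ge0// sumr_ge0// => j _; have [] := HC j.
rewrite E; set I := Rintegral _ _ _; set q := usubmx z; set p := dsubmx z.
rewrite ler_pdivlMr ?bracketX_gt0//.
apply: (@le_trans _ _ (`|I| * (bracket q ^+ N * (2 ^+ N * (1 + \sum_j `|p j ord0| ^+ N))))).
  rewrite ler_wpM2l//; apply: (@le_trans _ _ ((bracket q * bracket p) ^+ N)).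
    by rewrite lerXn2r ?nnegrE ?mulr_ge0 ?bracket_ge0// bracket_vsubmx.
  by rewrite exprMn ler_wpM2l ?exprn_ge0 ?bracket_ge0// bracketX_le_sum.
rewrite [leLHS](_ : _ = 2 ^+ N * (bracket q ^+ N * ((1 + \sum_j `|p j ord0| ^+ N) * `|I|))); last by ring.
rewrite ler_wpM2l ?exprn_ge0// mulrC -ler_pdivlMr ?bracketX_gt0//.
rewrite mulrDl mul1r mulrDl lerD//; first exact: HC0.
rewrite !mulr_suml ler_sum// => j _; have [_] := HC j; exact.
Qed.

End wave_packet_transform.


(** * Matrix elements between wave packets *)

Section normc.
Context {R : realType}.
Implicit Types z : R[i].
Local Notation normc := (@Normc.normc R).

Lemma normc_ge0 z : 0 <= normc z.
Proof. by case: z => a b; exact: sqrtr_ge0. Qed.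

Lemma Re_le_normc z : `|complex.Re z| <= normc z.
Proof. by case: z => a b /=; rewrite -sqrtr_sqr ler_wsqrtr// lerDl sqr_ge0. Qed.

Lemma Im_le_normc z : `|complex.Im z| <= normc z.
Proof. by case: z => a b /=; rewrite -sqrtr_sqr ler_wsqrtr// lerDr sqr_ge0. Qed.

Lemma normc_le z : normc z <= `|complex.Re z| + `|complex.Im z|.
Proof.
case: z => a b /=; rewrite -[leRHS]ger0_norm ?addr_ge0// -sqrtr_sqr ler_wsqrtr//.
rewrite sqrrD !real_normK ?num_real// addrAC lerDl mulrn_wge0// mulr_ge0//.
Qed.

Lemma normc_conj z : normc z^*%C = normc z.
Proof. by case: z => a b /=; rewrite sqrrN. Qed.

Lemma normc_real (a : R) : normc a%:C = `|a|.
Proof. by rewrite /= expr0n addr0 sqrtr_sqr. Qed.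

Lemma normc_expCi (a : R) : normc (expC ('i%C * a%:C)) = 1.
Proof.
rewrite (_ : 'i%C * a%:C = 0 +i* a); last first.
  by apply/eqP; rewrite eq_complex /=; apply/andP; split; apply/eqP; ring.
rewrite /expC Normc.normcM normc_real /= expR0 normr1 mul1r.
by rewrite cos2Dsin2 sqrtr1.
Qed.

End normc.

Section Cintegral_bound.
Context {R : realType} {n : nat}.
Local Notation normc := (@Normc.normc R).
Local Notation mu := (lebesgue_cV R n).
Variables (F : 'cV[R]_n -> R[i]) (B : R).
Hypothesis mF : Cmeasurable F.
Hypothesis FB : forall x, normc (F x) <= B * weight x.

Lemma Cintegrable_dominated :
  mu.-integrable setT (EFin \o (fun x => complex.Re (F x))) /\
  mu.-integrable setT (EFin \o (fun x => complex.Im (F x))).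
Proof.
split; apply: (@integrable_dominated _ _ _ B).
- exact: mF.1.
- by move=> x; apply: le_trans (Re_le_normc _) (FB x).
- exact: mF.2.
- by move=> x; apply: le_trans (Im_le_normc _) (FB x).
Qed.

Lemma Cintegral_bound : normc (Cintegral mu F) <= 2 * B * \int[mu]_x weight x.
Proof.
have [i1 i2] := Cintegrable_dominated.
have bound (f : 'cV[R]_n -> R) : mu.-integrable setT (EFin \o f) ->
    (forall x, `|f x| <= B * weight x) -> `|\int[mu]_x f x| <= B * \int[mu]_x weight x.
  move=> fi fB; apply: le_trans (le_normr_Rintegral measurableT fi) _.
  rewrite -RintegralZl//; last exact: integrable_weight.
  apply: (le_Rintegral measurableT (integrable_abse fi)
    (integrableZl measurableT B (integrable_weight _))).
  by move=> x _; exact: fB.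
apply: le_trans (normc_le _) _; rewrite -mulrA mulr_natl mulr2n; apply: lerD.
  by apply: (bound _ i1) => x; apply: le_trans (Re_le_normc _) (FB x).
by apply: (bound _ i2) => x; apply: le_trans (Im_le_normc _) (FB x).
Qed.

End Cintegral_bound.

Section matrix_elements.
Context {R : realType} {D : nat} (eps : R) (Gamma : 'M[R]_D).
Hypothesis eps_gt0 : 0 < eps.
Hypothesis Gamma_pos : forall v : 'cV[R]_D, v != 0 ->
  0 < (v^T *m Gamma *m v) ord0 ord0.

Local Notation phase := 'cV[R]_(D + D).
Local Notation wave := (wave eps Gamma).
Local Notation g := (gaussian eps Gamma).
Local Notation mu := (lebesgue_cV R D).
Local Notation normc := (@Normc.normc R).

Lemma Cmeasurable_gaussian : Cmeasurable (fun p : phase * 'cV[R]_D => g p.1 p.2).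
Proof.
split.
- under eq_fun do rewrite gaussianE//=; exact: measurable_wave.
- under eq_fun do rewrite gaussianE//=; exact: measurable_wave.
Qed.

Lemma gaussian_decay k : exists2 C : R, 0 <= C &
  forall z x, normc (g z x) <= C * bracket (x - usubmx z) ^- k.
Proof.
have [C C0 HC] := amp_decay eps_gt0 Gamma_pos k.
exists (2 * C) => [|z x]; first exact: mulr_ge0.
rewrite gaussianE// (le_trans (normc_le _))//= -mulrA mulr_natl mulr2n.
by apply: lerD; apply: le_trans (wave_le_amp _ _ _ _ _) (HC _ _).
Qed.

Lemma measurable_pair_fst m (d : measure_display) (T : measurableType d)
    (f : 'cV[R]_m -> R[i]) : Cmeasurable f ->
  Cmeasurable (fun p : T * 'cV[R]_m => f p.2).
Proof. by move=> mf; exact: Cmeasurable_comp mf measurable_snd. Qed.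

Section schwartz_function.
Variable psi : 'cV[R]_D -> R[i].
Hypothesis psi_schwartz : schwartz psi.

Lemma Cmeasurable_schwartz : Cmeasurable psi.
Proof.
have [h1 h2 _] := psi_schwartz.
split; apply: continuous_cV_measurable; first exact: (h1 [::]).1.
exact: (h2 [::]).1.
Qed.

Lemma Cmeasurable_inner_l : Cmeasurable (fun z => inner psi (g z)).
Proof.
apply: (Cmeasurable_parametric_integral mu
  (F := fun p : phase * 'cV[R]_D => (psi p.2)^*%C * g p.1 p.2)).
apply: CmeasurableM; last exact: Cmeasurable_gaussian.
by apply: Cmeasurable_conj; apply: measurable_pair_fst; exact: Cmeasurable_schwartz.
Qed.

Lemma Cmeasurable_inner_r : Cmeasurable (fun z => inner (g z) psi).
Proof.
apply: (Cmeasurable_parametric_integral mu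
  (F := fun p : phase * 'cV[R]_D => (g p.1 p.2)^*%C * psi p.2)).
apply: CmeasurableM; first by apply: Cmeasurable_conj; exact: Cmeasurable_gaussian.
by apply: measurable_pair_fst; exact: Cmeasurable_schwartz.
Qed.

(** Each inner product combines four real integrals, of the real and imaginary
    parts of [psi] against those of the wave packet. *)
Lemma inner_gaussian_decay N : exists2 C : R, 0 <= C & forall z,
  normc (inner psi (g z)) <= C * bracket z ^- N /\
  normc (inner (g z) psi) <= C * bracket z ^- N.
Proof.
have [ru rv] := schwartz_rapid psi_schwartz.
pose u x := complex.Re (psi x); pose v x := complex.Im (psi x).
have iu b z : mu.-integrable setT (EFin \o (fun x => u x * wave b z x)).
  have := integrable_term eps_gt0 Gamma_pos ru [::] b z (polyfun_cst 1).
  by apply: eq_integrable => // x _; rewrite /= mulr1.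
have iv b z : mu.-integrable setT (EFin \o (fun x => v x * wave b z x)).
  have := integrable_term eps_gt0 Gamma_pos rv [::] b z (polyfun_cst 1).
  by apply: eq_integrable => // x _; rewrite /= mulr1.
have [C1 C10 H1] := wave_transform_decay eps_gt0 Gamma_pos ru true N.
have [C2 C20 H2] := wave_transform_decay eps_gt0 Gamma_pos ru false N.
have [C3 C30 H3] := wave_transform_decay eps_gt0 Gamma_pos rv true N.
have [C4 C40 H4] := wave_transform_decay eps_gt0 Gamma_pos rv false N.
exists ((C1 + C4) + (C2 + C3)) => [|z]; first by rewrite !addr_ge0.
have bound (a b c d : R) : `|a| <= C1 * bracket z ^- N -> `|b| <= C2 * bracket z ^- N ->
    `|c| <= C3 * bracket z ^- N -> `|d| <= C4 * bracket z ^- N ->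
    `|a + d| + `|b - c| <= (C1 + C4 + (C2 + C3)) * bracket z ^- N.
  move=> ha hb hc hd; rewrite !mulrDl; apply: lerD.
    by apply: le_trans (ler_normD _ _) _; exact: lerD.
  by apply: le_trans (ler_normB _ _) _; exact: lerD.
split; apply: le_trans (normc_le _) _.
- have -> : complex.Re (inner psi (g z)) =
      \int[mu]_x (u x * wave true z x) + \int[mu]_x (v x * wave false z x).
    rewrite -RintegralD//; apply: eq_Rintegral => x _; rewrite gaussianE//.
    by rewrite /u /v; case: (psi x) => p q /=; ring.
  have -> : complex.Im (inner psi (g z)) =
      \int[mu]_x (u x * wave false z x) - \int[mu]_x (v x * wave true z x).
    rewrite -RintegralB//; apply: eq_Rintegral => x _; rewrite gaussianE//.
    by rewrite /u /v; case: (psi x) => p q /=; ring.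
  by apply: bound; [exact: H1|exact: H2|exact: H3|exact: H4].
- have -> : complex.Re (inner (g z) psi) =
      \int[mu]_x (u x * wave true z x) + \int[mu]_x (v x * wave false z x).
    rewrite -RintegralD//; apply: eq_Rintegral => x _; rewrite gaussianE//.
    by rewrite /u /v; case: (psi x) => p q /=; ring.
  have -> : complex.Im (inner (g z) psi) =
      \int[mu]_x (v x * wave true z x) - \int[mu]_x (u x * wave false z x).
    rewrite -RintegralB//; apply: eq_Rintegral => x _; rewrite gaussianE//.
    by rewrite /u /v; case: (psi x) => p q /=; ring.
  by rewrite [X in _ + X]distrC; apply: bound; [exact: H1|exact: H2|exact: H3|exact: H4].
Qed.

End schwartz_function.

(** The symbol by which an observable multiplies the wave packet at [z]. *)
Definition polyC (a : phase -> 'cV[R]_D -> R[i]) :=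
  polyfun (fun z x => complex.Re (a z x)) /\ polyfun (fun z x => complex.Im (a z x)).

Definition tameC (a : phase -> 'cV[R]_D -> R[i]) :=
  tame (fun z x => complex.Re (a z x)) /\ tame (fun z x => complex.Im (a z x)).

Lemma polyC_tameC a : polyC a -> tameC a.
Proof. by move=> [h1 h2]; split; exact: polyfun_tame. Qed.

Lemma polyC_cst c : polyC (fun _ _ => c).
Proof. by split; exact: polyfun_cst. Qed.

Lemma polyC_var j : polyC (fun _ x => (x j ord0)%:C).
Proof. by split; [exact: polyfun_var|exact: polyfun_cst]. Qed.

Lemma polyCM a b : polyC a -> polyC b -> polyC (fun z x => a z x * b z x).
Proof.
move=> [a1 a2] [b1 b2]; split.
  rewrite (_ : (fun _ _ => _) = fun z x => complex.Re (a z x) * complex.Re (b z x) -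
      complex.Im (a z x) * complex.Im (b z x)).
    by apply: polyfunB; exact: polyfunM.
  by apply/funext => z; apply/funext => x; rewrite complex_ReM.
rewrite (_ : (fun _ _ => _) = fun z x => complex.Re (a z x) * complex.Im (b z x) +
    complex.Im (a z x) * complex.Re (b z x)).
  by apply: polyfunD; exact: polyfunM.
by apply/funext => z; apply/funext => x; rewrite complex_ImM.
Qed.

Lemma polyCD a b : polyC a -> polyC b -> polyC (fun z x => a z x + b z x).
Proof.
move=> [a1 a2] [b1 b2]; split.
  rewrite (_ : (fun _ _ => _) = fun z x => complex.Re (a z x) + complex.Re (b z x)).
    exact: polyfunD.
  by apply/funext => z; apply/funext => x; rewrite complex_ReD.
rewrite (_ : (fun _ _ => _) = fun z x => complex.Im (a z x) + complex.Im (b z x)).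
  exact: polyfunD.
by apply/funext => z; apply/funext => x; rewrite complex_ImD.
Qed.

Lemma polyC_sum (I : Type) (s : seq I) (F : I -> phase -> 'cV[R]_D -> R[i]) :
  (forall i, polyC (F i)) -> polyC (fun z x => \sum_(i <- s) F i z x).
Proof.
move=> hF; elim: s => [|i s IH].
  rewrite (_ : (fun _ _ => _) = fun _ _ => 0); first exact: polyC_cst.
  by apply/funext => z; apply/funext => x; rewrite big_nil.
rewrite (_ : (fun _ _ => _) = fun z x => F i z x + \sum_(i <- s) F i z x).
  exact: polyCD.
by apply/funext => z; apply/funext => x; rewrite big_cons.
Qed.

(** The logarithmic derivative of a wave packet is a polynomial, so derivatives
    multiply it by polynomials. *)
Lemma Cpartial_symbol a j : polyC a -> exists2 a', polyC a' &
  forall z, Cpartial j (fun x => a z x * g z x) = (fun x => a' z x * g z x).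
Proof.
move=> [h1 h2]; pose a1 z x := complex.Re (a z x); pose a2 z x := complex.Im (a z x).
have [d1 hd1 D1] := is_derive_polyfun j h1.
have [d2 hd2 D2] := is_derive_polyfun j h2.
have [l hl dl] := is_derive_wave eps Gamma j.
pose P (z : phase) := eps^-1 * dsubmx z j ord0.
have hP : polyfun (fun (z : phase) (_ : 'cV[R]_D) => P z).
  rewrite (_ : (fun _ _ => _) =
    fun (z : phase) (_ : 'cV[R]_D) => eps^-1 * z (rshift D j) ord0).
    by apply: polyfunM; [exact: polyfun_cst|exact: polyfun_par].
  by apply/funext => z; apply/funext => x; rewrite /P mxE.
have hl' := polyfun_usubmx hl.
exists (fun z x => (d1 z x + a1 z x * l (usubmx z) x - a2 z x * P z) +i*
                   (d2 z x + a2 z x * l (usubmx z) x + a1 z x * P z)).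
  split => /=.
    apply: polyfunB; last exact: polyfunM.
    by apply: polyfunD => //; exact: polyfunM.
  apply: polyfunD; last exact: polyfunM.
  by apply: polyfunD => //; exact: polyfunM.
move=> z; apply/funext => x; rewrite /Cpartial /partial.
have E1 : (fun y => complex.Re (a z y * g z y)) =
    (fun y => a1 z y * wave true z y + (- a2 z y) * wave false z y).
  by apply/funext => y; rewrite complex_ReM gaussianE//= mulNr.
have E2 : (fun y => complex.Im (a z y * g z y)) =
    (fun y => a1 z y * wave false z y + a2 z y * wave true z y).
  by apply/funext => y; rewrite complex_ImM gaussianE.
have dN : is_derive x (delta_mx j ord0) (fun y => - a2 z y) (- d2 z x) by exact: is_deriveN.
rewrite E1 E2 gaussianE//.
rewrite (derive_val (is_derive := is_derive_add (is_derive_mul (D1 z x) (dl true z x))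
                     (is_derive_mul dN (dl false z x)))).
rewrite (derive_val (is_derive := is_derive_add (is_derive_mul (D1 z x) (dl false z x))
                     (is_derive_mul (D2 z x) (dl true z x)))).
rewrite /= -/(P z) -/(a1 z x) -/(a2 z x).
by apply/eqP; rewrite eq_complex /=; apply/andP; split; apply/eqP; ring.
Qed.

Lemma iter_symbol (B : ('cV[R]_D -> R[i]) -> ('cV[R]_D -> R[i])) n :
  (forall a, polyC a -> exists2 a', polyC a' &
     forall z, B (fun x => a z x * g z x) = (fun x => a' z x * g z x)) ->
  exists2 a, polyC a & forall z, iter n B (g z) = (fun x => a z x * g z x).
Proof.
move=> HB; elim: n => [|n [a ha Ea]].
  exists (fun _ _ => 1); first exact: polyC_cst.
  by move=> z; apply/funext => x /=; rewrite mul1r.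
have [a' ha' Ea'] := HB a ha; exists a' => // z.
by rewrite iterS Ea Ea'.
Qed.

Lemma qhat_symbol j n :
  exists2 a, polyC a & forall z, iter n (qhat j) (g z) = (fun x => a z x * g z x).
Proof.
apply: iter_symbol => a ha; exists (fun z (x : 'cV[R]_D) => (x j ord0)%:C * a z x).
  by apply: polyCM => //; exact: polyC_var.
by move=> z; apply/funext => x; rewrite /qhat mulrA.
Qed.

Lemma phat_symbol j n :
  exists2 a, polyC a & forall z, iter n (phat eps j) (g z) = (fun x => a z x * g z x).
Proof.
apply: iter_symbol => a ha; have [a' ha' Ea'] := Cpartial_symbol j ha.
exists (fun z x => - 'i%C * eps%:C * a' z x).
  by apply: polyCM => //; exact: polyC_cst.
by move=> z; apply/funext => x; rewrite /phat Ea' mulrA.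
Qed.

Lemma That_symbol :
  exists2 a, polyC a & forall z, That eps (g z) = (fun x => a z x * g z x).
Proof.
have one z : g z = (fun x => 1 * g z x) by apply/funext => x; rewrite mul1r.
have /choice[a Ha] : forall j, exists a, polyC a /\ forall z,
    Cpartial j (Cpartial j (g z)) = (fun x => a z x * g z x).
  move=> j; have [a ha Ea] := Cpartial_symbol j (polyC_cst 1).
  have [a' ha' Ea'] := Cpartial_symbol j ha.
  exists a'; split=> // z; rewrite -Ea' -Ea; congr (Cpartial j (Cpartial j _)).
  exact: one.
exists (fun z x => - (eps ^+ 2 / 2)%:C * \sum_j a j z x).
  apply: polyCM; first exact: polyC_cst.
  by apply: polyC_sum => j; have [] := Ha j.
move=> z; apply/funext => x; rewrite /That -[RHS]mulrA mulr_suml; congr (_ * _).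
by apply: eq_bigr => j _; have [_ ->] := Ha j.
Qed.

Lemma observable_symbol (V : 'cV[R]_D -> R) (n : nat) (j : 'I_D)
    (A : ('cV[R]_D -> R[i]) -> ('cV[R]_D -> R[i])) :
  tame (fun (_ : phase) x => V x) ->
  [\/ A = id, A = iter n (qhat j), A = iter n (phat eps j) | A = Hhat eps V] ->
  exists2 a, tameC a & forall z, A (g z) = (fun x => a z x * g z x).
Proof.
move=> tV [->|->|->|->].
- exists (fun _ _ => 1); first by apply: polyC_tameC; exact: polyC_cst.
  by move=> z; apply/funext => x; rewrite mul1r.
- by have [a ha Ea] := qhat_symbol j n; exists a => //; exact: polyC_tameC.
- by have [a ha Ea] := phat_symbol j n; exists a => //; exact: polyC_tameC.
- have [a /polyC_tameC[h1 h2] Ea] := That_symbol.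
  exists (fun z x => a z x + (V x)%:C).
    have -> : (fun z x => a z x + (V x)%:C) =
        (fun z x => (complex.Re (a z x) + V x) +i* complex.Im (a z x)).
      apply/funext => z; apply/funext => x; apply/eqP.
      by rewrite eq_complex complex_ReD complex_ImD /= addr0 !eqxx.
    by split=> //=; exact: tameD.
  by move=> z; apply/funext => x; rewrite /Hhat Ea mulrDl.
Qed.

Section symbol.
Variable a : phase -> 'cV[R]_D -> R[i].
Hypothesis a_tame : tameC a.
Let matrix_element y z := inner (g y) (fun x => a z x * g z x).

Lemma Cmeasurable_matrix_element :
  Cmeasurable (fun p : phase * phase => matrix_element p.1 p.2).
Proof.
have [[m1 _] [m2 _]] := a_tame.
have ma : Cmeasurable (fun p : phase * 'cV[R]_D => a p.1 p.2) by [].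
have mg := Cmeasurable_gaussian.
have m13 : measurable_fun setT (fun p : phase * phase * 'cV[R]_D => (p.1.1, p.2)).
  apply/measurable_fun_pairP; split; last exact: measurable_snd.
  exact: (measurableT_comp measurable_fst measurable_fst).
have m23 : measurable_fun setT (fun p : phase * phase * 'cV[R]_D => (p.1.2, p.2)).
  apply/measurable_fun_pairP; split; last exact: measurable_snd.
  exact: (measurableT_comp measurable_snd measurable_fst).
apply: (Cmeasurable_parametric_integral mu (F := fun p : phase * phase * 'cV[R]_D =>
   (g p.1.1 p.2)^*%C * (a p.1.2 p.2 * g p.1.2 p.2))).
apply: CmeasurableM; first by apply: Cmeasurable_conj; exact: (Cmeasurable_comp mg m13).
by apply: CmeasurableM; [exact: (Cmeasurable_comp ma m23)|exact: (Cmeasurable_comp mg m23)].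
Qed.

(** The packet centred at [z] decays faster than the symbol grows, but only in
    terms of the distance to the centre; Peetre's inequality trades this for
    integrability in [x] and a power of the bracket of [z]. *)
Lemma matrix_element_bound : exists C k, 0 <= C /\
  forall y z, normc (matrix_element y z) <= C * bracket z ^+ k.
Proof.
have [[m1 [C1 [k1 [C10 H1]]]] [m2 [C2 [k2 [C20 H2]]]]] := a_tame.
have [G0 G00 HG0] := gaussian_decay 0.
pose k := (maxn k1 k2 + 2 * D)%N.
have [G1 G10 HG1] := gaussian_decay k.
pose W := \int[mu]_x weight x.
exists (2 * (G0 * (C1 + C2) * G1) * W), (maxn k1 k2 + k)%N.
have W0 : 0 <= W by apply: Rintegral_ge0 => x _; exact: ltW (weight_gt0 x).
split=> [|y z]; first by rewrite !mulr_ge0// addr_ge0.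
rewrite mulrAC -[X in X * W]mulrA.
apply: Cintegral_bound.
  have mg := Cmeasurable_gaussian.
  have ma : Cmeasurable (fun p : phase * 'cV[R]_D => a p.1 p.2) by [].
  have mp (c : phase) : measurable_fun setT (fun x : 'cV[R]_D => (c, x)).
    exact: measurable_pair1.
  apply: CmeasurableM; first by apply: Cmeasurable_conj; exact: (Cmeasurable_comp mg (mp y)).
  by apply: CmeasurableM; [exact: (Cmeasurable_comp ma (mp z))|exact: (Cmeasurable_comp mg (mp z))].
move=> x.
have -> : normc ((g y x)^*%C * (a z x * g z x)) =
    normc (g y x) * (normc (a z x) * normc (g z x)).
  by rewrite Normc.normcM [X in _ * X]Normc.normcM normc_conj.
have q1 : bracket (usubmx z) <= bracket z by exact: bracket_usubmx.
have x0 := bracket_gt0 x; have z0 := bracket_gt0 z.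
have Ha : normc (a z x) <= (C1 + C2) * (bracket z * bracket x) ^+ maxn k1 k2.
  apply: le_trans (normc_le _) _; rewrite mulrDl.
  have zx1 : 1 <= bracket z * bracket x by rewrite mulr_ege1// bracket_ge1.
  apply: lerD.
    by apply: le_trans (H1 z x) _; rewrite ler_wpM2l// ler_weXn2l// leq_maxl.
  by apply: le_trans (H2 z x) _; rewrite ler_wpM2l// ler_weXn2l// leq_maxr.
have Hy : normc (g y x) <= G0 by have := HG0 y x; rewrite expr0 invr1 mulr1.
have Hz : normc (g z x) <= G1 * (bracket z ^+ k * bracket x ^- k).
  apply: le_trans (HG1 z x) _; rewrite ler_wpM2l//.
  rewrite -[leLHS]mul1r ler_pdivrMr ?bracketX_gt0// mulrAC ler_pdivlMr ?bracketX_gt0//.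
  rewrite mul1r -exprMn lerXn2r ?nnegrE ?mulr_ge0 ?bracket_ge0//.
  apply: le_trans (bracket_subl x (usubmx z)) _; rewrite mulrC ler_wpM2r//.
  exact: bracket_ge0.
apply: (@le_trans _ _ (G0 * ((C1 + C2) * (bracket z * bracket x) ^+ maxn k1 k2 *
   (G1 * (bracket z ^+ k * bracket x ^- k))))).
  apply: ler_pM Hy _; [exact: normc_ge0|by apply: mulr_ge0; exact: normc_ge0|].
  by apply: ler_pM Ha Hz; exact: normc_ge0.
rewrite [leLHS](_ : _ = G0 * (C1 + C2) * G1 * bracket z ^+ (maxn k1 k2 + k) *
  (bracket x ^- (2 * D))); last first.
  rewrite /k; move: (2 * D)%N (maxn k1 k2) => d m; rewrite !exprMn !exprD.
  have : bracket x ^+ m != 0 by rewrite gt_eqF// bracketX_gt0.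
  have : bracket x ^+ d != 0 by rewrite gt_eqF// bracketX_gt0.
  move: (bracket x ^+ m) (bracket x ^+ d) (bracket z ^+ m) (bracket z ^+ d) => X1 X2 Z1 Z2.
  by move=> n1 n2; field; rewrite n1 n2.
rewrite ler_wpM2l ?weight_bracket// !mulr_ge0 ?addr_ge0// ltW// bracketX_gt0//.
Qed.

End symbol.

End matrix_elements.


(** * The Hamiltonian flow *)

Section mean_value.
Context {R : realType}.

Lemma is_derive_continuous (f : R -> R) (df : R -> R) :
  (forall x : R, is_derive x 1 f (df x)) -> continuous f.
Proof.
by move=> h x; apply/differentiable_continuous/derivable1_diffP; case: (h x).
Qed.

Lemma mean_value_le (g dg : R -> R) (r C a b : R) :
  (forall s : R, is_derive s 1 g (dg s)) -> (forall s, `|s| <= r -> `|dg s| <= C) ->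
  `|a| <= r -> `|b| <= r -> `|g a - g b| <= C * `|a - b|.
Proof.
move=> hg hC; wlog ab : a b / a <= b => [H|] ar br.
  have [/H|/ltW /H] := leP a b; first exact.
  by rewrite distrC [X in _ <= _ * X]distrC; exact.
have cg := is_derive_continuous hg.
have [c] := MVT_segment ab (fun x _ => hg x) (continuous_subspaceT cg).
rewrite in_itv/= => /andP[ac cb] E.
rewrite distrC E normrM [X in _ <= _ * X]distrC ler_wpM2r// hC//.
move: ar br; rewrite !ler_norml => /andP[a1 a2] /andP[b1 b2].
by rewrite (le_trans a1 ac) (le_trans cb b2).
Qed.

(** Change the coordinates one at a time. *)
Lemma lipschitz_partials n (f : 'cV[R]_n -> R) (r C : R) :
  (forall i x, derivable f x (delta_mx i ord0)) ->
  (forall i w, `|w| <= r -> `|partial i f w| <= C) ->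
  forall x y, `|x| <= r -> `|y| <= r -> `|f x - f y| <= n%:R * C * `|x - y|.
Proof.
move=> df hC x y xr yr.
pose mix (m : nat) (s : R) : 'cV[R]_n :=
  \col_i (if (i < m)%N then y i ord0 else if i == m :> nat then s else x i ord0).
pose h m : 'cV[R]_n := \col_i (if (i < m)%N then y i ord0 else x i ord0).
have r0 : 0 <= r by exact: le_trans xr.
have step (m : 'I_n) : `|f (h m) - f (h m.+1)| <= C * `|x - y|.
  have -> : h m = mix m (x m ord0).
    apply/colP => i; rewrite !mxE; case: ltnP => // mi.
    by case: eqP => // /val_inj ->.
  have -> : h m.+1 = mix m (y m ord0).
    apply/colP => i; rewrite !mxE ltnS leq_eqVlt.
    by case: eqP => [/val_inj ->|_] /=; [rewrite ltnn|].
  have dg (s : R) : is_derive s 1 (fun s => f (mix m s)) (partial m f (mix m s)).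
    apply: (@is_derive_along _ R^o _ _ f (mix m) s 1 (delta_mx m ord0)); last exact: DeriveDef.
    move=> k; apply/colP => i; rewrite !mxE eqxx andbT.
    case: ltnP => [im|mi].
      by rewrite -val_eqE (ltn_eqF im) mulr0 add0r.
    rewrite -val_eqE /=; case: eqP => _; last by rewrite mulr0 add0r.
    by [].
  have bd (s : R) : `|s| <= r -> `|partial m f (mix m s)| <= C.
    move=> sr; apply: hC; apply: mx_norm_le => // i j; rewrite mxE.
    case: ifP => _; first exact: le_trans (le_mx_norm _ _ _) yr.
    by case: ifP => _ //; exact: le_trans (le_mx_norm _ _ _) xr.
  have C0 : 0 <= C by apply: le_trans (bd 0 _); rewrite ?normr0.
  apply: le_trans (mean_value_le dg bd _ _) _.
  - exact: le_trans (le_mx_norm _ _ _) xr.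
  - exact: le_trans (le_mx_norm _ _ _) yr.
  - by rewrite ler_wpM2l// -mxBE le_mx_norm.
have -> : f x - f y = \sum_(m < n) (f (h m) - f (h m.+1)).
  have -> : x = h 0%N by apply/colP => i; rewrite mxE.
  have -> : y = h n by apply/colP => i; rewrite mxE ltn_ord.
  rewrite -opprB -(telescope_sumr (f \o h) (leq0n n)) big_mkord -sumrN.
  by apply: eq_bigr => m _; rewrite opprB.
apply: le_trans (ler_norm_sum _ _ _) _.
apply: le_trans (ler_sum _ (fun m _ => step m)) _.
by rewrite sumr_const card_ord -[leLHS]mulr_natl mulrA.
Qed.

(** The product of [u] with the decreasing exponential is nonincreasing. *)
Lemma gronwall (u du : R -> R) (K t : R) :
  (forall s : R, is_derive s 1 u (du s)) -> (forall s, du s <= K * u s) -> 0 <= t ->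
  u t <= expR (K * t) * u 0.
Proof.
move=> hu hK; rewrite le_eqVlt => /predU1P[<-|t0]; first by rewrite mulr0 expR0 mul1r.
pose v s := expR (- (K * s)) * u s.
have hv (s : R) : is_derive s 1 v (expR (- (K * s)) * (du s - K * u s)).
  have hl : is_derive s 1 (fun s : R => - (K * s)) (- K).
    have := is_derive_mul (is_derive_cst (- K) s 1) (is_derive_id s 1).
    move=> h; rewrite (_ : (fun s => _) = (fun y : R => cst (- K) y * id y)); last first.
      by apply/funext => y /=; rewrite mulNr.
    by apply: (is_derive_eq h); rewrite mul0r add0r mulr1.
  have := is_derive_mul (is_derive_comp1 (f := fun s : R => - (K * s))
    (is_derive_expR (- (K * s))) hl) (hu s).
  by move=> h; apply: (is_derive_eq h); rewrite /=; ring.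
have [c _ E] := MVT t0 (fun s _ => hv s) (continuous_subspaceT (is_derive_continuous hv)).
have : v t <= v 0.
  rewrite -subr_le0 E subr0 mulr_le0_ge0 ?(ltW t0)// mulr_ge0_le0 ?expR_ge0//.
  by rewrite subr_le0.
rewrite /v mulr0 oppr0 expR0 mul1r expRN => h.
by rewrite mulrC -ler_pdivrMr ?expR_gt0// mulrC.
Qed.

Lemma sqr_mx_norm n (c : 'cV[R]_n) :
  `|c| ^+ 2 <= \sum_i c i ord0 ^+ 2 <= n%:R * `|c| ^+ 2.
Proof.
apply/andP; split.
  have [->|c0] := eqVneq `|c| 0.
    by rewrite expr0n/= sumr_ge0// => i _; exact: sqr_ge0.
  have [[i j] /= ->] : exists ij : 'I_n * 'I_1, `|c| = `|c ij.1 ij.2| by exact: mx_norm_neq0.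
  rewrite (ord1 j) real_normK ?num_real// (bigD1 i)//= lerDl sumr_ge0// => k _.
  exact: sqr_ge0.
rewrite mulr_natl; apply: (@le_trans _ _ (\sum_(i < n) `|c| ^+ 2)); last first.
  by rewrite sumr_const card_ord.
apply: ler_sum => i _.
by rewrite -(real_normK (num_real (c i ord0))) lerXn2r ?nnegrE// le_mx_norm.
Qed.

(** Gronwall's inequality for the Euclidean norm, which unlike the maximum norm
    is differentiable. *)
Lemma gronwall_norm n (c dc : R -> 'cV[R]_n) (K t : R) : 0 <= K ->
  (forall (s : R) i, is_derive s 1 (fun s => c s i ord0) (dc s i ord0)) ->
  (forall s, `|dc s| <= K * `|c s|) -> 0 <= t ->
  `|c t| <= (1 + expR (2 * n%:R * K * t) * n%:R) * `|c 0|.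
Proof.
move=> K0 hc hK t0; pose u s := \sum_i c s i ord0 ^+ 2.
pose du s := \sum_i (dc s i ord0 * c s i ord0 + c s i ord0 * dc s i ord0).
have hu (s : R) : is_derive s 1 u (du s).
  have := @is_derive_sum _ _ _ n (fun i s => c s i ord0 * c s i ord0) s 1
    (fun i => dc s i ord0 * c s i ord0 + c s i ord0 * dc s i ord0)
    (fun i => is_derive_mul (hc s i) (hc s i)).
  by rewrite (_ : u = \sum_i (fun s => c s i ord0 * c s i ord0))//; apply/funext => y; rewrite fct_sumE.
have duK s : du s <= 2 * n%:R * K * u s.
  apply: (@le_trans _ _ (\sum_(i < n) (2 * (K * `|c s| ^+ 2)))).
    apply: ler_sum => i _.
    have h1 : `|dc s i ord0| <= K * `|c s| by apply: le_trans (le_mx_norm _ _ _) (hK s).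
    have h2 := le_mx_norm (c s) i ord0.
    have : c s i ord0 * dc s i ord0 <= K * `|c s| ^+ 2.
      by rewrite (le_trans (ler_norm _))// normrM expr2 mulrCA ler_pM.
    by lra.
  rewrite sumr_const card_ord -[leLHS]mulr_natl.
  rewrite [leLHS](_ : _ = 2 * n%:R * K * `|c s| ^+ 2); last by ring.
  rewrite ler_wpM2l ?mulr_ge0//.
  by have /andP[] := sqr_mx_norm (c s).
have G := gronwall hu duK t0.
have /andP[_ h0] := sqr_mx_norm (c 0); have /andP[h1 _] := sqr_mx_norm (c t).
set E := expR _ in G *; have E0 : 0 <= E by exact: expR_ge0.
have n0 : 0 <= n%:R :> R by [].
have H : `|c t| ^+ 2 <= E * n%:R * `|c 0| ^+ 2.
  by apply: le_trans h1 (le_trans G _); rewrite -mulrA ler_wpM2l.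
have A0 : 0 <= E * n%:R by exact: mulr_ge0.
rewrite -ler_sqr ?nnegrE ?mulr_ge0 ?addr_ge0//.
apply: le_trans H _; rewrite exprMn ler_wpM2r ?exprn_ge0//; nra.
Qed.

End mean_value.

Section hamiltonian_system.
Context {R : realType} {D : nat} (V : 'cV[R]_D -> R).
Hypothesis V_sub : subquadratic V.
Local Notation phase := 'cV[R]_(D + D).

Lemma lipschitz_grad k : exists2 L : R, 0 <= L &
  forall x y, `|partial k V x - partial k V y| <= L * `|x - y|.
Proof.
have [sV bV] := V_sub.
have /choice[C HC] : forall i, exists C : R, forall x, `|partial i (partial k V) x| <= C.
  by move=> i; exact: (bV [:: i; k]).
pose B := \sum_i `|C i|.
have BC i x : `|partial i (partial k V) x| <= B.
  apply: le_trans (HC i x) _; apply: le_trans (ler_norm _) _.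
  by rewrite /B (bigD1 i)//= lerDl sumr_ge0.
exists (D%:R * B) => [|x y]; first by rewrite mulr_ge0// sumr_ge0.
apply: (@lipschitz_partials _ _ _ (`|x| + `|y|)).
- by move=> i z; exact: (sV [:: k]).2.
- by move=> i w _; exact: BC.
- by rewrite lerDl.
- by rewrite lerDr.
Qed.

Lemma grad_bound : exists2 C : R, 0 <= C & forall k x, `|partial k V x| <= C * (1 + `|x|).
Proof.
have /choice[L HL] : forall k, exists L : R, 0 <= L /\
    forall x y, `|partial k V x - partial k V y| <= L * `|x - y|.
  by move=> k; have [L L0 H] := lipschitz_grad k; exists L.
pose C k := L k + `|partial k V 0|.
have C0 k : 0 <= C k by rewrite addr_ge0//; have [] := HL k.
exists (\sum_k C k) => [|k x]; first by rewrite sumr_ge0.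
have [L0 /(_ x 0)] := HL k; rewrite subr0 => h.
apply: (@le_trans _ _ (C k * (1 + `|x|))); last first.
  by rewrite ler_wpM2r ?addr_ge0// (bigD1 k)//= lerDl sumr_ge0.
rewrite -[partial k V x](subrK (partial k V 0)) (le_trans (ler_normD _ _))//.
rewrite /C; have := normr_ge0 (partial k V 0); have := normr_ge0 x; nra.
Qed.

Lemma continuous_V : continuous V. Proof. exact: (V_sub.1 [::]).1. Qed.

Lemma tame_V m : tame (fun (_ : 'cV[R]_m) x => V x).
Proof.
split.
  by apply: measurableT_comp measurable_snd; apply: continuous_cV_measurable; exact: continuous_V.
have [C C0 HC] := grad_bound.
exists (`|V 0| + D%:R * C), 2%N; split=> [|c x]; first by rewrite addr_ge0// mulr_ge0.
have h : `|V x - V 0| <= D%:R * (C * (1 + `|x|)) * `|x - 0|.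
  apply: (@lipschitz_partials _ _ _ `|x|) => //; last by rewrite normr0.
    by move=> i y; exact: (V_sub.1 [::]).2.
  by move=> i w wx; apply: le_trans (HC i w) _; rewrite ler_wpM2l// lerD2l.
rewrite subr0 in h.
have E : bracket x ^+ 2 <= (bracket c * bracket x) ^+ 2.
  by rewrite lerXn2r ?nnegrE ?mulr_ge0 ?bracket_ge0// ler_peMl ?bracket_ge0 ?bracket_ge1.
apply: (@le_trans _ _ ((`|V 0| + D%:R * C) * bracket x ^+ 2)); last first.
  by rewrite ler_wpM2l// addr_ge0// mulr_ge0.
rewrite -[V x](subrK (V 0)) (le_trans (ler_normD _ _))// addrC mulrDl; apply: lerD.
  by rewrite ler_peMr// bracketX_ge1.
apply: le_trans h _; rewrite -!mulrA ler_wpM2l// ler_wpM2l//.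
by rewrite expr2 ler_wpM2l ?addr_ge0// /bracket lerDr.
Qed.

(** The Hamiltonian is the case [s = 1], the Lagrangian as a function on phase
    space the case [s = -1]. *)
Definition energy (s : R) (z : phase) : R :=
  2^-1 * sqnorm (dsubmx z) + s * V (usubmx z).

Lemma is_derive_kinetic (j : 'I_(D + D)) (z : phase) :
  is_derive z (delta_mx j ord0) (fun z : phase => 2^-1 * sqnorm (dsubmx z))
    (\sum_(k < D) (rshift D k == j)%:R * dsubmx z k ord0).
Proof.
have := is_derive_mul (is_derive_cst (2^-1 : R) z (delta_mx j ord0))
  (@is_derive_sum _ _ _ D (fun k (z : phase) => z (rshift D k) ord0 * z (rshift D k) ord0) z _ _
  (fun k => is_derive_mul (is_derive_coord (rshift D k) j z) (is_derive_coord (rshift D k) j z))).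
move=> h; rewrite (_ : (fun z => _) = (fun y => cst (2^-1) y *
   (\sum_(k < D) (fun z : phase => z (rshift D k) ord0 * z (rshift D k) ord0)) y)).
  apply: (is_derive_eq h); rewrite mul0r add0r mulr_sumr; apply: eq_bigr => k _.
  by rewrite !mxE /=; field.
apply/funext => y; congr (_ * _); rewrite fct_sumE /sqnorm mxE.
by apply: eq_bigr => k _; rewrite !mxE.
Qed.

Lemma is_derive_usub_l (f : 'cV[R]_D -> R) (k : 'I_D) (z : phase) :
  derivable f (usubmx z) (delta_mx k ord0) ->
  is_derive z (delta_mx (lshift D k) ord0) (fun z : phase => f (usubmx z))
    (partial k f (usubmx z)).
Proof.
move=> df; apply: (is_derive_along (c := @usubmx R D D 1) (v := delta_mx k ord0)).
  move=> h; apply/colP => i; rewrite !mxE eqxx !andbT.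
  by rewrite (inj_eq (@lshift_inj D D)).
exact: DeriveDef.
Qed.

Lemma is_derive_usub_r (f : 'cV[R]_D -> R) (k : 'I_D) (z : phase) :
  is_derive z (delta_mx (rshift D k) ord0) (fun z : phase => f (usubmx z)) 0.
Proof.
apply: is_derive_unline; rewrite (_ : (fun h => _) = (fun=> f (usubmx z))).
  exact: is_derive_cst.
apply/funext => h; congr f; apply/colP => i; rewrite !mxE eqxx andbT.
by rewrite eq_lrshift mulr0 addr0.
Qed.

Lemma is_derive_energy_l (s : R) (k : 'I_D) (z : phase) :
  is_derive z (delta_mx (lshift D k) ord0) (energy s) (s * partial k V (usubmx z)).
Proof.
have dV : is_derive z (delta_mx (lshift D k) ord0) (fun z => V (usubmx z))
    (partial k V (usubmx z)).
  by apply: is_derive_usub_l; exact: (V_sub.1 [::]).2.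
have := is_derive_add (is_derive_kinetic (lshift D k) z)
  (is_derive_mul (is_derive_cst s z (delta_mx (lshift D k) ord0)) dV).
move=> h; apply: (is_derive_eq h); rewrite mul0r add0r big1 ?add0r// => l _.
by rewrite eq_sym eq_lrshift mul0r.
Qed.

Lemma is_derive_energy_r (s : R) (k : 'I_D) (z : phase) :
  is_derive z (delta_mx (rshift D k) ord0) (energy s) (dsubmx z k ord0).
Proof.
have dV := is_derive_usub_r V k z.
have := is_derive_add (is_derive_kinetic (rshift D k) z)
  (is_derive_mul (is_derive_cst s z (delta_mx (rshift D k) ord0)) dV).
move=> h; apply: (is_derive_eq h); rewrite mul0r mulr0 !addr0 (bigD1 k)//= eqxx mul1r.
rewrite big1 ?addr0// => l lk; rewrite (inj_eq (@rshift_inj D D)).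
by rewrite (negbTE lk) mul0r.
Qed.

Lemma energyE : hamiltonian V = energy 1.
Proof. by apply/funext => z; rewrite /energy mul1r. Qed.

Lemma grad_hamiltonian z :
  grad (hamiltonian V) z = col_mx (grad V (usubmx z)) (dsubmx z).
Proof.
apply/colP => i; rewrite !mxE energyE /partial; case: splitP => k ik.
  have -> : i = lshift D k by exact: val_inj.
  by rewrite mxE (derive_val (is_derive := is_derive_energy_l 1 k z)) mul1r.
have -> : i = rshift D k by exact: val_inj.
by rewrite (derive_val (is_derive := is_derive_energy_r 1 k z)) mxE.
Qed.

Definition vector_field (z : phase) : phase := symplJ R D *m grad (hamiltonian V) z.

Lemma vector_fieldE z : vector_field z = col_mx (dsubmx z) (- grad V (usubmx z)).
Proof.
rewrite /vector_field grad_hamiltonian /symplJ mul_block_col.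
by rewrite mul0mx add0r mul1mx mulNmx mul1mx mul0mx addr0.
Qed.

Lemma vector_field_lipschitz : exists2 L : R, 0 <= L &
  forall z z', `|vector_field z - vector_field z'| <= L * `|z - z'|.
Proof.
have /choice[L HL] : forall k, exists L : R, 0 <= L /\
    forall x y, `|partial k V x - partial k V y| <= L * `|x - y|.
  by move=> k; have [L L0 H] := lipschitz_grad k; exists L.
have S0 : 0 <= \sum_k L k by rewrite sumr_ge0// => k _; have [] := HL k.
exists (1 + \sum_k L k) => [|z z']; first by rewrite addr_ge0.
have nz := normr_ge0 (z - z').
apply: mx_norm_le => [|i j]; first by rewrite mulr_ge0// addr_ge0.
rewrite (ord1 j) mxBE !vector_fieldE !mxE; case: splitP => k _.
  rewrite !mxE -mxBE (le_trans (le_mx_norm _ _ _))// ler_peMl// lerDl.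
  exact: S0.
rewrite !mxE -opprD normrN; have [Lk0 H] := HL k.
apply: le_trans (H _ _) _; apply: ler_pM => //.
  by rewrite (bigD1 k)//= addrCA lerDl addr_ge0// sumr_ge0// => l _; have [] := HL l.
apply: mx_norm_le => // l m; rewrite mxBE !mxE -mxBE.
exact: le_mx_norm.
Qed.

Variable flow : R -> phase -> phase.
Hypothesis flowP : is_flow V flow.

Lemma is_derive_flow (t : R) (z : phase) i :
  is_derive t 1 (fun s => flow s z i ord0) (vector_field (flow t z) i ord0).
Proof.
have [dm E] := (flowP z).2 t.
have /derivable_mxP/(_ i ord0) di := dm.
by split=> //; rewrite /vector_field -E derive_mx// mxE.
Qed.

(** Second derivatives of [V] are bounded, so the vector field is globally
    Lipschitz and Gronwall's inequality applies to the difference of two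
    trajectories. *)
Lemma flow_lipschitz t : 0 <= t -> exists2 L : R, 0 <= L &
  forall s z z', 0 <= s <= t -> `|flow s z - flow s z'| <= L * `|z - z'|.
Proof.
move=> t0; have [K K0 HK] := vector_field_lipschitz.
have c0 : 0 <= 2 * (D + D)%:R * K by rewrite !mulr_ge0.
exists (1 + expR (2 * (D + D)%:R * K * t) * (D + D)%:R).
  by rewrite addr_ge0// mulr_ge0// expR_ge0.
move=> s z z' /andP[s0 st].
have := @gronwall_norm _ _ (fun s => flow s z - flow s z')
  (fun s => vector_field (flow s z) - vector_field (flow s z')) K s K0.
rewrite (flowP z).1 (flowP z').1 => H; apply: le_trans (H _ _ s0) _.
- move=> r i; rewrite mxBE (_ : (fun s => _) =
    ((fun s => flow s z i ord0) \- (fun s => flow s z' i ord0))).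
    by apply: is_deriveB; exact: is_derive_flow.
  by apply/funext => y; rewrite mxBE.
- by move=> r; exact: HK.
- by rewrite ler_wpM2r// lerD2l ler_wpM2r// ler_expR ler_wpM2l.
Qed.

Lemma continuous_lip (U W : normedModType R) (f : U -> W) (L : R) :
  (forall z z', `|f z - f z'| <= L * `|z - z'|) -> continuous f.
Proof.
move=> Lf z; apply/cvgrPdist_le => e e0; near=> y.
apply: le_trans (Lf z y) _.
apply: (@le_trans _ _ ((1 + `|L|) * `|z - y|)).
  by rewrite ler_wpM2r// (le_trans (ler_norm _))// lerDr.
rewrite mulrC -ler_pdivlMr ?ltr_pwDl//.
by near: y; apply: cvgr_dist_le cvg_id _ _; rewrite divr_gt0// ltr_pwDl.
Unshelve. all: by end_near. Qed.

Lemma continuous_flow t : 0 <= t -> continuous (flow t).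
Proof.
move=> t0; have [L _ HL] := flow_lipschitz t0.
by apply: (@continuous_lip _ _ (flow t) L) => z z'; apply: HL; rewrite t0 lexx.
Qed.

Lemma continuous_flow_coord t i : 0 <= t -> continuous (fun z => flow t z i ord0).
Proof.
move=> t0 z; apply: (@continuous_comp _ _ _ (flow t) (fun x : phase => x i ord0)).
  exact: continuous_flow.
exact: coord_continuous.
Qed.

Lemma measurable_flow t : 0 <= t -> measurable_fun setT (flow t).
Proof.
move=> t0; apply: measurable_fun_cV => i; apply: continuous_cV_measurable.
exact: continuous_flow_coord.
Qed.

Lemma flow_growth t : 0 <= t -> exists2 C : R, 0 <= C &
  forall z, bracket (flow t z) <= C * bracket z.
Proof.
move=> t0; have [L L0 HL] := flow_lipschitz t0.
exists (1 + `|flow t 0| + L) => [|z]; first by rewrite !addr_ge0.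
have := HL t z 0; rewrite t0 lexx subr0 => /(_ isT) h.
have : `|flow t z| <= L * `|z| + `|flow t 0|.
  by rewrite -[flow t z](subrK (flow t 0)) (le_trans (ler_normD _ _))// lerD2r.
rewrite /bracket; have := normr_ge0 z; have := normr_ge0 (flow t 0); nra.
Qed.

End hamiltonian_system.


(** * The action and the stability matrix *)

Section local_lipschitz.
Context {R : realType}.

Lemma continuous_loclip (U W : normedModType R) (f : U -> W) :
  (forall z, exists K, forall z', `|z - z'| <= 1 -> `|f z - f z'| <= K * `|z - z'|) ->
  continuous f.
Proof.
move=> Lf z; have [K HK] := Lf z; apply/cvgrPdist_le => e e0; near=> y.
have y1 : `|z - y| <= 1 by near: y; exact: cvgr_dist_le cvg_id _ ltr01.
apply: le_trans (HK y y1) _.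
apply: (@le_trans _ _ ((1 + `|K|) * `|z - y|)).
  by rewrite ler_wpM2r// (le_trans (ler_norm _))// lerDr.
rewrite mulrC -ler_pdivlMr ?ltr_pwDl//.
by near: y; apply: cvgr_dist_le cvg_id _ _; rewrite divr_gt0// ltr_pwDl.
Unshelve. all: by end_near. Qed.

Lemma is_derive_cvg_seq (U : normedModType R) (f : U -> R) (x v : U) (df : R) :
  is_derive x v f df ->
  k.+1%:R * (f (x + k.+1%:R^-1 *: v) - f x) @[k --> \oo] --> df.
Proof.
move=> [fc dfE].
have h0 : (k.+1%:R : R)^-1 @[k --> \oo] --> 0^'.
  move=> A [e /= e0 HA]; change (\forall k \near \oo, A ((k.+1%:R : R)^-1)); near=> k.
  apply: HA; last by rewrite gt_eqF// invr_gt0 ltr0n.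
  rewrite /= sub0r normrN ger0_norm ?invr_ge0//.
  by near: k; exact: near_infty_natSinv_lt (PosNum e0).
have q0 : (fun h : R => h^-1 *: ((f \o shift x) (h *: v) - f x)) @ 0^' --> df.
  by rewrite -dfE; exact: fc.
have := cvg_comp _ _ h0 q0; apply: cvg_trans; apply: near_eq_cvg; apply: nearW => k /=.
by rewrite invrK [_ *: v + x]addrC.
Unshelve. all: by end_near. Qed.

Lemma is_derive_bound (U : normedModType R) (f : U -> R) (x v : U) (df L : R) :
  is_derive x v f df -> (forall h, `|f (x + h *: v) - f x| <= L * `|h|) -> `|df| <= L.
Proof.
move=> /is_derive_cvg_seq/cvg_norm c fL.
rewrite -(cvg_lim _ c)//; apply: limr_le; first by apply/cvg_ex; exists `|df|.
apply: nearW => k; rewrite normrM ger0_norm// mulrC -ler_pdivlMr ?ltr0n//.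
by apply: le_trans (fL _) _; rewrite ger0_norm ?invr_ge0.
Qed.

End local_lipschitz.

Section flow_data.
Context {R : realType} {D : nat} (V : 'cV[R]_D -> R).
Hypothesis V_sub : subquadratic V.
Local Notation phase := 'cV[R]_(D + D).
Variable flow : R -> phase -> phase.
Hypothesis flowP : is_flow V flow.

Lemma energy_lipschitz s r : 0 <= r -> exists2 C : R, 0 <= C &
  forall z z' : phase, `|z| <= r -> `|z'| <= r ->
  `|energy V s z - energy V s z'| <= C * `|z - z'|.
Proof.
move=> r0; have [C C0 HC] := grad_bound V_sub.
exists ((D + D)%:R * (r + `|s| * (C * (1 + r)))) => [|z z' zr zr'].
  by rewrite mulr_ge0// addr_ge0// !mulr_ge0// addr_ge0.
have C1 : 0 <= `|s| * (C * (1 + r)) by rewrite !mulr_ge0// addr_ge0.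
have dE (j : 'I_(D + D)) (w : phase) : exists2 d : R,
    is_derive w (delta_mx j ord0) (energy V s) d &
    (`|w| <= r -> `|d| <= r + `|s| * (C * (1 + r))).
  case: (splitP j) => k jk.
    have -> : j = lshift D k by exact: val_inj.
    exists (s * partial k V (usubmx w)); first exact: is_derive_energy_l.
    move=> wr; rewrite normrM; apply: (@le_trans _ _ (`|s| * (C * (1 + r)))).
      rewrite ler_wpM2l// (le_trans (HC _ _))// ler_wpM2l// lerD2l.
      by apply: le_trans wr; have := bracket_usubmx w; rewrite /bracket lerD2l.
    by rewrite lerDr.
  have -> : j = rshift D k by exact: val_inj.
  exists (dsubmx w k ord0); first exact: is_derive_energy_r.
  by move=> wr; rewrite mxE (le_trans (le_mx_norm _ _ _))// (le_trans wr)// lerDl.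
apply: (@lipschitz_partials _ _ _ r) => // [j w|j w wr].
  by have [d []] := dE j w.
have [d dd hd] := dE j w.
by rewrite /partial (derive_val (is_derive := dd)); exact: hd.
Qed.

Lemma flow_bounded (t : R) (z : phase) : 0 <= t ->
  exists2 B : R, 0 <= B & forall s, 0 <= s <= t -> `|flow s z| <= B.
Proof.
move=> t0; pose u s := \sum_i flow s z i ord0 ^+ 2.
have cu : continuous u.
  apply: is_derive_continuous => s.
  have := @is_derive_sum _ _ _ (D + D) (fun i s => flow s z i ord0 * flow s z i ord0) s 1 _
    (fun i => is_derive_mul (is_derive_flow flowP s z i) (is_derive_flow flowP s z i)).
  by rewrite (_ : u = \sum_i (fun s => flow s z i ord0 * flow s z i ord0));
    [exact|apply/funext => y; rewrite fct_sumE].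
have [c _ Hc] := EVT_max t0 (continuous_subspaceT cu).
have uc0 : 0 <= u c by apply: sumr_ge0 => i _; exact: sqr_ge0.
exists (1 + u c) => [|s st]; first exact: addr_ge0.
have /andP[h _] := sqr_mx_norm (flow s z).
have h2 : `|flow s z| ^+ 2 <= u c by apply: le_trans h (Hc s _); rewrite in_itv.
by have := normr_ge0 (flow s z); nra.
Qed.

(** On bounded sets the Lagrangian is Lipschitz, and nearby trajectories stay
    close and bounded up to time [t]; the mean value theorem in time compares
    their actions. *)
Lemma continuous_action (S : R -> phase -> R) t :
  is_action V flow S -> 0 <= t -> continuous (S t).
Proof.
move=> SP t0; apply: continuous_loclip => z.
have [L L0 HL] := flow_lipschitz V_sub flowP t0.
have [B B0 HB] := flow_bounded z t0.
have BL : 0 <= B + L by exact: addr_ge0.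
have [C C0 HC] := energy_lipschitz (-1) BL.
exists (C * L * t) => z' zz'.
have dS (s : R) : is_derive s 1 (fun s => S s z - S s z')
    (energy V (-1) (flow s z) - energy V (-1) (flow s z')).
  have h1 := (SP z).2 s; have h2 := (SP z').2 s.
  have := is_deriveB h1 h2; move=> h.
  by apply: (is_derive_eq h); rewrite /energy !mulN1r.
have [c] := MVT_segment t0 (fun s _ => dS s) (continuous_subspaceT (is_derive_continuous dS)).
rewrite in_itv/= => ct; rewrite (SP z).1 (SP z').1 !subr0 => ->.
have Lz := HL c z z' ct.
have c1 : `|flow c z| <= B + L by rewrite (le_trans (HB c ct))// lerDl.
have c2 : `|flow c z'| <= B + L.
  rewrite -[flow c z'](subKr (flow c z)) (le_trans (ler_normB _ _))// lerD ?HB//.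
  by rewrite (le_trans Lz)// ler_piMr.
rewrite normrM (ger0_norm t0) [leRHS]mulrAC ler_wpM2r// (le_trans (HC _ _ c1 c2))//.
by rewrite -mulrA ler_wpM2l.
Qed.

(** The entries are directional derivatives of the flow, which is Lipschitz. *)
Lemma stability_bound (M : R -> phase -> 'M[R]_(D + D)) t :
  is_stability V flow M -> 0 <= t ->
  exists2 L : R, 0 <= L & forall z i j, `|M t z i j| <= L.
Proof.
move=> MP t0; have [L L0 HL] := flow_lipschitz V_sub flowP t0.
exists L => // z i j; have [dM _ _] := MP z.
apply: (is_derive_bound (dM t i j)) => h; rewrite -mxBE.
apply: le_trans (le_mx_norm _ _ _) _.
have := HL t (z + h *: delta_mx j ord0) z; rewrite t0 lexx addrAC subrr add0r => /(_ isT) H.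
apply: le_trans H _; rewrite ler_wpM2l//; apply: mx_norm_le => // k l.
by rewrite !mxE normrM ler_piMr//; case: (_ && _); rewrite ?normr1 ?normr0.
Qed.

(** The entries of the stability matrix are limits of difference quotients. *)
Lemma measurable_stability (M : R -> phase -> 'M[R]_(D + D)) t i j :
  is_stability V flow M -> 0 <= t -> measurable_fun setT (fun z => M t z i j).
Proof.
move=> MP t0; have cf : continuous (fun z => flow t z i ord0) by apply: (continuous_flow_coord V_sub flowP).
apply: (@measurable_fun_cvg _ _ _ setT (fun k (z : phase) => k.+1%:R *
  (flow t (z + k.+1%:R^-1 *: delta_mx j ord0) i ord0 - flow t z i ord0))).
  move=> k; apply: measurable_funM; first exact: measurable_cst.
  have cT : continuous (fun z : phase => z + k.+1%:R^-1 *: delta_mx j ord0).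
    apply: (@continuous_lip _ _ _ _ 1) => z z'.
    by rewrite opprD addrACA subrr addr0 mul1r.
  apply: measurable_funB; apply: continuous_cV_measurable; last exact: cf.
  move=> z; exact: (@continuous_comp _ _ _ (fun z : phase => z + k.+1%:R^-1 *: delta_mx j ord0)
    (fun x => flow t x i ord0) z (cT z) (cf _)).
by move=> z _; have [dM _ _] := MP z; exact: (is_derive_cvg_seq (dM t i j)).
Qed.

End flow_data.


(** * The Herman-Kluk prefactor *)

Section schwarz_theorem.
Context {R : realType}.

Lemma eq_of_nearby (U : normedModType R) (f g : U -> R) (x : U) :
  {for x, continuous f} -> {for x, continuous g} ->
  (forall h : R, 0 < h -> exists y z : U, [/\ `|y - x| <= h, `|z - x| <= h & f y = g z]) ->
  f x = g x.
Proof.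
move=> cf cg H; apply/eqP; rewrite -subr_eq0 -normr_eq0 eq_le normr_ge0 andbT.
apply/ler_addgt0Pr => e e0; rewrite add0r.
have e2 : 0 < e / 2 by rewrite divr_gt0.
have /cvgrPdist_le/(_ _ e2)/nbhs_normP[r1 /= r10 H1] := cf.
have /cvgrPdist_le/(_ _ e2)/nbhs_normP[r2 /= r20 H2] := cg.
have r0 : 0 < Num.min r1 r2 / 2 by rewrite divr_gt0// lt_min r10.
have [y [z [yx zx E]]] := H _ r0.
have lt2 : Num.min r1 r2 / 2 < Num.min r1 r2.
  by rewrite ltr_pdivrMr// ltr_pMr ?ltr1n// lt_min r10.
have h1 : `|f x - f y| <= e / 2.
  apply: H1; rewrite /= distrC; apply: le_lt_trans yx (lt_le_trans lt2 _).
  by rewrite ge_min lexx.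
have h2 : `|g x - g z| <= e / 2.
  apply: H2; rewrite /= distrC; apply: le_lt_trans zx (lt_le_trans lt2 _).
  by rewrite ge_min lexx orbT.
have -> : f x - g x = (f x - f y) - (g x - g z) by rewrite E; ring.
by rewrite (le_trans (ler_normB _ _))// [leRHS]splitr lerD.
Qed.

(** Two applications of the mean value theorem, along [i] and then along [j]. *)
Lemma second_difference n (f : 'cV[R]_n -> R) (i j : 'I_n) (x : 'cV[R]_n) (h : R) :
  smooth f -> 0 < h ->
  exists2 y : 'cV[R]_n, `|y - x| <= 2 * h &
    f (x + h *: delta_mx j ord0 + h *: delta_mx i ord0) - f (x + h *: delta_mx i ord0) -
    (f (x + h *: delta_mx j ord0) - f x) = partial j (partial i f) y * h * h.
Proof.
move=> sf h0; pose ei : 'cV[R]_n := delta_mx i ord0; pose ej : 'cV[R]_n := delta_mx j ord0.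
have hx (s : R) : is_derive s 1 (fun s => f (x + h *: ej + s *: ei) - f (x + s *: ei))
    (partial i f (x + h *: ej + s *: ei) - partial i f (x + s *: ei)).
  by apply: is_deriveB; apply: is_derive_line; apply: DeriveDef => //; exact: (sf [::]).2.
have [c] := MVT_segment (ltW h0) (fun s _ => hx s)
  (continuous_subspaceT (is_derive_continuous hx)).
rewrite in_itv/= scale0r !addr0 subr0 => /andP[c0 ch] E1.
have hy (s : R) : is_derive s 1 (fun s => partial i f (x + c *: ei + s *: ej))
    (partial j (partial i f) (x + c *: ei + s *: ej)).
  by apply: is_derive_line; apply: DeriveDef => //; exact: (sf [:: i]).2.
have [c'] := MVT_segment (ltW h0) (fun s _ => hy s)
  (continuous_subspaceT (is_derive_continuous hy)).
rewrite in_itv/= scale0r !addr0 subr0 => /andP[c'0 c'h] E2.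
exists (x + c *: ei + c' *: ej).
  have bnd (k : 'I_n) (a : R) : 0 <= a -> a <= h -> `|a *: (delta_mx k ord0 : 'cV[R]_n)| <= h.
    move=> a0 ah; apply: mx_norm_le => [|u v]; first exact: ltW.
    rewrite !mxE normrM (ger0_norm a0) (le_trans _ ah)// ler_piMr//.
    by case: (_ && _); rewrite ?normr1 ?normr0.
  rewrite -!addrA addrC -!addrA addNr addr0 mulr_natl mulr2n.
  by apply: le_trans (ler_normD _ _) _; apply: lerD; exact: bnd.
by rewrite E1 [x + _ + _]addrAC E2.
Qed.

(** The second difference is symmetric in the two directions, so both iterated
    partial derivatives are its limit after division by [h ^+ 2]. *)
Lemma partial_comm n (f : 'cV[R]_n -> R) (i j : 'I_n) (x : 'cV[R]_n) :
  smooth f -> partial i (partial j f) x = partial j (partial i f) x.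
Proof.
move=> sf; apply: eq_of_nearby.
- exact: (sf [:: i; j]).1.
- exact: (sf [:: j; i]).1.
move=> h h0; have h2 : 0 < h / 2 by rewrite divr_gt0.
have [y yx Ey] := second_difference j i x sf h2.
have [z zx Ez] := second_difference i j x sf h2.
have E2 : 2 * (h / 2) = h by rewrite mulrC divfK.
rewrite E2 in yx zx; exists y, z; split; [exact: yx|exact: zx|].
apply: (mulIf (lt0r_neq0 h2)); apply: (mulIf (lt0r_neq0 h2)).
apply: etrans (etrans (esym Ey) _) Ez.
have swap (a b c d : R) : a - b - (c - d) = a - c - (b - d) by ring.
by rewrite [x + _ + _]addrAC; exact: swap.
Qed.

End schwarz_theorem.

Section hessian.
Context {R : realType} {D : nat} (V : 'cV[R]_D -> R).
Hypothesis V_sub : subquadratic V.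
Local Notation phase := 'cV[R]_(D + D).

Lemma partial_hamiltonian_l k :
  partial (lshift D k) (hamiltonian V) = fun z => partial k V (usubmx z).
Proof.
apply/funext => z; rewrite energyE /partial.
by rewrite (derive_val (is_derive := is_derive_energy_l V_sub 1 k z)) mul1r.
Qed.

Lemma partial_hamiltonian_r k :
  partial (rshift D k) (hamiltonian V) = fun z => z (rshift D k) ord0.
Proof.
apply/funext => z; rewrite energyE /partial.
by rewrite (derive_val (is_derive := is_derive_energy_r V 1 k z)) mxE.
Qed.

Lemma Hess_hamiltonian_sym (z : phase) :
  (Hess (hamiltonian V) z)^T = Hess (hamiltonian V) z.
Proof.
have dl k l : partial (lshift D k) (partial (lshift D l) (hamiltonian V)) z =
    partial k (partial l V) (usubmx z).
  rewrite partial_hamiltonian_l; apply: derive_val.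
  by apply: is_derive_usub_l; exact: (V_sub.1 [:: l]).2.
have drl k l : partial (rshift D k) (partial (lshift D l) (hamiltonian V)) z = 0.
  by rewrite partial_hamiltonian_l; apply: derive_val; exact: is_derive_usub_r.
have dr k l : partial k (partial (rshift D l) (hamiltonian V)) z = (rshift D l == k)%:R.
  by rewrite partial_hamiltonian_r; apply: derive_val; exact: is_derive_coord.
apply/matrixP => i j; rewrite !mxE.
have [k ->|k ->] := split_ordP i; have [l ->|l ->] := split_ordP j.
- by rewrite !dl partial_comm//; exact: V_sub.1.
- by rewrite dr drl eq_sym eq_lrshift.
- by rewrite dr drl eq_sym eq_lrshift.
- by rewrite !dr eq_sym.
Qed.

End hessian.


Section symplectic.
Context {R : realType} {D : nat}.
Local Notation phase := 'cV[R]_(D + D).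
Local Notation J := (symplJ R D).

Lemma is_derive_mulmx m n p (A : R -> 'M[R]_(m, n)) (B : R -> 'M[R]_(n, p))
    (dA : 'M[R]_(m, n)) (dB : 'M[R]_(n, p)) (s : R) :
  (forall i j, is_derive s 1 (fun s => A s i j) (dA i j)) ->
  (forall i j, is_derive s 1 (fun s => B s i j) (dB i j)) ->
  forall i j, is_derive s 1 (fun s => (A s *m B s) i j) ((dA *m B s + A s *m dB) i j).
Proof.
move=> hA hB i j.
have := @is_derive_sum _ _ _ n (fun k s => A s i k * B s k j) s 1
  (fun k => dA i k * B s k j + A s i k * dB k j) (fun k => is_derive_mul (hA i k) (hB k j)).
rewrite (_ : \sum_(i0 < n) (fun s => _) = (fun s => (A s *m B s) i j)); last first.
  by apply/funext => y; rewrite fct_sumE mxE.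
by move=> h; apply: (is_derive_eq h); rewrite !mxE big_split.
Qed.

Lemma symplJ_tr : J^T = - J.
Proof. by rewrite /symplJ tr_block_mx !trmx0 linearN/= trmx1 opp_block_mx !oppr0 opprK. Qed.

Lemma symplJ_sqr : J *m J = - 1%:M.
Proof.
rewrite /symplJ mulmx_block !mul0mx !mulmx0 !mulNmx !mul1mx !addr0 !add0r.
by rewrite -[1%:M in RHS]/(scalar_mx 1) scalar_mx_block opp_block_mx !oppr0.
Qed.

Lemma symplJ_form (a b c d : 'cV[R]_D) :
  (col_mx a b)^T *m J *m col_mx c d = a^T *m d - b^T *m c.
Proof.
rewrite tr_col_mx /symplJ mul_row_block mul_row_col.
by rewrite !mulmx0 add0r addr0 mulmxN !mulmx1 addrC mulNmx.
Qed.

(** With [H] the symmetric Hessian, the derivative of [M^T J M] is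
    [M^T H J^T J M + M^T J J H M], where [J^T J = 1] and [J J = - 1]. *)
Lemma stability_symplectic (V : 'cV[R]_D -> R) (flow : R -> phase -> phase)
    (M : R -> phase -> 'M[R]_(D + D)) (t : R) (z : phase) :
  subquadratic V -> is_stability V flow M -> (M t z)^T *m J *m M t z = J.
Proof.
move=> V_sub MP; have [_ M0 dM] := MP z.
pose H s := Hess (hamiltonian V) (flow s z).
have hM (s : R) i j : is_derive s 1 (fun s => M s z i j) ((J *m H s *m M s z) i j).
  have [dm E] := dM s; have /derivable_mxP/(_ i j) di := dm.
  by split=> //; rewrite -E derive_mx// mxE.
have hJ (s : R) (i j : 'I_(D + D)) : is_derive s 1 (fun _ : R => J i j) ((0 : 'M[R]_(D + D)) i j).
  by rewrite [X in is_derive _ _ _ X]mxE; exact: is_derive_cst.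
have hT (s : R) i j : is_derive s 1 (fun s => (M s z)^T i j) ((J *m H s *m M s z)^T i j).
  rewrite mxE (_ : (fun s => _) = (fun s => M s z j i)); first exact: hM.
  by apply/funext => y; rewrite mxE.
apply/matrixP => i j; rewrite -mulmxA.
have := @is_derive_0_is_cst R (fun s => ((M s z)^T *m (J *m M s z)) i j) t 0.
rewrite M0 mulmx1 trmx1 mul1mx; apply=> s.
have := is_derive_mulmx (hT s) (is_derive_mulmx (hJ s) (hM s)) i j.
move=> h; apply: (is_derive_eq h); rewrite mul0mx add0r.
rewrite !trmx_mul Hess_hamiltonian_sym// symplJ_tr !mulmxA.
rewrite -[_ *m - J *m J]mulmxA mulNmx symplJ_sqr opprK mulmx1.
rewrite -[(M s z)^T *m J *m J]mulmxA symplJ_sqr mulmxN mulmx1 !mulNmx.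
by rewrite !mxE subrr.
Qed.

End symplectic.

Section nondegenerate.
Context {R : realType} {D : nat} (Gamma : 'M[R]_D).
Hypothesis Gamma_sym : Gamma^T = Gamma.
Hypothesis Gamma_pos : forall v : 'cV[R]_D, v != 0 -> 0 < (v^T *m Gamma *m v) ord0 ord0.
Local Notation toC A := (map_mx (real_complex R) A).

Let quad (v : 'cV[R]_D) : R := (v^T *m Gamma *m v) ord0 ord0.

Let quad_ge0 v : 0 <= quad v.
Proof.
have [->|/Gamma_pos/ltW//] := eqVneq v 0.
by rewrite /quad mulmx0 mxE.
Qed.

Lemma posdef_unit : Gamma \in unitmx.
Proof.
rewrite unitmxE unitfE; apply/negP => /eqP/eqP/det0P[v v0 vG].
have /Gamma_pos : v^T != 0 by rewrite -(inj_eq (can_inj (@trmxK _ _ _))) trmxK trmx0.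
by rewrite trmxK vG mul0mx mxE ltxx.
Qed.

Lemma toC_eq0 m n (a b : 'M[R]_(m, n)) : toC a + 'i%C *: toC b = 0 -> a = 0 /\ b = 0.
Proof.
move=> /matrixP ab; split; apply/matrixP => i j; have := ab i j; rewrite !mxE.
  by move=> /(congr1 (@complex.Re R)) /=; rewrite !(mul0r, mul1r, mulr0, subr0, addr0).
by move=> /(congr1 (@complex.Im R)) /=; rewrite !(mul0r, mul1r, mulr0, add0r, addr0).
Qed.

Definition HK_re (M : 'M[R]_(D + D)) : 'M[R]_D :=
  ulsubmx M + invmx Gamma *m drsubmx M *m Gamma.

Definition HK_im (M : 'M[R]_(D + D)) : 'M[R]_D :=
  invmx Gamma *m dlsubmx M - ursubmx M *m Gamma.

Lemma HK_matrixE M : HK_matrix Gamma M = toC (HK_re M) + 'i%C *: toC (HK_im M).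
Proof. by rewrite /HK_matrix !map_mxD map_mxN scalerDr scalerN addrAC addrA. Qed.

(** A kernel vector [x + i y] gives the real vectors [X = (x, Gamma y)] and
    [Y = (y, - Gamma x)], whose images [M X = (p1, p2)] and [M Y = (q1, q2)]
    satisfy [q2 = Gamma p1] and [p2 = - Gamma q1]. The symplectic form of [X] and
    [Y] is then [- quad x - quad y], that of their images [quad p1 + quad q1]. As
    [M] preserves the form, all four vanish. *)
Lemma HK_det_neq0 (M : 'M[R]_(D + D)) :
  M^T *m symplJ R D *m M = symplJ R D -> \det (HK_matrix Gamma M) != 0.
Proof.
move=> Msympl; apply/negP; rewrite -det_tr => /det0P[v v0 vK].
pose P := HK_re M; pose Q := HK_im M.
pose x : 'cV[R]_D := map_mx (@complex.Re R) v^T.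
pose y : 'cV[R]_D := map_mx (@complex.Im R) v^T.
have vE : v^T = toC x + 'i%C *: toC y.
  apply/matrixP => i j; rewrite !mxE; case: (v j i) => a b.
  by apply/eqP; rewrite eq_complex /= !(mul0r, mul1r, mulr0, subr0, addr0, add0r) !eqxx.
have [E1 E2] : P *m x - Q *m y = 0 /\ P *m y + Q *m x = 0.
  apply: toC_eq0; rewrite map_mxB map_mxD !map_mxM.
  have : HK_matrix Gamma M *m v^T = 0 by rewrite -[LHS]trmxK trmx_mul trmxK vK trmx0.
  rewrite HK_matrixE vE mulmxDl !mulmxDr -!scalemxAl -!scalemxAr scalerA => <-.
  rewrite (_ : 'i%C * 'i%C = -1 :> R[i]); last by rewrite -expr2 sqr_i.
  rewrite scaleN1r scalerDr; set a := toC P *m toC x; set b := toC Q *m toC y.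
  set c := 'i%C *: _; set d := 'i%C *: _.
  by rewrite -[RHS]addrA [d - b]addrC !addrA [a + c - b]addrAC.
pose p1 := ulsubmx M *m x + ursubmx M *m (Gamma *m y).
pose p2 := dlsubmx M *m x + drsubmx M *m (Gamma *m y).
pose q1 := ulsubmx M *m y - ursubmx M *m (Gamma *m x).
pose q2 := dlsubmx M *m y - drsubmx M *m (Gamma *m x).
have Gu := posdef_unit.
have q2E : q2 = Gamma *m p1.
  suff -> : p1 = invmx Gamma *m q2 by rewrite mulKVmx.
  apply/eqP; rewrite -subr_eq0 -E1; apply/eqP.
  rewrite /p1 /q2 /P /Q /HK_re /HK_im !(mulmxDl, mulmxDr, mulmxN, mulNmx) !mulmxA !opprD !opprK.
  by rewrite [LHS]addrACA [RHS]addrACA; congr (_ + _); rewrite addrC.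
have p2E : p2 = - (Gamma *m q1).
  suff -> : q1 = - (invmx Gamma *m p2) by rewrite mulmxN opprK mulKVmx.
  apply/eqP; rewrite -subr_eq0 opprK -E2; apply/eqP.
  rewrite /q1 /p2 /P /Q /HK_re /HK_im !(mulmxDl, mulmxDr, mulmxN, mulNmx) !mulmxA.
  by rewrite [LHS]addrACA [RHS]addrACA; congr (_ + _); rewrite addrC.
have MX : M *m col_mx x (Gamma *m y) = col_mx p1 p2.
  by rewrite -{1}(submxK M) mul_block_col.
have MY : M *m col_mx y (- (Gamma *m x)) = col_mx q1 q2.
  by rewrite -{1}(submxK M) mul_block_col !mulmxN.
have := symplJ_form p1 p2 q1 q2; rewrite -MX -MY trmx_mul !mulmxA.
rewrite -[_ *m M^T *m _]mulmxA -[_ *m (M^T *m _) *m M]mulmxA Msympl symplJ_form.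
rewrite q2E p2E trmx_mul [(- _)^T]linearN/= trmx_mul Gamma_sym !mulmxN mulNmx opprK !mulmxA.
move=> /matrixP/(_ ord0 ord0); rewrite [LHS]mxE [RHS]mxE [LHS](_ : _ = - quad x - quad y); last first.
  by congr (_ + _); rewrite [LHS]mxE.
rewrite -/(quad p1) -/(quad q1) => E.
have := quad_ge0 p1; have := quad_ge0 q1; have := quad_ge0 x; have := quad_ge0 y => y0 x0 h1 h2.
have quad0 u : quad u = 0 -> u = 0.
  move=> uE; apply/eqP; apply: contra_eqT (uE) => /Gamma_pos; rewrite -/(quad u).
  by move=> /lt0r_neq0.
have xE : x = 0 by apply: quad0; lra.
have yE : y = 0 by apply: quad0; lra.
by move: v0; rewrite -(trmxK v) vE xE yE !map_mx0 scaler0 addr0 trmx0 eqxx.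
Qed.

End nondegenerate.


Section continuous_root.
Context {R : realType}.
Local Notation normc := (@Normc.normc R).

Lemma uniformly_continuous_segment (g : R -> R) (a b e : R) :
  continuous g -> 0 < e ->
  exists2 dlt : R, 0 < dlt & forall x y, x \in `[a, b] -> `|x - y| < dlt -> `|g x - g y| < e.
Proof.
move=> cg e0; have e2 : 0 < e / 2 by rewrite divr_gt0.
have /compact_near_coveringP/(_ R (0^'+)
  (fun dlt x => forall y, `|x - y| < dlt -> `|g x - g y| < e)) := @segment_compact R a b.
case=> [x _|dlt dlt0 /= H].
  have /cvgrPdist_lt/(_ _ e2)/nbhs_normP[r /= r0 Hr] := cg x.
  have r2 : 0 < r / 2 by rewrite divr_gt0.
  exists (ball x (r / 2), [set dlt | dlt < r / 2]) => /=.
    split; first exact: nbhsx_ballx.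
    by apply: nbhs_right_lt.
  move=> [x' dlt] /= [xx' dr] y x'y.
  have h1 : `|g x - g x'| < e / 2.
    by apply: Hr; rewrite /= (lt_trans xx')// ltr_pdivrMr// ltr_pMr// ltr1n.
  have h2 : `|g x - g y| < e / 2.
    apply: Hr; rewrite /= [ltRHS]splitr -(subrKA x') (le_lt_trans (ler_normD _ _))//.
    by rewrite ltrD// (lt_trans x'y).
  rewrite -(subrKA (g x)) (le_lt_trans (ler_normD _ _))// [ltRHS]splitr.
  by rewrite ltrD// distrC.
have d2 : 0 < dlt / 2 by rewrite divr_gt0.
exists (dlt / 2) => // x y xab xy; apply: (H (dlt / 2)) => //=.
  by rewrite /ball/= sub0r normrN gtr0_norm// ltr_pdivrMr// ltr_pMr// ltr1n.
Qed.

(** The principal branch, on the plane cut along the negative half-axis. *)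
Definition csqrt (w : R[i]) : R[i] :=
  ((Num.sqrt (2 * (normc w + complex.Re w)))^-1)%:C * ((normc w)%:C + w).

Lemma csqrt_sqr (u : R[i]) : 0 < complex.Re u -> csqrt (u ^+ 2) = u.
Proof.
case: u => a b /= a0; rewrite /csqrt expr2 /=.
rewrite (_ : (a * a - b * b) ^+ 2 + (a * b + b * a) ^+ 2 = (a ^+ 2 + b ^+ 2) ^+ 2); last by ring.
rewrite sqrtr_sqr ger0_norm ?addr_ge0 ?sqr_ge0//.
rewrite (_ : 2 * _ = (2 * a) ^+ 2); last by ring.
rewrite sqrtr_sqr gtr0_norm ?mulr_gt0//.
have a1 : a != 0 by rewrite gt_eqF.
by apply/eqP; rewrite eq_complex /=; apply/andP; split; apply/eqP; field.
Qed.

(** Multiplying by the conjugate of [u ^+ 2] instead of dividing by [u ^+ 2]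
    changes the argument of the root only by a positive factor, and only the
    inverse of a real number has to be measurable. *)
Lemma csqrt_ratio (u v : R[i]) : 0 < complex.Re (v * u^*%C) ->
  csqrt (v ^+ 2 * (u ^+ 2)^*%C) * ((normc (u ^+ 2))^-1)%:C * u = v.
Proof.
move=> h; rewrite (_ : v ^+ 2 * _ = (v * u^*%C) ^+ 2); last first.
  case: u v {h} => [a b] [a' b']; rewrite !expr2.
  by apply/eqP; rewrite eq_complex /=; apply/andP; split; apply/eqP; ring.
rewrite csqrt_sqr//; case: u v h => [a b] [a' b'] /= h.
have q0 : a ^+ 2 + b ^+ 2 != 0.
  apply/eqP => q0; have a2 := sqr_ge0 a; have b2 := sqr_ge0 b.
  have /eqP : a ^+ 2 = 0 by lra.
  have /eqP : b ^+ 2 = 0 by lra.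
  rewrite !sqrf_eq0 => /eqP bE /eqP aE.
  by move: h; rewrite aE bE oppr0 !mulr0 subrr ltxx.
rewrite (_ : (_ * _ - _ * _) ^+ 2 + _ = (a ^+ 2 + b ^+ 2) ^+ 2); last by ring.
rewrite sqrtr_sqr ger0_norm ?addr_ge0 ?sqr_ge0//.
by apply/eqP; rewrite eq_complex /=; apply/andP; split; apply/eqP; field.
Qed.

Lemma measurable_inv_ge0 d (T : measurableType d) (f : T -> R) :
  measurable_fun setT f -> (forall x, 0 <= f x) -> measurable_fun setT (fun x => (f x)^-1).
Proof.
move=> mf f0; rewrite (_ : (fun x => _) = (@powR R ^~ (-1)) \o f).
  by apply: measurableT_comp => //; exact: measurable_powR.
by apply/funext => x /=; rewrite powR_inv1.
Qed.

Lemma measurable_normc d (T : measurableType d) (f : T -> R[i]) :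
  Cmeasurable f -> measurable_fun setT (fun x => normc (f x)).
Proof.
move=> [f1 f2]; rewrite (_ : (fun x => _) =
  @Num.sqrt R \o (fun x => complex.Re (f x) ^+ 2 + complex.Im (f x) ^+ 2)).
  apply: measurableT_comp; first exact: (continuous_measurable_fun (@sqrt_continuous R)).
  by apply: measurable_funD; exact: measurable_funX.
by apply/funext => x /=; case: (f x).
Qed.

Lemma Cmeasurable_csqrt d (T : measurableType d) (f : T -> R[i]) :
  Cmeasurable f -> Cmeasurable (fun x => csqrt (f x)).
Proof.
move=> mf; have mn := measurable_normc mf.
apply: CmeasurableM; last by apply: CmeasurableD => //; exact: Cmeasurable_real.
apply: Cmeasurable_real; apply: measurable_inv_ge0; last by move=> x; exact: sqrtr_ge0.
apply: measurableT_comp; first exact: (continuous_measurable_fun (@sqrt_continuous R)).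
apply: measurable_funM; first exact: measurable_cst.
by apply: measurable_funD => //; exact: mf.1.
Qed.

Lemma continuous_Re_Im (f : R -> R[i]^o) : continuous f ->
  continuous (fun s => complex.Re (f s)) /\ continuous (fun s => complex.Im (f s)).
Proof.
move=> cf; suff H (p : R[i] -> R) : (forall a b, p a - p b = p (a - b)) ->
    (forall a, `|p a| <= normc a) -> continuous (fun s => p (f s)).
  split; [apply: (H (@complex.Re R))|apply: (H (@complex.Im R))].
  - by move=> [? ?] [? ?].
  - exact: Re_le_normc.
  - by move=> [? ?] [? ?].
  - exact: Im_le_normc.
move=> pB pn s; apply/cvgrPdist_lt => e e0.
have e0' : 0 < e%:C :> R[i] by rewrite ltcR.
have /cvgrPdist_lt/(_ _ e0') := cf s.
apply: filterS => y; rewrite pB => h; apply: le_lt_trans (pn _) _.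
by rewrite -ltcR.
Qed.

(** Along a continuous nonvanishing curve [r], the ratio of the values at
    consecutive points of a fine partition has positive real part, so it is the
    principal root of the ratio of the squares. Hence [r] at the endpoint is a
    finite product of principal roots of expressions in [f = r ^+ 2], and these
    depend measurably on [z]. *)
Lemma Cmeasurable_continuous_root d (T : measurableType d) (r f : R -> T -> R[i])
    (c : R[i]) (t : R) : 0 <= t ->
  (forall s z, r s z ^+ 2 = f s z) -> (forall s z, f s z != 0) ->
  (forall z, continuous (fun s => r s z : R[i]^o)) -> (forall z, r 0 z = c) ->
  (forall s, 0 <= s -> Cmeasurable (f s)) -> Cmeasurable (r t).
Proof.
move=> t0 rf f0 cr r0 mf.
pose node N k : R := t * (k%:R / N.+1%:R).
have node0 N k : 0 <= node N k by rewrite mulr_ge0// divr_ge0.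
pose ratio N k z := csqrt (f (node N k.+1) z * (f (node N k) z)^*%C) *
  ((normc (f (node N k) z))^-1)%:C.
pose approx N z := c * \prod_(k < N.+1) ratio N k z.
have mapprox N : Cmeasurable (approx N).
  apply: CmeasurableM; first exact: Cmeasurable_cst.
  apply: Cmeasurable_prod => k; apply: CmeasurableM.
    by apply: Cmeasurable_csqrt; apply: CmeasurableM; [exact: mf|apply: Cmeasurable_conj; exact: mf].
  apply: Cmeasurable_real; apply: measurable_inv_ge0 => [|x]; last exact: normc_ge0.
  by apply: measurable_normc; exact: mf.
suff H z : \forall N \near \oo, approx N z = r t z.
  split.
    apply: (@measurable_fun_cvg _ _ _ setT (fun N z => complex.Re (approx N z))).
      by move=> N; exact: (mapprox N).1.
    by move=> z _; apply: cvg_near_cst; apply: filterS (H z) => N ->.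
  apply: (@measurable_fun_cvg _ _ _ setT (fun N z => complex.Im (approx N z))).
    by move=> N; exact: (mapprox N).2.
  by move=> z _; apply: cvg_near_cst; apply: filterS (H z) => N ->.
have [c1 c2] := continuous_Re_Im (cr z).
pose q s := complex.Re (r s z) ^+ 2 + complex.Im (r s z) ^+ 2.
have cq : continuous q.
  by move=> s; apply: cvgD; apply: (continuous_comp _ (@exprn_continuous _ 2 _)); [exact: c1|exact: c2].
have [s0 _ qmin] := EVT_min t0 (continuous_subspaceT cq).
have m0 : 0 < q s0.
  have /negP : r s0 z != 0 by apply: contraNneq (f0 s0 z) => E; rewrite -rf E expr0n.
  rewrite lt_neqAle addr_ge0 ?sqr_ge0// andbT => rn0; apply/negP; move/eqP/esym => E; apply: rn0.
  move: E; rewrite /q; case: (r s0 z) => a b /= E.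
  have := sqr_ge0 a; have := sqr_ge0 b => b2 a2.
  have : a ^+ 2 = 0 by lra.
  have : b ^+ 2 = 0 by lra.
  by move=> /eqP; rewrite sqrf_eq0 => /eqP -> /eqP; rewrite sqrf_eq0 => /eqP ->.
(* With both coordinates of the increment below [e], the real part of the
   ratio is positive: twice [Re (u v^* )] is [|u|^2 + |v|^2 - |u - v|^2], and
   [2 * e ^+ 2 <= 2 * q s0]. *)
pose e := Num.min 1 (q s0); have e0 : 0 < e by rewrite lt_min ltr01.
have [d1 d10 H1] := @uniformly_continuous_segment _ 0 t _ c1 e0.
have [d2 d20 H2] := @uniformly_continuous_segment _ 0 t _ c2 e0.
near=> N.
have step k : (k <= N)%N -> `|node N k - node N k.+1| < Num.min d1 d2.
  move=> kN; rewrite /node -mulrBr -mulrBl -natr1 opprD addrA subrr add0r mulN1r mulrN normrN.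
  rewrite ger0_norm ?mulr_ge0// ltr_pdivrMr// mulrC -ltr_pdivrMr ?lt_min ?d10//.
  apply: (lt_trans (truncnS_gt _)); rewrite ltr_nat ltnS.
  by near: N; exact: nbhs_infty_gt.
have inseg k : (k <= N.+1)%N -> node N k \in `[0, t].
  move=> kN; rewrite in_itv/= node0 /node ler_piMr// ler_pdivrMr// mul1r ler_nat//.
have root k : (k <= N)%N -> ratio N k z * r (node N k) z = r (node N k.+1) z.
  move=> kN; have := step k kN; rewrite lt_min => /andP[].
  have kN' := leqW kN.
  move=> /(H1 _ _ (inseg _ kN')) h1 /(H2 _ _ (inseg _ kN')) h2.
  have := qmin _ (inseg _ kN'); have := qmin _ (inseg k.+1 kN).
  have e2 : e ^+ 2 <= q s0.
    have : e <= 1 by rewrite ge_min lexx.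
    have : e <= q s0 by rewrite ge_min lexx orbT.
    nra.
  rewrite /ratio -!rf => q1 q2; apply: csqrt_ratio.
  move: h1 h2 q1 q2 e2; rewrite /q; case: (r (node N k) z) => a b.
  case: (r (node N k.+1) z) => a' b' /=; rewrite !ltr_norml => /andP[h1 h2] /andP[h3 h4] q1 q2 e2.
  have : (a - a') ^+ 2 < e ^+ 2 by nra.
  have : (b - b') ^+ 2 < e ^+ 2 by nra.
  lra.
have prods k : (k <= N.+1)%N -> c * \prod_(l < k) ratio N l z = r (node N k) z.
  elim: k => [_|k IH kN]; first by rewrite big_ord0 mulr1 /node mul0r mulr0 r0.
  by rewrite big_ord_recr/= mulrA IH ?(ltnW kN)// mulrC root.
by rewrite /approx prods// /node divff ?pnatr_eq0// mulr1.
Unshelve. all: by end_near. Qed.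

End continuous_root.


Section prefactor.
Context {R : realType} {D : nat} (Gamma : 'M[R]_D).
Hypothesis Gamma_sym : Gamma^T = Gamma.
Hypothesis Gamma_pos : forall v : 'cV[R]_D, v != 0 -> 0 < (v^T *m Gamma *m v) ord0 ord0.
Variable V : 'cV[R]_D -> R.
Hypothesis V_sub : subquadratic V.
Local Notation phase := 'cV[R]_(D + D).
Local Notation normc := (@Normc.normc R).
Variable flow : R -> phase -> phase.
Hypothesis flowP : is_flow V flow.
Variable M : R -> phase -> 'M[R]_(D + D).
Hypothesis MP : is_stability V flow M.
Variable r : R -> phase -> R[i].
Hypothesis rP : is_HK_root Gamma M r.

Lemma HK_entry (A : 'M[R]_(D + D)) i j :
  HK_matrix Gamma A i j = (HK_re Gamma A i j)%:C + 'i%C * (HK_im Gamma A i j)%:C.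
Proof. by rewrite HK_matrixE !mxE. Qed.

Lemma measurable_mulmx d (T : measurableType d) m n p (A : T -> 'M[R]_(m, n))
    (B : T -> 'M[R]_(n, p)) :
  (forall i j, measurable_fun setT (fun z => A z i j)) ->
  (forall i j, measurable_fun setT (fun z => B z i j)) ->
  forall i j, measurable_fun setT (fun z => (A z *m B z) i j).
Proof.
move=> mA mB i j; under eq_fun do rewrite mxE.
by apply: measurable_sum => k; exact: measurable_funM.
Qed.

Lemma Cmeasurable_HK_root t : 0 <= t -> Cmeasurable (r t).
Proof.
move=> t0; pose c := ((2 `^ (- (D%:R / 2)))%:C : R[i])^-1.
apply: (@Cmeasurable_continuous_root _ _ _ r (fun s z => \det (HK_matrix Gamma (M s z))) c t t0).
- by move=> s z; have [] := rP z.
- move=> s z; apply: (HK_det_neq0 Gamma_sym Gamma_pos).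
  exact: (stability_symplectic _ _ V_sub MP).
- by move=> z; have [] := rP z.
- move=> z; have [_ _] := rP z; rewrite /HK_prefactor => h.
  have c0 : ((2 `^ (- (D%:R / 2)))%:C : R[i]) != 0.
    by apply/eqP => c0; move: h; rewrite c0 mul0r => /esym/eqP; rewrite oner_eq0.
  by apply: (mulfI c0); rewrite h divff.
move=> s s0; apply: Cmeasurable_det => i j.
have mM k l : measurable_fun setT (fun z => M s z k l) by exact: (measurable_stability V_sub flowP).
have cst (m n : nat) (B : 'M[R]_(m, n)) k l : measurable_fun setT (fun _ : phase => B k l).
  exact: measurable_cst.
under eq_fun do rewrite HK_entry.
apply: CmeasurableD; [|apply: CmeasurableM; first exact: Cmeasurable_cst];
  apply: Cmeasurable_real.
  under eq_fun do rewrite mxE; apply: measurable_funD.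
    by under eq_fun do rewrite !mxE; exact: mM.
  apply: measurable_mulmx => // ? ?; apply: measurable_mulmx => // ? ?.
  by under eq_fun do rewrite !mxE; exact: mM.
under eq_fun do rewrite mxE [X in _ + X]mxE; apply: measurable_funB.
  by apply: measurable_mulmx => // ? ?; under eq_fun do rewrite !mxE; exact: mM.
by apply: measurable_mulmx => // ? ?; under eq_fun do rewrite !mxE; exact: mM.
Qed.

Lemma mulmx_norm m n p (A : 'M[R]_(m, n)) (B : 'M[R]_(n, p)) :
  `|A *m B| <= n%:R * `|A| * `|B|.
Proof.
apply: mx_norm_le => [|i j]; first by rewrite !mulr_ge0.
rewrite mxE (le_trans (ler_norm_sum _ _ _))//.
apply: (@le_trans _ _ (\sum_(k < n) `|A| * `|B|)).
  by apply: ler_sum => k _; rewrite normrM ler_pM ?le_mx_norm.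
by rewrite sumr_const card_ord -[leLHS]mulr_natl mulrA.
Qed.

Lemma HK_matrix_bound (L : R) : 0 <= L -> exists2 B : R, 0 <= B &
  forall A : 'M[R]_(D + D), (forall i j, `|A i j| <= L) ->
  forall i j, normc (HK_matrix Gamma A i j) <= B.
Proof.
move=> L0; set a := `|invmx Gamma|; set b := `|Gamma|.
exists ((L + D%:R * (D%:R * a * L) * b) + (D%:R * a * L + D%:R * L * b)).
  by rewrite !addr_ge0// !mulr_ge0// ?normr_ge0.
move=> A HA i j.
have AL (B : 'M[R]_D) : (forall i j, exists k l, B i j = A k l) -> `|B| <= L.
  by move=> HB; apply: mx_norm_le => // k l; have [u [v ->]] := HB k l; exact: HA.
have h1 : `|ulsubmx A| <= L by apply: AL => k l; rewrite !mxE; do 2 eexists.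
have h2 : `|ursubmx A| <= L by apply: AL => k l; rewrite !mxE; do 2 eexists.
have h3 : `|dlsubmx A| <= L by apply: AL => k l; rewrite !mxE; do 2 eexists.
have h4 : `|drsubmx A| <= L by apply: AL => k l; rewrite !mxE; do 2 eexists.
rewrite HK_entry; apply: le_trans (normc_le _) _.
rewrite (_ : complex.Re _ = HK_re Gamma A i j); last first.
  by rewrite /= !(mul0r, mul1r, mulr0, subr0, addr0, oppr0).
rewrite (_ : complex.Im _ = HK_im Gamma A i j); last first.
  by rewrite /= !(mul0r, mul1r, mulr0, subr0, addr0, add0r).
have aL (B : 'M[R]_D) : `|B| <= L -> `|invmx Gamma *m B| <= D%:R * a * L.
  by move=> BL; rewrite (le_trans (mulmx_norm _ _))// ler_wpM2l ?mulr_ge0 ?normr_ge0.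
have Lb (B : 'M[R]_D) K : `|B| <= K -> `|B *m Gamma| <= D%:R * K * b.
  move=> BK; rewrite (le_trans (mulmx_norm _ _))// ler_wpM2r ?normr_ge0//.
  by rewrite ler_wpM2l.
apply: lerD; apply: le_trans (le_mx_norm _ _ _) _.
  by apply: le_trans (ler_normD _ _) _; rewrite lerD// Lb// aL.
by apply: le_trans (ler_normB _ _) _; rewrite lerD ?Lb ?aL.
Qed.

Lemma det_bound n (A : 'M[R[i]]_n) (B : R) : (forall i j, normc (A i j) <= B) ->
  normc (\det A) <= #|{perm 'I_n}|%:R * B ^+ n.
Proof.
move=> AB; rewrite -lecR -[X in X <= _]/(`|\det A|).
apply: le_trans (ler_norm_sum _ _ _) _.
rewrite rmorphM rmorph_nat rmorphXn/= mulr_natl -sumr_const; apply: ler_sum => s _.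
rewrite normrM normrX normrN1 expr1n mul1r normr_prod.
rewrite -[X in _ ^+ X](card_ord n) -prodr_const; apply: ler_prod => i _.
by rewrite normr_ge0 -[X in X <= _]/((normc (A i (s i)))%:C) lecR AB.
Qed.

(** The square of the modulus is the modulus of a determinant with bounded
    entries. *)
Lemma HK_root_bound t : 0 <= t -> exists2 C : R, 0 <= C & forall z, normc (r t z) <= C.
Proof.
move=> t0; have [L L0 HL] := stability_bound V_sub flowP MP t0.
have [B B0 HB] := HK_matrix_bound L0.
set C := #|{perm 'I_D}|%:R * B ^+ D.
have C0 : 0 <= C by rewrite mulr_ge0// exprn_ge0.
exists (1 + C) => [|z]; first exact: addr_ge0.
have : normc (r t z) ^+ 2 <= C.
  rewrite expr2 -Normc.normcM -expr2; have [-> _ _] := rP z.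
  by apply: det_bound => i j; apply: HB => k l; exact: HL.
by have := normc_ge0 (r t z); nra.
Qed.

End prefactor.


(** * The strong law of large numbers *)

Section sparse_times.
Context {R : realType}.
Variable a : nat.

(** A geometric progression of ratio [1 + 1 / a.+1], rounded down so that the
    times are integers; starting at [a.+1] makes every increment positive. *)
Fixpoint sparse (n : nat) : nat :=
  if n is m.+1 then (sparse m + sparse m %/ a.+1)%N else a.+1.

Lemma sparse_ge n : (a < sparse n)%N.
Proof. by elim: n => //= n /leq_trans; apply; exact: leq_addr. Qed.

Lemma sparse_lt n : (sparse n < sparse n.+1)%N.
Proof. by rewrite /= -[X in (X < _)%N]addn0 ltn_add2l divn_gt0// sparse_ge. Qed.

Lemma sparse_gt n : (n < sparse n)%N.
Proof. by elim: n => // n IH; exact: leq_ltn_trans IH (sparse_lt n). Qed.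

Lemma sparse_gt0 n : 0 < (sparse n)%:R :> R.
Proof. by rewrite ltr0n (leq_ltn_trans _ (sparse_gt n)). Qed.

Lemma sparse_le n : (sparse n.+1)%:R <= (1 + a.+1%:R^-1) * (sparse n)%:R :> R.
Proof.
rewrite /= natrD mulrDl mul1r lerD2l mulrC ler_pdivlMr ?ltr0n//.
by rewrite -natrM ler_nat leq_trunc_div.
Qed.

Local Arguments sparse : simpl never.

(** Bounds [sparse n.+1] by its increment, rounding included. *)
Definition sparse_cst : R := (a.+1.*2.+1)%:R.

Lemma sparse_growth n :
  (sparse n.+1)%:R <= sparse_cst * ((sparse n.+1)%:R - (sparse n)%:R) :> R.
Proof.
have H : (sparse n <= (sparse n %/ a.+1) * a.+1.*2)%N.
  have h1 : (0 < sparse n %/ a.+1)%N by rewrite divn_gt0// sparse_ge.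
  have h2 := ltn_pmod (sparse n) (ltn0Sn a).
  rewrite {1}(divn_eq (sparse n) a.+1) -addnn mulnDr leq_add2l.
  by rewrite (leq_trans (ltnW h2))// leq_pmull.
rewrite /sparse_cst [sparse n.+1]/= natrD addrAC subrr add0r -natrM -natrD ler_nat mulSn.
by rewrite addnC leq_add2l mulnC.
Qed.

Lemma sparse_cst_ge1 : 1 <= sparse_cst.
Proof. by rewrite /sparse_cst ler1n. Qed.

(** Both sums are dominated by their extremal term because [sparse] grows
    geometrically; comparing with the telescoping sums of [min (sparse n) x]
    and of its inverse avoids computing geometric series. *)
Lemma sum_sparse_below (x : R) N : 0 <= x ->
  \sum_(n < N) (if (sparse n)%:R < x then (sparse n)%:R else 0) <= sparse_cst * x.
Proof.
move=> x0; have c1 := sparse_cst_ge1; have c0 := le_trans ler01 c1.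
suff H : \sum_(n < N.+1) (if (sparse n)%:R < x then (sparse n)%:R else 0) <=
    sparse_cst * Num.min (sparse N)%:R x.
  apply: le_trans (le_trans H _).
    rewrite big_ord_recr/= lerDl; case: ifP => // _; exact: ltW (sparse_gt0 _).
  by rewrite ler_wpM2l ?(le_trans ler01)// ge_min lexx orbT.
elim: N => [|N IH].
  rewrite big_ord_recl big_ord0 addr0.
  have s0 := sparse_gt0 0.
  by case: ltP => h; [nra|rewrite mulr_ge0// (le_trans ler01)].
rewrite big_ord_recr /=; have g := sparse_growth N.
have s0 := sparse_gt0 N.
have s1 : (sparse N)%:R < (sparse N.+1)%:R :> R by rewrite ltr_nat sparse_lt.
case: ifPn => [h|]; last rewrite -leNgt => h.
  rewrite min_l ?(ltW h)//.
  by rewrite (min_l (ltW (lt_trans s1 h))) in IH; lra.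
rewrite addr0 (le_trans IH)// ler_wpM2l ?(le_trans ler01)//.
by rewrite le_min !ge_min (ltW s1) lexx orbT.
Qed.

Lemma sum_sparse_above (x : R) N : 0 <= x ->
  \sum_(n < N) (if x <= (sparse n)%:R then x ^+ 2 / (sparse n)%:R else 0) <=
  sparse_cst * x.
Proof.
move=> x0; have c1 := sparse_cst_ge1; have c0 := le_trans ler01 c1.
have [->|xN0] := eqVneq x 0.
  by rewrite big1 ?mulr0// => i _; rewrite expr0n/= mul0r; case: ifP.
have xp : 0 < x by rewrite lt_neqAle eq_sym xN0.
pose psi n : R := (Num.max (sparse n)%:R x)^-1.
have psi0 n : 0 < psi n by rewrite invr_gt0 lt_max xp orbT.
suff H : \sum_(n < N) (if x <= (sparse n)%:R then x ^+ 2 / (sparse n)%:R else 0) +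
    sparse_cst * x ^+ 2 * psi N <= sparse_cst * x ^+ 2 * psi 0%N.
  have : psi 0%N <= x^-1.
    by rewrite lef_pV2 ?posrE ?lt_max ?xp ?orbT// le_max lexx orbT.
  rewrite -(ler_pM2l (_ : 0 < sparse_cst * x ^+ 2)); last first.
    by rewrite mulr_gt0 ?exprn_gt0// (lt_le_trans ltr01).
  rewrite expr2 -[X in _ <= X]mulrA mulfK// => /(le_trans H); apply: le_trans.
  by rewrite lerDl mulr_ge0 ?(ltW (psi0 _))// mulr_ge0// exprn_ge0.
elim: N => [|N IH]; first by rewrite big_ord0 add0r.
rewrite big_ord_recr /=; apply: le_trans IH; rewrite -addrA lerD2l.
have s1 : (sparse N)%:R < (sparse N.+1)%:R :> R by rewrite ltr_nat sparse_lt.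
case: ifPn => [h|]; last first.
  rewrite -ltNge => h; rewrite add0r ler_wpM2l// ?mulr_ge0 ?exprn_ge0//.
  rewrite lef_pV2 ?posrE ?lt_max ?xp ?orbT// ge_max !le_max (ltW s1) lexx/=.
  by rewrite orbT.
rewrite /psi (max_l h) (max_l (le_trans h (ltW s1))).
have g := sparse_growth N; have s0 := sparse_gt0 N; have s2 := sparse_gt0 N.+1.
set u := (sparse N)%:R in g s0 s1 h *; set v := (sparse N.+1)%:R in g s1 s2 *.
have -> : x ^+ 2 / u + sparse_cst * x ^+ 2 / v =
    x ^+ 2 * ((v + sparse_cst * u) / (u * v)) by field; rewrite !gt_eqF.
rewrite [leRHS](_ : _ = x ^+ 2 * (sparse_cst * v / (u * v))); last by field; rewrite !gt_eqF.
have uv : 0 <= (u * v)^-1 by rewrite invr_ge0 mulr_ge0// ltW.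
by rewrite ler_wpM2l ?exprn_ge0// ler_wpM2r//; lra.
Qed.

Lemma sparse_between m : (sparse 0 <= m)%N ->
  exists n, (sparse n <= m < sparse n.+1)%N.
Proof.
move=> m0; have ex : exists n, (m < sparse n)%N by exists m; exact: sparse_gt.
case: (ex_minnP ex) => -[|n] mn minn; first by rewrite ltnNge m0 in mn.
exists n; rewrite mn andbT leqNgt; apply/negP => /minn.
by rewrite ltnn.
Qed.

Lemma le_sparse n m : (n <= m)%N -> (sparse n <= sparse m)%N.
Proof.
by move/subnK <-; elim: (m - n)%N => // k IH; rewrite (leq_trans IH)// addSn ltnW// sparse_lt.
Qed.

End sparse_times.

(** A nondecreasing sequence is sandwiched between its values at consecutive
    sparse times, at the price of the factor [1 + 1 / a.+1]. *)
Lemma cvg_sparse_average (R : realType) (s : nat -> R) (mu : R) :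
  0 <= mu -> (forall n, 0 <= s n) -> {homo s : m n / (m <= n)%N >-> m <= n} ->
  (forall a, s (sparse a n) / (sparse a n)%:R @[n --> \oo] --> mu) ->
  s n / n%:R @[n --> \oo] --> mu.
Proof.
move=> mu0 s0 ns cs; apply/cvgrPdist_le => e e0.
pose a := Num.trunc (4 * (mu + e) / e).
have ae : mu + e <= a.+1%:R * (e / 4).
  rewrite -ler_pdivrMr ?divr_gt0// ltW//.
  rewrite (_ : _ / _ = 4 * (mu + e) / e) ?truncnS_gt//.
  by field; rewrite gt_eqF.
have a0 : 0 < a.+1%:R :> R by rewrite ltr0n.
have e4 : 0 < e / 4 by rewrite divr_gt0.
have /cvgrPdist_le/(_ _ e4)[K _ HK] := cs a.
near=> m.
have mK : (sparse a K <= m)%N by near: m; exact: nbhs_infty_ge.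
have [n /andP[nm mn]] := sparse_between (leq_trans (le_sparse _ (leq0n K)) mK).
have Kn : (K <= n)%N.
  rewrite leqNgt; apply/negP => nK; have := leq_trans mn (le_sparse a nK).
  by rewrite ltnNge mK.
have h1 := HK n Kn; have h2 := HK n.+1 (leqW Kn).
have k0 := @sparse_gt0 R a n; have k1 := @sparse_gt0 R a n.+1.
have kl := @sparse_le R a n.
have m0 : 0 < m%:R :> R by apply: lt_le_trans k0 _; rewrite ler_nat.
have sm1 := ns _ _ nm; have sm2 := ns _ _ (ltnW mn).
have nmR : (sparse a n)%:R <= m%:R :> R by rewrite ler_nat.
have mnR : m%:R <= (sparse a n.+1)%:R :> R by rewrite ler_nat ltnW.
move: h1 h2; rewrite !ler_distlC => /andP[h1 _] /andP[_ h2].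
rewrite ler_pdivlMr// in h1; rewrite ler_pdivrMr// in h2.
set A := a.+1%:R in ae a0 kl.
set k := (sparse a n)%:R in k0 kl nmR h1 *; set k' := (sparse a n.+1)%:R in k1 kl mnR h2 *.
have kk : A * k' <= (A + 1) * k.
  rewrite (_ : (A + 1) * k = A * ((1 + A^-1) * k)) ?ler_pM2l//.
  by field; rewrite gt_eqF.
have e0' := ltW e0.
rewrite ler_pdivlMr// ler_pdivrMr//; apply/andP; split.
  have [me|me] := leP (mu - e) 0.
    by apply: le_trans (s0 m); rewrite mulr_le0_ge0// ltW.
  apply: le_trans sm1; apply: le_trans h1.
  rewrite -(ler_pM2l (_ : 0 < A + 1)) ?addr_gt0// mulrCA [leRHS]mulrCA.
  apply: (@le_trans _ _ ((mu - e / 4) * (A * k'))); last first.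
    by rewrite ler_pM2l//; lra.
  apply: (@le_trans _ _ ((mu - e) * ((A + 1) * k'))).
    by rewrite !ler_pM2l// addr_gt0.
  rewrite !mulrA ler_pM2r//; nra.
apply: le_trans sm2 _; apply: le_trans h2 _.
rewrite -(ler_pM2l a0) mulrCA.
apply: (@le_trans _ _ ((mu + e / 4) * ((A + 1) * k))).
  by rewrite ler_pM2l//; lra.
apply: (@le_trans _ _ (A * ((mu + e) * k))).
  rewrite [leLHS]mulrA [leRHS]mulrA ler_pM2r//; nra.
by rewrite ler_pM2l// ler_pM2l//; lra.
Unshelve. all: by end_near. Qed.

Section summable_expectations.
Context d (T : measurableType d) (R : realType) (P : {measure set T -> \bar R}).

(** The sum of the expectations is the expectation of the sum, which is
    therefore almost everywhere finite. *)
Lemma ae_cvg0 (f : nat -> T -> R) :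
  (forall n, measurable_fun setT (f n)) -> (forall n x, 0 <= f n x) ->
  (\sum_(n <oo) \int[P]_x (f n x)%:E < +oo)%E ->
  {ae P, forall x, f n x @[n --> \oo] --> 0}.
Proof.
move=> mf f0 sf.
have mF n : measurable_fun setT (EFin \o f n) by exact/measurable_EFinP.
have F0 n x : setT x -> (0 <= (EFin \o f n) x)%E by move=> _; rewrite lee_fin.
have iF : P.-integrable setT (fun x => \sum_(n <oo) (f n x)%:E)%E.
  apply/integrableP; split.
    by apply: ge0_emeasurable_sum => n *; [rewrite lee_fin|exact: mF].
  have N0 x : (0 <= \sum_(n <oo) (f n x)%:E)%E.
    by apply: nneseries_ge0 => n _ _; rewrite lee_fin.
  under eq_integral do rewrite gee0_abs ?N0//.
  by rewrite (integral_nneseries P measurableT mF F0).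
apply: filterS (integrable_ae measurableT iF) => x /(_ I) fx.
apply: cvg_series_cvg_0; apply: nondecreasing_is_cvgn.
  by apply: nondecreasing_series => n _ _; exact: f0.
exists (fine (\sum_(n <oo) (f n x)%:E)%E) => _ [n _ <-].
rewrite -lee_fin fineK// /series/= -sumEFin.
by apply: nneseries_lim_ge => k _; rewrite lee_fin.
Qed.

End summable_expectations.

Section etemadi.
Context d (T : measurableType d) (R : realType) (P : probability T R).
Variable X : nat -> {RV P >-> R}.
Hypothesis X0 : forall k w, 0 <= X k w.
Hypothesis X_id : forall k B, measurable B ->
  P (X k @^-1` B) = P (X 0%N @^-1` B).
Hypothesis X_indep : forall i j B C, i != j -> measurable B -> measurable C ->
  P (X i @^-1` B `&` X j @^-1` C) = (P (X i @^-1` B) * P (X j @^-1` C))%E.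
Hypothesis X_int : P.-integrable setT (EFin \o X 0%N).

Let law := distribution P (X 0%N).

Lemma ge0_integral_law (h : R -> \bar R) k : measurable_fun setT h ->
  (forall x, 0 <= h x)%E ->
  (\int[P]_w h (X k w) = \int[law]_x h x)%E.
Proof.
move=> mh h0; rewrite -[LHS](ge0_integral_distribution _ mh h0).
by apply: eq_measure_integral => A mA _; exact: X_id.
Qed.

Lemma integral_law (h : R -> R) k : measurable_fun setT h ->
  \int[P]_w h (X k w) = \int[law]_x h x.
Proof.
move=> mh; have mh' : measurable_fun setT (EFin \o h) by exact/measurable_EFinP.
rewrite /Rintegral integralE [in RHS]integralE; congr (fine (_ - _)).
  rewrite -(@ge0_integral_law (EFin \o h)^\+%E k)//; last exact: measurable_funepos.
  by apply: eq_integral => w _; rewrite !funeposE.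
rewrite -(@ge0_integral_law (EFin \o h)^\-%E k)//; last exact: measurable_funeneg.
by apply: eq_integral => w _; rewrite !funenegE.
Qed.

Lemma bounded_integrable d' (U : measurableType d') (Q : probability U R) (h : U -> R) (c : R) :
  measurable_fun setT h -> (forall x, `|h x| <= c) ->
  Q.-integrable setT (EFin \o h).
Proof.
move=> mh hc; apply: (le_integrable measurableT _ _ (finite_measure_integrable_cst Q c measurableT)).
  exact/measurable_EFinP.
by move=> x _; rewrite /= lee_fin (le_trans (hc x))// ler_norm.
Qed.

(** The joint law of two of the variables is the product of their laws. *)
Lemma integral_law2 (h : R -> R) (c : R) i j : i != j -> measurable_fun setT h ->
  (forall x, `|h x| <= c) ->
  \int[P]_w (h (X i w) * h (X j w)) = (\int[law]_x h x) ^+ 2.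
Proof.
move=> ij mh hc.
have mX k : measurable_fun setT (X k) by exact: measurable_funPT.
have mXX : measurable_fun setT (fun w => (X i w, X j w)).
  by apply/measurable_fun_pairP; split.
pose f p := (h p.1 * h p.2)%:E.
have mf : measurable_fun [set: R * R] f.
  apply/measurable_EFinP; apply: measurable_funM.
    exact: measurableT_comp mh measurable_fst.
  exact: measurableT_comp mh measurable_snd.
have hh x y : `|h x * h y| <= c ^+ 2.
  by rewrite normrM expr2 ler_pM.
have ih : law.-integrable setT (EFin \o h) by exact: bounded_integrable hc.
have if_ : (law \x law)%E.-integrable setT f.
  apply/integrableP; split=> //.
  apply: (@le_lt_trans _ _ ((c ^+ 2)%:E * (law \x law) setT)%E).
    apply: integral_le_bound => //; first by rewrite lee_fin sqr_ge0.
    by apply/aeW => p _; rewrite lee_fin hh.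
  have -> : (law \x law)%E setT = 1%E.
    rewrite -setXTT; apply: etrans (product_measure1E _ _ measurableT measurableT) _.
    by rewrite -[RHS]mule1; congr (_ * _)%E; exact: probability_setT.
  rewrite mule1.
  exact: ltry.
have E : (\int[P]_w f (X i w, X j w) = \int[law \x law]_p f p)%E.
  have iXX : P.-integrable setT (f \o (fun w => (X i w, X j w))).
    apply: (@bounded_integrable _ _ P (fun w => h (X i w) * h (X j w)) (c ^+ 2)) => //.
    by apply: measurable_funM; apply: measurableT_comp mh _.
  have := integral_pushforward mXX mf iXX measurableT.
  rewrite preimage_setT => <-.
  apply/esym; apply: eq_measure_integral => A mA _; apply: product_measure_unique => // B C mB mC.
  transitivity (P (X i @^-1` B `&` X j @^-1` C)); first by [].
  by rewrite X_indep// X_id// [X in (_ * X)%E]X_id.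
transitivity (fine (\int[P]_w f (X i w, X j w)))%E; first by [].
rewrite E -integral12_prod_meas1//.
have -> : (fun x => \int[law]_y f (x, y))%E = (fun x => (h x)%:E * (\int[law]_y h y)%:E)%E.
  apply/funext => x; rewrite /f/=; under eq_integral do rewrite EFinM.
  rewrite integralZl//; congr (_ * _)%E; rewrite /Rintegral fineK//.
  exact: integrable_fin_num.
by rewrite integralZr// /Rintegral expr2 fineM//; exact: integrable_fin_num.
Qed.

Definition truncate (c x : R) : R := if 0 <= x <= c then x else 0.

Lemma measurable_truncate c : measurable_fun setT (truncate c).
Proof.
rewrite (_ : truncate c = fun x => x * \1_(`[0, c]%classic : set R) x).
  by apply: measurable_funM => //; exact: measurable_indic.
apply/funext => x; rewrite indicE /truncate mem_setE in_itv/=.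
by case: ifP; rewrite ?mulr1 ?mulr0.
Qed.

Lemma truncate_le c x : 0 <= c -> `|truncate c x| <= c.
Proof.
by move=> c0; rewrite /truncate; case: ifPn => [/andP[x0 xc]|]; rewrite ?normr0// ger0_norm.
Qed.

Lemma cst_integral (r : R) : \int[P]_w r = r.
Proof.
transitivity (r * fine (P setT)); first exact: Rintegral_cst.
by rewrite probability_setT mulr1.
Qed.

Lemma integrable_sumR (I : Type) (s : seq I) (f : I -> T -> R) :
  (forall i, P.-integrable setT (EFin \o f i)) ->
  P.-integrable setT (EFin \o (fun w => \sum_(i <- s) f i w)).
Proof.
move=> fi; rewrite (_ : _ \o _ = (fun w => \sum_(i <- s) (f i w)%:E)%E).
  by apply: (integrable_sum measurableT) => i _; exact: fi.
by apply/funext => w; rewrite /= sumEFin.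
Qed.

Lemma Rintegral_sum (I : Type) (s : seq I) (f : I -> T -> R) :
  (forall i, P.-integrable setT (EFin \o f i)) ->
  \int[P]_w (\sum_(i <- s) f i w) = \sum_(i <- s) \int[P]_w f i w.
Proof.
move=> fi; elim: s => [|i s IH].
  rewrite big_nil; under eq_Rintegral do rewrite big_nil.
  by rewrite cst_integral.
rewrite big_cons -IH; under eq_Rintegral do rewrite big_cons.
by rewrite RintegralD//; exact: integrable_sumR.
Qed.

Let e_ c := \int[P]_w truncate c (X 0%N w).

(** Pairwise independence kills the cross terms of the square. *)
Lemma row_variance (k : nat) : (0 < k)%N ->
  (\int[P]_w (((\sum_(i < k) (truncate k%:R (X i w) - e_ k%:R)) / k%:R) ^+ 2)%:E <=
   \int[P]_w (truncate k%:R (X 0%N w) ^+ 2 / k%:R)%:E)%E.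
Proof.
move=> k0; set c := k%:R.
have c0 : 0 <= c by rewrite /c.
pose h x := truncate c x - e_ c.
have mX i : measurable_fun setT (X i) by exact: measurable_funPT.
have mt : measurable_fun setT (truncate c) by exact: measurable_truncate.
have mh : measurable_fun setT h by apply: measurable_funB => //; exact: measurable_cst.
have tX i : P.-integrable setT (EFin \o (fun w => truncate c (X i w))).
  apply: (@bounded_integrable _ _ P _ c) => [|w]; last exact: truncate_le.
  exact: measurableT_comp mt (mX i).
have hb x : `|h x| <= c + `|e_ c|.
  by rewrite (le_trans (ler_normB _ _))// lerD2r truncate_le.
have ic (a : R) : P.-integrable setT (EFin \o (fun=> a)).
  exact: (finite_measure_integrable_cst P a measurableT).
have Eh : \int[law]_x h x = 0.
  rewrite -(integral_law 0 mh) RintegralB// cst_integral.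
  by rewrite subrr.
have ihh i j : P.-integrable setT (EFin \o (fun w => h (X i w) * h (X j w))).
  apply: (@bounded_integrable _ _ P _ ((c + `|e_ c|) ^+ 2)) => [|w].
    by apply: measurable_funM; [exact: measurableT_comp mh (mX i)|exact: measurableT_comp mh (mX j)].
  by rewrite normrM expr2 ler_pM.
have it2 : P.-integrable setT (EFin \o (fun w => truncate c (X 0%N w) ^+ 2)).
  apply: (@bounded_integrable _ _ P _ (c ^+ 2)) => [|w].
    by apply: measurable_funX; exact: measurableT_comp mt (mX 0%N).
  by rewrite normrX ler_pXn2r ?nnegrE// truncate_le.
have V : \int[P]_w (h (X 0%N w) * h (X 0%N w)) <= \int[P]_w (truncate c (X 0%N w) ^+ 2).
  have -> : (fun w => h (X 0%N w) * h (X 0%N w)) = (fun w => truncate c (X 0%N w) ^+ 2 -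
      (2 * e_ c * truncate c (X 0%N w) - e_ c ^+ 2)).
    by apply/funext => w; rewrite /h; ring.
  rewrite RintegralB//; last first.
    have := integrableB measurableT (integrableZl measurableT (2 * e_ c) (tX 0%N)) (ic (e_ c ^+ 2)).
    by apply: eq_integrable.
  rewrite RintegralB//; last exact: (integrableZl measurableT (2 * e_ c) (tX 0%N)).
  rewrite RintegralZl// cst_integral -/(e_ c).
  rewrite gerBl; have := sqr_ge0 (e_ c); nra.
have S : (fun w => ((\sum_(i < k) (truncate c (X i w) - e_ c)) / c) ^+ 2) =
    (fun w => c ^- 2 * \sum_(i < k) \sum_(j < k) h (X i w) * h (X j w)).
  apply/funext => w; rewrite exprMn exprVn mulrC; congr (_ * _).
  by rewrite expr2 mulr_suml; apply: eq_bigr => i _; rewrite mulr_sumr.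
have isum i : P.-integrable setT (EFin \o (fun w => \sum_(j < k) h (X i w) * h (X j w))).
  by apply: integrable_sumR => j; exact: ihh.
have isum2 : P.-integrable setT (EFin \o (fun w => \sum_(i < k) \sum_(j < k) h (X i w) * h (X j w))).
  by apply: integrable_sumR => i; exact: isum.
have RE (f : T -> R) : P.-integrable setT (EFin \o f) ->
    (\int[P]_w (f w)%:E)%E = (\int[P]_w f w)%:E.
  by move=> fi; rewrite /Rintegral fineK//; exact: (integrable_fin_num measurableT fi).
under eq_integral => w _ do rewrite (congr1 (fun g => g w) S).
rewrite RE; last exact: (integrableZl measurableT (c ^- 2) isum2).
rewrite RE; last first.
  have := integrableZl measurableT (c^-1) it2.
  by apply: eq_integrable => // w _ /=; rewrite mulrC.
rewrite lee_fin RintegralZl// RintegralZr// Rintegral_sum//.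
rewrite (eq_bigr (fun i : 'I_k => \int[P]_w (h (X 0%N w) * h (X 0%N w)))); last first.
  move=> i _; rewrite Rintegral_sum// (bigD1 i)//= big1 ?addr0.
    have mhh : measurable_fun setT (fun x => h x * h x) by exact: measurable_funM.
    by rewrite (integral_law i mhh) (integral_law 0 mhh).
  move=> j ji; rewrite (@integral_law2 _ (c + `|e_ c|))// 1?eq_sym ?Eh ?expr0n//.
rewrite sumr_const card_ord -mulr_natr mulrCA.
have ck : 0 < c by rewrite /c ltr0n.
rewrite -/c (_ : c ^- 2 * c = c^-1); last by field; rewrite gt_eqF.
by rewrite ler_pM2r// invr_gt0.
Qed.

Lemma ge0_integral_id (h : R -> R) k : measurable_fun setT h -> (forall x, 0 <= h x) ->
  (\int[P]_w (h (X k w))%:E = \int[P]_w (h (X 0%N w))%:E)%E.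
Proof.
move=> mh h0; have mh' : measurable_fun setT (EFin \o h) by exact/measurable_EFinP.
have h0' x : (0 <= (EFin \o h) x)%E by rewrite lee_fin.
by rewrite (ge0_integral_law k mh' h0') (ge0_integral_law 0 mh' h0').
Qed.

Lemma integral_series_lty (g : nat -> R -> R) (C : R) : 0 <= C ->
  (forall n, measurable_fun setT (g n)) -> (forall n x, 0 <= g n x) ->
  (forall x N, 0 <= x -> \sum_(n < N) g n x <= C * x) ->
  (\sum_(n <oo) \int[P]_w (g n (X 0%N w))%:E < +oo)%E.
Proof.
move=> C0 mg g0 gC.
have mgX n : measurable_fun setT (fun w => (g n (X 0%N w))%:E).
  by apply/measurable_EFinP; apply: measurableT_comp (mg n) _; exact: measurable_funPT.
have gX0 n w : setT w -> (0 <= (g n (X 0%N w))%:E)%E by move=> _; rewrite lee_fin.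
rewrite -(integral_nneseries P measurableT mgX gX0).
apply: (@le_lt_trans _ _ (\int[P]_w (C%:E * `|(X 0%N w)%:E|))%E).
  apply: ge0_le_integral => //.
  - by move=> w _; apply: nneseries_ge0 => n _ _; rewrite lee_fin.
  - by apply: ge0_emeasurable_sum => n *; [rewrite lee_fin|exact: mgX].
  - apply: measurable_funeM; apply: measurableT_comp => //; apply/measurable_EFinP.
    exact: measurable_funPT.
  - move=> w _; apply: lime_le.
      by apply: is_cvg_nneseries => n _ _; rewrite lee_fin.
    apply: nearW => N; rewrite sumEFin lee_fin big_mkord ger0_norm//.
    exact: gC.
rewrite ge0_integralZl//; last first.
  by apply: measurableT_comp => //; case/integrableP : X_int.
case/integrableP : X_int => _ Xoo.
rewrite lte_mul_pinfty//.
Qed.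

(** All variables of the average at time [k] are truncated at level [k]. The
    variances of these averages and the probabilities that the truncation changes
    anything are both summable along sparse times, by the two estimates on sums
    over sparse times and the integrability of the first variable. *)
Lemma etemadi_sparse a :
  {ae P, forall w, (\sum_(i < sparse a n) X i w) / (sparse a n)%:R @[n --> \oo] -->
                   \int[P]_w X 0%N w}.
Proof.
pose k n := sparse a n.
have k0 n : (0 < k n)%N by rewrite (leq_ltn_trans _ (sparse_gt a n)).
have kR n : 0 < (k n)%:R :> R by rewrite ltr0n.
have mX i : measurable_fun setT (X i) by exact: measurable_funPT.
have mt n := measurable_truncate (k n)%:R.
pose Z n w := (\sum_(i < k n) (truncate (k n)%:R (X i w) - e_ (k n)%:R)) / (k n)%:R.
have mZ n : measurable_fun setT (Z n).
  apply: measurable_funM; last exact: measurable_cst.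
  apply: measurable_sum => i; apply: measurable_funB; last exact: measurable_cst.
  exact: measurableT_comp (mt n) (mX i).
have Z0 : {ae P, forall w, Z n w ^+ 2 @[n --> \oo] --> 0}.
  apply: ae_cvg0 => [n|n w|]; [exact: measurable_funX|exact: sqr_ge0|].
  apply: (@le_lt_trans _ _
      (\sum_(n <oo) \int[P]_w (truncate (k n)%:R (X 0%N w) ^+ 2 / (k n)%:R)%:E)%E).
    apply: lee_nneseries => n _; last exact: row_variance.
    by move=> _; apply: integral_ge0 => w _; rewrite lee_fin sqr_ge0.
  apply: (@integral_series_lty (fun n x => truncate (k n)%:R x ^+ 2 / (k n)%:R) (sparse_cst a)).
  - exact: le_trans ler01 (sparse_cst_ge1 _).
  - by move=> n; apply: measurable_funM; [exact: measurable_funX|exact: measurable_cst].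
  - by move=> n x; rewrite divr_ge0// sqr_ge0.
  - move=> x N x0; apply: le_trans (sum_sparse_above a N x0); apply: ler_sum => n _.
    rewrite /truncate x0 /=; case: ifP => // _.
    by rewrite expr0n/= mul0r.
pose q n (x : R) : R := if (k n)%:R < x then 1 else 0.
have mq n : measurable_fun setT (q n).
  rewrite (_ : q n = \1_(`](k n)%:R, +oo[%classic : set R)); first exact: measurable_indic.
  apply/funext => x; rewrite indicE /q mem_setE in_itv/= andbT.
  by case: ifP.
have q0 n x : 0 <= q n x by rewrite /q; case: ifP.
have Q0 : {ae P, forall w, \sum_(i < k n) q n (X i w) @[n --> \oo] --> (0 : R)}.
  apply: (@ae_cvg0 _ _ _ _ (fun n w => \sum_(i < k n) q n (X i w))) => [n|n w|].
  - by apply: measurable_sum => i; exact: measurableT_comp (mq n) (mX i).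
  - exact: sumr_ge0.
  have E n : (\int[P]_w (\sum_(i < k n) q n (X i w))%:E =
      \int[P]_w ((k n)%:R * q n (X 0%N w))%:E)%E.
    under eq_integral do rewrite -sumEFin.
    have mqX i : measurable_fun setT (fun w => (q n (X i w))%:E).
      by apply/measurable_EFinP; exact: measurableT_comp (mq n) (mX i).
    rewrite ge0_integral_sum//; last by move=> i w _; rewrite lee_fin.
    under eq_bigr do rewrite (ge0_integral_id _ (mq n) (q0 n)).
    under [RHS]eq_integral do rewrite EFinM.
    rewrite ge0_integralZl//; last by move=> w _; rewrite lee_fin.
    by rewrite sumr_const card_ord mule_natl.
  rewrite (eq_eseriesr (fun n _ => E n)).
  apply: (@integral_series_lty (fun n x => (k n)%:R * q n x) (sparse_cst a)).
  - exact: le_trans ler01 (sparse_cst_ge1 _).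
  - by move=> n; apply: measurable_funM.
  - by move=> n x; rewrite mulr_ge0.
  - move=> x N x0; apply: le_trans (sum_sparse_below a N x0); apply: ler_sum => n _.
    by rewrite /q; case: ifP; rewrite ?mulr1 ?mulr0.
have e_cvg : e_ (k n)%:R @[n --> \oo] --> \int[P]_w X 0%N w.
  have : (\int[P]_w (truncate (k n)%:R (X 0%N w))%:E)%E @[n --> \oo] --> (\int[P]_w (X 0%N w)%:E)%E.
    apply: (@dominated_cvg _ _ _ P setT measurableT
      (fun n w => (truncate (k n)%:R (X 0%N w))%:E) (EFin \o X 0%N) (EFin \o X 0%N)) => //.
    - by move=> n; apply/measurable_EFinP; exact: measurableT_comp (mt n) (mX 0%N).
    - move=> w _; apply: cvg_near_cst; near=> n; rewrite /truncate X0/= ifT//.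
      have : (Num.trunc (X 0%N w) <= n)%N by near: n; exact: nbhs_infty_ge.
      move=> h; have h2 := leq_ltn_trans h (sparse_gt a n).
      by rewrite ltW// (lt_le_trans (truncnS_gt _))// ler_nat.
    - move=> n w _; rewrite /= lee_fin /truncate X0/=.
      by case: ifP => _; rewrite ?normr0// ger0_norm.
  have -> : (\int[P]_w (X 0%N w)%:E = (\int[P]_w X 0%N w)%:E)%E.
    by rewrite fineK//; exact: integrable_fin_num.
  by move=> /fine_cvgP[].
apply: filterS2 Z0 Q0 => w Zw Qw.
have Z1 : Z n w @[n --> \oo] --> 0.
  apply/cvgrPdist_le => e e0; have e2 : 0 < e ^+ 2 by rewrite exprn_gt0.
  move/cvgrPdist_le : Zw => /(_ _ e2); apply: filterS => n.
  by rewrite !sub0r !normrN normrX ler_pXn2r// nnegrE// ltW.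
have T1 : Z n w + e_ (k n)%:R @[n --> \oo] --> \int[P]_w X 0%N w.
  by rewrite -[X in _ --> X]add0r; exact: cvgD.
apply: cvg_trans T1; apply: near_eq_cvg.
move/cvgrPdist_lt : Qw => /(_ 1 ltr01) Qw.
near=> n.
have Qn : `|0 - \sum_(i < k n) q n (X i w)| < 1 by near: n.
have Xk (i : 'I_(k n)) : X i w <= (k n)%:R.
  rewrite leNgt; apply/negP => h; move: Qn; rewrite sub0r normrN ger0_norm ?sumr_ge0//.
  by rewrite (bigD1 i)//= {1}/q h gtrDl ltNge sumr_ge0.
rewrite /Z sumrB sumr_const card_ord -[e_ _ *+ _]mulr_natr mulrBl mulfK ?gt_eqF// subrK.
by congr (_ / _); apply: eq_bigr => i _; rewrite /truncate X0 Xk.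
Unshelve. all: by end_near. Qed.

(** Nonnegativity makes the partial sums nondecreasing, so convergence along all
    sparse times suffices. *)
Lemma etemadi_ge0 :
  {ae P, forall w, (\sum_(i < n) X i w) / n%:R @[n --> \oo] --> \int[P]_w X 0%N w}.
Proof.
have := ae_foralln (fun a => etemadi_sparse a); apply: filterS => w Hw.
apply: (@cvg_sparse_average _ (fun n => \sum_(i < n) X i w)) => //.
- by apply: Rintegral_ge0.
- by move=> n; exact: sumr_ge0.
- move=> m n mn; rewrite -(subnKC mn) big_split_ord/= lerDl.
  exact: sumr_ge0.
Qed.

End etemadi.

Section strong_law.
Context d (T : measurableType d) (R : realType) (P : probability T R).
Variable X : nat -> {RV P >-> R}.
Hypothesis X_id : forall k B, measurable B ->
  P (X k @^-1` B) = P (X 0%N @^-1` B).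
Hypothesis X_indep : forall i j B C, i != j -> measurable B -> measurable C ->
  P (X i @^-1` B `&` X j @^-1` C) = (P (X i @^-1` B) * P (X j @^-1` C))%E.
Hypothesis X_int : P.-integrable setT (EFin \o X 0%N).

(** The nonnegative case applies to the positive and negative parts. *)
Lemma strong_law :
  {ae P, forall w, (\sum_(i < n) X i w) / n%:R @[n --> \oo] --> \int[P]_w X 0%N w}.
Proof.
have mX i : measurable_fun setT (X i) by exact: measurable_funPT.
have part (h : R -> R) : measurable_fun setT h -> (forall x, 0 <= h x <= `|x|) ->
    P.-integrable setT (EFin \o (h \o X 0%N)) /\
    {ae P, forall w, (\sum_(i < n) h (X i w)) / n%:R @[n --> \oo] -->
      \int[P]_w h (X 0%N w)}.
  move=> mh h0.
  have mhX k : measurable_fun setT (h \o X k) by exact: measurableT_comp mh (mX k).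
  have ih : P.-integrable setT (EFin \o (h \o X 0%N)).
    apply: le_integrable X_int => //; first exact/measurable_EFinP.
    move=> w _ /=; rewrite lee_fin; have /andP[h1 h2] := h0 (X 0%N w).
    by rewrite ger0_norm.
  split=> //.
  pose Y k : {RV P >-> R} := HB.pack (h \o X k) (isMeasurableFun.Build _ _ _ _ _ (mhX k)).
  have mB B : measurable B -> measurable (h @^-1` B).
    by move=> mB; rewrite -[X in measurable X]setTI; exact: mh.
  apply: (@etemadi_ge0 _ _ _ P Y) => //.
  - by move=> k w; have /andP[] := h0 (X k w).
  - by move=> k B /mB; exact: X_id.
  - by move=> i j B C ij mB' mC'; exact: (X_indep ij (mB _ mB') (mB _ mC')).
have [ip cp] : P.-integrable setT (EFin \o ((fun x => Num.max x 0) \o X 0%N)) /\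
    {ae P, forall w, (\sum_(i < n) Num.max (X i w) 0) / n%:R @[n --> \oo] -->
      \int[P]_w Num.max (X 0%N w) 0}.
  apply: (part (fun x => Num.max x 0)); first by apply: measurable_maxr.
  by move=> x; rewrite le_max lexx orbT ge_max ler_norm normr_ge0.
have [im cm] : P.-integrable setT (EFin \o ((fun x => Num.max (- x) 0) \o X 0%N)) /\
    {ae P, forall w, (\sum_(i < n) Num.max (- X i w) 0) / n%:R @[n --> \oo] -->
      \int[P]_w Num.max (- X 0%N w) 0}.
  apply: (part (fun x => Num.max (- x) 0)); first by apply: measurable_maxr => //; exact: measurable_funN.
  by move=> x; rewrite le_max lexx orbT ge_max -normrN ler_norm normr_ge0.
apply: filterS2 cp cm => w cp cm.
have E x : x = Num.max x 0 - Num.max (- x) 0 :> R.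
  by case: (leP x 0) => h; [rewrite max_l ?oppr_ge0//; lra|rewrite max_r ?oppr_le0 ?ltW//; lra].
have -> : \int[P]_w X 0%N w = \int[P]_w Num.max (X 0%N w) 0 - \int[P]_w Num.max (- X 0%N w) 0.
  by rewrite -RintegralB//; apply: eq_Rintegral => v _; exact: E.
rewrite (_ : (fun n => _) = (fun n => (\sum_(i < n) Num.max (X i w) 0) / n%:R -
  (\sum_(i < n) Num.max (- X i w) 0) / n%:R)); first exact: cvgB.
apply/funext => n; rewrite -mulrBl -sumrB; congr (_ / _).
by apply: eq_bigr => i _; exact: E.
Qed.

End strong_law.


(** * Importance sampling *)

Section complex_convergence.
Context {R : realType}.
Local Notation normc := (@Normc.normc R).

Lemma cvg_complex (u : nat -> R[i]) (l : R[i]) :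
  complex.Re (u n) @[n --> \oo] --> complex.Re l ->
  complex.Im (u n) @[n --> \oo] --> complex.Im l ->
  (u : nat -> R[i]^o) @ \oo --> (l : R[i]^o).
Proof.
move=> c1 c2; apply/(@cvgrPdist_lt _ (R[i]^o)) => -[e ei].
rewrite ltcE/= => /andP[/eqP -> e0].
have e2 : 0 < e / 2 by rewrite divr_gt0.
move/cvgrPdist_lt : c1 => /(_ _ e2); move/cvgrPdist_lt : c2 => /(_ _ e2).
apply: filterS2 => n h2 h1.
rewrite -[X in X < _]/((normc (l - u n))%:C) ltcR.
apply: le_lt_trans (normc_le _) _; rewrite [ltRHS]splitr ltrD//.
  by move: h1 {h2}; case: l => ? ?; case: (u n).
by move: h2 {h1}; case: l => ? ?; case: (u n).
Qed.

End complex_convergence.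

Section importance_sampling.
Context {R : realType} {n : nat} (rho : 'cV[R]_n -> R).
Hypothesis rhoP : prob_density rho.
Context (d : measure_display) (Omega : measurableType d) (P : probability Omega R).
Variable w : nat -> {RV P >-> 'cV[R]_n}.
Hypothesis w_distr : forall k, has_density (w k) rho.
Hypothesis w_indep : mutually_independent w.
Local Notation mu := (lebesgue_cV R n).

Let mrho : measurable_fun setT rho. Proof. by case: rhoP. Qed.
Let rho0 x : 0 <= rho x. Proof. by case: rhoP => _ + _ _; exact. Qed.

(** The density agrees almost everywhere with the Radon-Nikodym derivative of
    the law. *)
Lemma ge0_expectation_density k (h : 'cV[R]_n -> \bar R) :
  measurable_fun setT h -> (forall x, 0 <= h x)%E ->
  (\int[P]_o h (w k o) = \int[mu]_x (h x * (rho x)%:E))%E.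
Proof.
move=> mh h0; rewrite -(ge0_integral_distribution (w k) mh h0).
have mrhoE : measurable_fun setT (EFin \o rho) by exact/measurable_EFinP.
have dom : distribution P (w k) `<< mu.
  apply/null_content_dominatesP => A mA A0; rewrite w_distr//.
  by apply: null_set_integral => //; exact: measurable_funS mrhoE.
rewrite -(Radon_Nikodym_SigmaFinite.change_of_variables dom)//.
have fi := Radon_Nikodym_SigmaFinite.f_integrable dom.
have mf := measurable_int _ fi.
apply: ae_eq_integral => //; [exact: emeasurable_funM|exact: emeasurable_funM|].
have : ae_eq mu setT (Radon_Nikodym_SigmaFinite.f (distribution P (w k)) mu) (EFin \o rho).
  apply: integral_ae_eq => // E _ mE.
  by rewrite -(Radon_Nikodym_SigmaFinite.f_integral dom mE); exact: w_distr.
by apply: filterS => x /= E I; rewrite E.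
Qed.

Lemma expectation_density k (h : 'cV[R]_n -> R) :
  measurable_fun setT h -> mu.-integrable setT (fun x => (h x * rho x)%:E) ->
  P.-integrable setT (EFin \o (h \o w k)) /\
  \int[P]_o h (w k o) = \int[mu]_x (h x * rho x).
Proof.
move=> mh hi.
have mhw : measurable_fun setT (EFin \o (h \o w k)).
  by apply/measurable_EFinP; apply: measurableT_comp.
have mhE : measurable_fun setT (EFin \o h) by exact/measurable_EFinP.
split.
  apply/integrableP; split=> //; have /integrableP[_] := hi.
  rewrite (ge0_expectation_density k (h := fun x => `|(h x)%:E|%E))//; last exact: measurableT_comp.
  rewrite [X in (X < _)%E -> _](_ : _ = \int[mu]_x (`|(h x)%:E| * (rho x)%:E))%E//.
  by apply: eq_integral => x _; rewrite EFinM abseM [X in (_ * X)%E]gee0_abs// lee_fin.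
rewrite /Rintegral; congr fine; rewrite integralE [RHS]integralE; congr (_ - _)%E.
  transitivity (\int[P]_o (EFin \o h)^\+ (w k o))%E.
    by apply: eq_integral => o _; rewrite !funeposE.
  rewrite ge0_expectation_density//; last exact: measurable_funepos.
  by apply: eq_integral => x _; rewrite !funeposE /= -!EFin_max -EFinM maxr_pMl// mul0r.
transitivity (\int[P]_o (EFin \o h)^\- (w k o))%E.
  by apply: eq_integral => o _; rewrite !funenegE.
rewrite ge0_expectation_density//; last exact: measurable_funeneg.
apply: eq_integral => x _; rewrite !funenegE /= -!EFin_max -EFinM.
by rewrite maxr_pMl// mul0r mulNr.
Qed.

(** The quotient [F / rho], evaluated at the samples, has expectation the integral
    of [F], because [rho] vanishes only on a null set. *)
Lemma importance_sampling (F : 'cV[R]_n -> R) :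
  measurable_fun setT F -> mu.-integrable setT (EFin \o F) ->
  {ae P, forall o, (\sum_(k < N) F (w k o) / rho (w k o)) / N%:R @[N --> \oo] -->
    \int[mu]_x F x}.
Proof.
move=> mF iF; pose h x := F x / rho x.
have mh : measurable_fun setT h.
  by apply: measurable_funM => //; exact: measurable_inv_ge0.
have hF : ae_eq mu setT (fun x => (h x * rho x)%:E) (EFin \o F).
  have [_ _ + _] := rhoP; apply: filterS => x rx _ /=.
  by rewrite /h divfK// gt_eqF.
have mhr : measurable_fun setT (fun x => (h x * rho x)%:E).
  by apply/measurable_EFinP; exact: measurable_funM.
have hi : mu.-integrable setT (fun x => (h x * rho x)%:E).
  apply/integrableP; split=> //; have /integrableP[mFE] := iF.
  rewrite [X in (X < _)%E -> _](_ : _ = \int[mu]_x `|(h x * rho x)%:E|)%E//.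
  apply: ae_eq_integral => //; [exact: measurableT_comp|exact: measurableT_comp|].
  by apply: filterS hF => x E I; rewrite E.
have mX k : measurable_fun setT (h \o w k) by exact: measurableT_comp.
pose X k : {RV P >-> R} := HB.pack (h \o w k) (isMeasurableFun.Build _ _ _ _ _ (mX k)).
have mB B : measurable B -> measurable (h @^-1` B).
  by move=> mB; rewrite -[X in measurable X]setTI; exact: mh.
have [iX EX] := expectation_density 0 mh hi.
have EF : \int[P]_o X 0 o = \int[mu]_x F x.
  rewrite [LHS]EX /Rintegral; congr fine; apply: ae_eq_integral => //.
  exact/measurable_EFinP.
rewrite -EF; apply: (@strong_law _ _ _ P X _ _ iX) => [k B /mB mB'|i j B C ij mB' mC'].
  by apply: etrans (w_distr k mB') _; apply: esym; exact: (w_distr 0 mB').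
pose E k := if k == i then h @^-1` B else h @^-1` C.
have mE k : measurable (E k) by rewrite /E; case: ifP => _; exact: mB.
have uij : uniq [:: i; j] by rewrite /= inE ij.
have := w_indep uij mE; rewrite !big_cons big_nil mule1 /E eqxx eq_sym (negbTE ij) => <-.
congr (P _); apply/seteqP; split => o /=.
  by move=> [Bo Co] k; rewrite /= !inE => /orP[/eqP->|/eqP->]; rewrite ?eqxx// eq_sym (negbTE ij).
move=> H; split.
  by have := H i; rewrite /= inE eqxx => /(_ isT).
by have := H j; rewrite /= !inE eqxx orbT eq_sym (negbTE ij) => /(_ isT).
Qed.

Lemma Cimportance_sampling (F : 'cV[R]_n -> R[i]) : Cmeasurable F ->
  mu.-integrable setT (EFin \o (fun x => complex.Re (F x))) ->
  mu.-integrable setT (EFin \o (fun x => complex.Im (F x))) ->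
  {ae P, forall o,
    (fun N => N%:R^-1 * \sum_(k < N) F (w k o) * ((rho (w k o))^-1)%:C : R[i]^o) @ \oo -->
    (Cintegral mu F : R[i]^o)}.
Proof.
move=> [m1 m2] i1 i2.
apply: filterS2 (importance_sampling m1 i1) (importance_sampling m2 i2) => o c1 c2.
have natC N : (N%:R^-1 : R[i]) = (N%:R^-1)%:C by rewrite fmorphV rmorph_nat.
apply: cvg_complex.
  apply: cvg_trans c1; apply: near_eq_cvg; apply: nearW => N.
  rewrite natC complex_ReM /= mul0r subr0 mulrC raddf_sum; congr (_ * _).
  by apply: eq_bigr => k _; rewrite /= complex_ReM /= mulr0 subr0.
apply: cvg_trans c2; apply: near_eq_cvg; apply: nearW => N.
rewrite natC complex_ImM /= mul0r addr0 mulrC raddf_sum; congr (_ * _).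
by apply: eq_bigr => k _; rewrite /= complex_ImM /= mulr0 add0r.
Qed.

End importance_sampling.


(** * The integrand of the Herman-Kluk expectation *)

Section integrand.
Context {R : realType} {D : nat} (eps : R) (Gamma : 'M[R]_D).
Hypothesis eps_gt0 : 0 < eps.
Hypothesis Gamma_sym : Gamma^T = Gamma.
Hypothesis Gamma_pos : forall v : 'cV[R]_D, v != 0 -> 0 < (v^T *m Gamma *m v) ord0 ord0.
Variable V : 'cV[R]_D -> R.
Hypothesis V_sub : subquadratic V.
Local Notation phase := 'cV[R]_(D + D).
Local Notation normc := (@Normc.normc R).
Local Notation g := (gaussian eps Gamma).
Variable flow : R -> phase -> phase.
Hypothesis flowP : is_flow V flow.
Variable S : R -> phase -> R.
Hypothesis SP : is_action V flow S.
Variable M : R -> phase -> 'M[R]_(D + D).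
Hypothesis MP : is_stability V flow M.
Variable r : R -> phase -> R[i].
Hypothesis rP : is_HK_root Gamma M r.
Variable psi : 'cV[R]_D -> R[i].
Hypothesis psi_schwartz : schwartz psi.
Variable A : ('cV[R]_D -> R[i]) -> ('cV[R]_D -> R[i]).
Variable a : phase -> 'cV[R]_D -> R[i].
Hypothesis a_tame : tameC a.
Hypothesis AE : forall z, A (g z) = (fun x => a z x * g z x).
Variable t : R.
Hypothesis t0 : 0 <= t.

Definition HK_integrand w :=
  HK_f0 eps Gamma psi w * HK_Phi eps S r t w * HK_O eps Gamma flow A t w.

Let mu1 : measurable_fun setT (fun w : 'cV[R]_((D + D) + (D + D)) => usubmx w).
Proof. exact: measurable_usubmx. Qed.

Let mu2 : measurable_fun setT (fun w : 'cV[R]_((D + D) + (D + D)) => dsubmx w).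
Proof. exact: measurable_dsubmx. Qed.

Lemma Cmeasurable_HK_integrand : Cmeasurable HK_integrand.
Proof.
have mr := Cmeasurable_HK_root Gamma_sym Gamma_pos V_sub flowP MP rP t0.
have mS : measurable_fun setT (S t).
  exact: continuous_cV_measurable (continuous_action V_sub flowP SP t0).
have mf := measurable_flow V_sub flowP t0.
apply: CmeasurableM; first apply: CmeasurableM.
- apply: CmeasurableM; first apply: CmeasurableM.
  + exact: Cmeasurable_cst.
  + exact: Cmeasurable_comp (Cmeasurable_inner_l eps Gamma psi_schwartz) mu1.
  + exact: Cmeasurable_comp (Cmeasurable_inner_r eps Gamma psi_schwartz) mu2.
- apply: CmeasurableM; first apply: CmeasurableM.
  + apply: Cmeasurable_conj; apply: CmeasurableM; first exact: Cmeasurable_cst.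
    exact: Cmeasurable_comp mr mu1.
  + by apply: CmeasurableM; [exact: Cmeasurable_cst|exact: Cmeasurable_comp mr mu2].
  + apply: Cmeasurable_expC; apply: CmeasurableM; last exact: Cmeasurable_cst.
    apply: CmeasurableM; first exact: Cmeasurable_cst.
    by apply: Cmeasurable_real; apply: measurable_funB; exact: measurableT_comp mS _.
rewrite (_ : HK_O _ _ _ _ _ = fun w => inner (g (flow t (usubmx w)))
  (fun x => a (flow t (dsubmx w)) x * g (flow t (dsubmx w)) x)); last first.
  by apply/funext => w; rewrite /HK_O AE.
apply: (Cmeasurable_comp (Cmeasurable_matrix_element eps Gamma a_tame)
  (h := fun w => (flow t (usubmx w), flow t (dsubmx w)))).
by apply/measurable_fun_pairP; split; exact: measurableT_comp mf _.
Qed.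

(** The inner products with the Schwartz function decay faster than the matrix
    element grows, and the remaining factors are bounded. *)
Lemma HK_integrand_bound : exists C : R, forall w, normc (HK_integrand w) <= C * weight w.
Proof.
have [Cr Cr0 Hr] := HK_root_bound V_sub flowP MP rP t0.
have [Cf Cf0 Hf] := flow_growth V_sub flowP t0.
have [Co [k [Co0 Ho]]] := matrix_element_bound eps_gt0 Gamma_pos a_tame.
pose N := (2 * ((D + D) + (D + D)))%N.
have [Cp Cp0 Hp] := inner_gaussian_decay eps_gt0 Gamma_pos psi_schwartz (N + k).
pose c1 := normc (((2 * pi * eps) ^- (2 * D))%:C : R[i]).
pose c2 := normc ((2 `^ (- (D%:R / 2)))%:C : R[i]).
exists (c1 * Cp ^+ 2 * (c2 * Cr) ^+ 2 * (Co * Cf ^+ k)) => w.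
have c10 : 0 <= c1 by exact: normc_ge0.
have c20 : 0 <= c2 by exact: normc_ge0.
set y := usubmx w; set z := dsubmx w.
have [by0 bz0] : 0 < bracket y /\ 0 < bracket z by split; exact: bracket_gt0.
have B1 : normc (HK_f0 eps Gamma psi w) <=
    c1 * (Cp * bracket y ^- (N + k)) * (Cp * bracket z ^- (N + k)).
  have [h1 _] := Hp y; have [_ h2] := Hp z.
  rewrite /HK_f0 -/y -/z [X in X <= _]Normc.normcM [X in X * _ <= _]Normc.normcM -/c1.
  apply: ler_pM h2; [by apply: mulr_ge0 => //; exact: normc_ge0|exact: normc_ge0|].
  exact: ler_wpM2l h1.
have BR x : normc (HK_prefactor D (r t x)) <= c2 * Cr.
  by rewrite /HK_prefactor Normc.normcM -/c2 ler_wpM2l.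
have B2 : normc (HK_Phi eps S r t w) <= (c2 * Cr) ^+ 2.
  have phase1 : normc (expC ('i%C * (S t z - S t y)%:C / eps%:C)) = 1.
    rewrite -[RHS](normc_expCi ((S t z - S t y) / eps)); congr (normc (expC _)).
    by rewrite -mulrA rmorphM fmorphV.
  rewrite /HK_Phi -/y -/z [X in X <= _]Normc.normcM phase1 mulr1 [X in X <= _]Normc.normcM.
  by rewrite normc_conj expr2 ler_pM ?normc_ge0.
have B3 : normc (HK_O eps Gamma flow A t w) <= Co * Cf ^+ k * bracket z ^+ k.
  rewrite /HK_O AE -/y -/z -mulrA -exprMn; apply: le_trans (Ho _ _) _.
  by rewrite ler_wpM2l// lerXn2r ?nnegrE ?mulr_ge0 ?bracket_ge0.
rewrite /HK_integrand [X in X <= _]Normc.normcM [X in X * _ <= _]Normc.normcM.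
apply: (@le_trans _ _ (c1 * (Cp * bracket y ^- (N + k)) * (Cp * bracket z ^- (N + k)) *
   (c2 * Cr) ^+ 2 * (Co * Cf ^+ k * bracket z ^+ k))).
  apply: ler_pM B3; [by apply: mulr_ge0; exact: normc_ge0|exact: normc_ge0|].
  by apply: ler_pM B1 B2; exact: normc_ge0.
have Y0 : 0 < bracket y ^+ N by exact: bracketX_gt0.
have Z0 : 0 < bracket z ^+ N by exact: bracketX_gt0.
have Zk : 0 < bracket z ^+ k by exact: bracketX_gt0.
have Yk : 0 < bracket y ^+ k by exact: bracketX_gt0.
rewrite [leLHS](_ : _ = c1 * Cp ^+ 2 * (c2 * Cr) ^+ 2 * (Co * Cf ^+ k) *
   (bracket y ^- k * (bracket y * bracket z) ^- N)); last first.
  move/lt0r_neq0 in Y0; move/lt0r_neq0 in Z0; move/lt0r_neq0 in Zk; move/lt0r_neq0 in Yk.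
  move: Y0 Z0 Zk Yk; rewrite (exprD (bracket y)) (exprD (bracket z)) [(bracket y * _) ^+ _]exprMn.
  move: (bracket y ^+ N) (bracket z ^+ N) (bracket y ^+ k) (bracket z ^+ k) (Cf ^+ k) => Y Z Yk Zk K.
  by move=> Y0 Z0 Zk0 Yk0; field; rewrite Y0 Z0 Zk0 Yk0.
apply: ler_wpM2l; first by rewrite !mulr_ge0 ?exprn_ge0 ?mulr_ge0.
apply: le_trans (weight_bracket w); apply: (@le_trans _ _ ((bracket y * bracket z) ^- N)).
  by rewrite ler_piMl ?invr_ge0 ?exprn_ge0 ?mulr_ge0 ?bracket_ge0// invf_le1// bracketX_ge1.
rewrite lef_pV2 ?posrE ?exprn_gt0 ?mulr_gt0 ?bracket_gt0// lerXn2r ?nnegrE ?mulr_ge0 ?bracket_ge0//.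
exact: bracket_vsubmx.
Qed.

End integrand.

Theorem lemma3 (R : realType) (D : nat) (D_ge1 : (1 <= D)%N)
  (eps : R) (eps_gt0 : 0 < eps)
  (Gamma : 'M[R]_D) (Gamma_sym : Gamma^T = Gamma)
  (Gamma_pos : forall v : 'cV[R]_D, v != 0 ->
     0 < (v^T *m Gamma *m v) ord0 ord0)
  (V : 'cV[R]_D -> R) (V_subquadratic : subquadratic V)
  (flow : R -> 'cV[R]_(D + D) -> 'cV[R]_(D + D)) (flowP : is_flow V flow)
  (S : R -> 'cV[R]_(D + D) -> R) (SP : is_action V flow S)
  (M : R -> 'cV[R]_(D + D) -> 'M[R]_(D + D)) (MP : is_stability V flow M)
  (r : R -> 'cV[R]_(D + D) -> R[i]) (rP : is_HK_root Gamma M r)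
  (n : nat) (j : 'I_D) (A : ('cV[R]_D -> R[i]) -> ('cV[R]_D -> R[i]))
  (AP : [\/ A = id, A = iter n (qhat j), A = iter n (phat eps j)
          | A = Hhat eps V])
  (tau : R) (tau_gt0 : 0 < tau)
  (rho : 'cV[R]_((D + D) + (D + D)) -> R) (rhoP : prob_density rho)
  (psi0 : 'cV[R]_D -> R[i]) (psi0_schwartz : schwartz psi0)
  (psi0_norm : L2norm psi0 = 1)
  (d : measure_display) (Omega : measurableType d) (P : probability Omega R)
  (w : nat -> {RV P >-> 'cV[R]_((D + D) + (D + D))})
  (w_distr : forall k, has_density (w k) rho)
  (w_indep : mutually_independent w) :
  forall t : R, 0 <= t <= tau ->
  {ae P, forall omega,
     (HK_estimator eps Gamma psi0 flow S r A rho (fun k => w k omega) t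
        : nat -> R[i]^o) @ \oo -->
     (HK_expectation eps Gamma psi0 flow S r A t : R[i]^o)}.
Proof.
move=> t /andP[t0 _].
have [a a_tame AE] := observable_symbol Gamma (tame_V V_subquadratic (D + D)) AP.
have mF := Cmeasurable_HK_integrand Gamma_sym Gamma_pos V_subquadratic flowP SP MP rP
  psi0_schwartz a_tame AE t0.
have [C FC] := HK_integrand_bound eps_gt0 Gamma_pos V_subquadratic flowP S MP rP
  psi0_schwartz a_tame AE t0.
have [i1 i2] := Cintegrable_dominated mF FC.
have := Cimportance_sampling rhoP w_distr w_indep mF i1 i2.
apply: filterS => omega; apply: cvg_trans; apply: near_eq_cvg; apply: nearW => N.
rewrite /HK_estimator; congr (_ * _); apply: eq_bigr => k _.
rewrite /HK_integrand fmorphV.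
by rewrite [LHS]mulrAC [X in X * _ = _]mulrAC.
Qed.
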